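(* Let $Y\subset\mathbb P^5$ be a smooth quintic Del Pezzo surface and let $C\in|\mathcal O_Y(2)|$ be a reduced curve such that $F:=F_C=\mathbb P(A)\cdot\mathbb G$ is a Morin-Del Pezzo configuration. Let $u\in F$ be the point corresponding to $P_5$, and let $V_A\subset\mathbb P^2\times\mathbb P^2$ be the bidegree $(2,2)$ hypersurface defined by $(A,u)$. In the ambient space $\mathbb P^5$ of $C$ the base locus of the net of quadrics $P_5$ is a Segre product $\mathbb P^1\times\mathbb P^2\supset C$. Let $\mathcal J$ be the ideal sheaf of $C$ in $\mathbb P^1\times\mathbb P^2$, let $q:\mathbb P^1\times\mathbb P^2\dashrightarrow\mathbb P^2$ be the rational map defined by the net $|\mathcal J(2,2)|$, and let $p:\mathbb P^1\times\mathbb P^2\to\mathbb P^2$ be the projection. Then $$q\times p:\ \mathbb P^1\times\mathbb P^2\dashrightarrow\mathbb P^2\times\mathbb P^2$$ is birational onto its image, and its image is $V_A$ (under a suitable identification of $\mathbb P^2\times\mathbb P^2$ with $P_u\times P_u^\perp$).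
   Context: The base field is $\mathbb C$. $F_C$: put $W=H^0(\mathcal I_C(2))$ (dimension $6$), so $\mathbb P(W)=\mathbb P^5_C$ is the space of quadrics through $C$. The hyperplane $\mathbb P^4_Y$ of quadrics through $Y$ contains exactly five planes $P_1,\dots,P_5$ whose union is the locus of quadrics of rank $\le4$; $P_i$ is the net of quadrics containing the Segre threefold $\Sigma_i\cong\mathbb P^1\times\mathbb P^2$ swept out by the planes of the conics of one of the five pencils of conics of $Y$. For $z\in\operatorname{Sing}C$, $P_z$ is the net of quadrics through $C$ singular at $z$. $F_C=\{P_1,\dots,P_5,P_z,\ z\in\operatorname{Sing}C\}\subset\mathbb G$, where $\mathbb G\subset\mathbb P(\wedge^3W)$ is the Grassmannian of planes of $\mathbb P(W)$. Morin configuration: a closed scheme $F\subset\mathbb G$ with $F=\bigcap_{e\in F}\{e'\in\mathbb G : P_{e'}\cap P_e\neq\emptyset\}$. Equivalently $\langle F\rangle=\mathbb P(A)$, $F=\mathbb P(A)\cdot\mathbb G$ with $A$ Lagrangian for the wedge pairing on $\wedge^3W$. A Morin-Del Pezzo configuration is a finite Morin configuration which contains with multiplicity one a $5$-tuple projectively equivalent to $\{P_1,\dots,P_5\}$. $V_A$: let $P_u=\mathbb P(U)$ and let $P_u^\perp=\mathbb P(\wedge^2(W/U))$ be the net of hyperplanes through $P_u$. Let $W^i_u$ be the image of $\wedge^iU\otimes\wedge^{3-i}W$ in $\wedge^3W$; then $A\subset W_u^1$, $A\cap W^2_u=\wedge^3U$, and $A/\wedge^3U\cong W_u^1/W_u^2\cong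 U\otimes\wedge^2(W/U)$. Choose a complement $V$ of $U$ and write $a\in A$ as $a=a_1+a_2+a_3$, $a_1\in U\wedge(\wedge^2V)$, $a_2\in(\wedge^2U)\wedge V$, $a_3\in\wedge^3U$. For $a\in A$ lying over a point $(x,y)$ of the Segre variety $P_u\times P_u^\perp\subset\mathbb P(W_u^1/W_u^2)$, $a_1\wedge a_2\in\wedge^6W$ defines a section of $\mathcal O(2,2)$ independent of $V$; $V_A$ is its divisor of zeros. Identifications of $P_u\times P_u^\perp$ with $\mathbb P^2\times\mathbb P^2$ are linear on each factor, and the factors may be taken in either order. *)

(* Defs.v *)
From HB Require Import structures.
From mathcomp Require Import all_boot all_order all_algebra.
From mathcomp Require Export reals complex.
From mathcomp Require Export mpoly.

Set Implicit Arguments.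
Unset Strict Implicit.
Unset Printing Implicit Defensive.
Import GRing.Theory.
Local Open Scope ring_scope.

(** * Polynomials

    Subschemes are given by ideals, and an ideal (or a linear system of forms)
    is a predicate on a polynomial ring.  Points of projective space are nonzero
    row vectors. *)

Definition peval (K : fieldType) n (g : {mpoly K[n]}) (v : 'rV[K]_n) : K :=
  g.@[fun i => v 0 i].

Definition psubst (K : fieldType) m n (F : 'I_m -> {mpoly K[n]})
    (g : {mpoly K[m]}) : {mpoly K[n]} :=
  g \mPo [tuple F i | i < m].

Definition lcomb (K : fieldType) m n (b : 'I_m -> {mpoly K[n]}) (a : 'rV[K]_m) :
    {mpoly K[n]} :=
  \sum_(i < m) a 0 i *: b i.

Definition lin_basis (K : fieldType) m n (S : {mpoly K[n]} -> Prop)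
    (b : 'I_m -> {mpoly K[n]}) : Prop :=
  (forall g, S g <-> exists a, g = lcomb b a) /\
  (forall a, lcomb b a = 0 -> a = 0).

(* Membership in the saturation of an ideal with respect to the irrelevant
   ideal, i.e. vanishing on the projective scheme defined by the ideal. *)
Definition saturation (K : fieldType) n (I : {mpoly K[n]} -> Prop)
    (g : {mpoly K[n]}) : Prop :=
  exists d : nat, forall h : {mpoly K[n]}, h \is d.-homog -> I (h * g).

(* Bihomogeneous of bidegree (d, e) in two groups of m and n variables. *)
Definition bihomog (K : fieldType) m n (d e : nat) (g : {mpoly K[m + n]}) : Prop :=
  forall mu, mu \in msupp g ->
    (\sum_(i < m) mu (lshift n i) = d)%N /\ (\sum_(j < n) mu (rshift m j) = e)%N.

(** * Quintic Del Pezzo surfaces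

    A smooth quintic Del Pezzo surface is the blow-up of P^2 at four points
    p_0, .., p_3, no three of them on a line, embedded in P^5 by (any basis f
    of) the space of cubics through the four points. *)

Definition general_position (K : fieldType) (p : 'I_4 -> 'rV[K]_3) : Prop :=
  forall s : 'I_3 -> 'I_4, injective s -> row_free (\matrix_(i < 3) p (s i)).

Definition cubics_through (K : fieldType) (p : 'I_4 -> 'rV[K]_3)
    (c : {mpoly K[3]}) : Prop :=
  c \is 3.-homog /\ forall i, peval c (p i) = 0.

(* Homogeneous ideal of Y, the closure of the image of P^2 under f. *)
Definition dP_ideal (K : fieldType) (f : 'I_6 -> {mpoly K[3]})
    (g : {mpoly K[6]}) : Prop :=
  psubst f g = 0.

(* The five pencils of conics of Y: for [Some i], the lines through p_i; for
   [None], the plane conics through p_0, .., p_3. *)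
Definition assigned (k : option 'I_4) (i : 'I_4) : bool :=
  if k is Some i0 then i == i0 else true.

Definition pencil_member (K : fieldType) (p : 'I_4 -> 'rV[K]_3)
    (k : option 'I_4) (D : {mpoly K[3]}) : Prop :=
  [/\ D != 0, D \is (if k is Some _ then 1%N else 2%N).-homog &
      forall i, assigned k i -> peval D (p i) = 0].

(* The plane spanned by the conic of Y given by D.  The hyperplane of equation
   l contains that conic when the plane cubic \sum_i l_i f_i is D plus a curve
   through the p_i that are not assigned base points of D; this accounts for
   the exceptional components of the reducible conics. *)
Definition conic_plane (K : fieldType) (p : 'I_4 -> 'rV[K]_3)
    (f : 'I_6 -> {mpoly K[3]}) (k : option 'I_4) (D : {mpoly K[3]})
    (v : 'rV[K]_6) : Prop :=
  forall l : 'rV[K]_6,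
    (exists g, lcomb f l = D * g /\
       forall i, ~~ assigned k i -> peval g (p i) = 0) ->
    \sum_(i < 6) l 0 i * v 0 i = 0.

Definition segre_threefold (K : fieldType) (p : 'I_4 -> 'rV[K]_3)
    (f : 'I_6 -> {mpoly K[3]}) (k : option 'I_4) (v : 'rV[K]_6) : Prop :=
  exists D, pencil_member p k D /\ conic_plane p f k D v.

Definition segre_net (K : fieldType) (p : 'I_4 -> 'rV[K]_3)
    (f : 'I_6 -> {mpoly K[3]}) (k : option 'I_4) (q : {mpoly K[6]}) : Prop :=
  q \is 2.-homog /\ forall v, segre_threefold p f k v -> peval q v = 0.

(** * The curve C = Y . {Q = 0}

    Y is projectively normal, so that the members of |O_Y(2)| are the sections
    of Y by the quadrics Q not containing Y, and it is arithmetically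
    Cohen-Macaulay, so that I_Y + (Q) is the saturated homogeneous ideal of
    C. *)

Definition curve_ideal (K : fieldType) (f : 'I_6 -> {mpoly K[3]})
    (Q g : {mpoly K[6]}) : Prop :=
  exists h, dP_ideal f (g - h * Q).

Definition reduced (K : fieldType) n (I : {mpoly K[n]} -> Prop) : Prop :=
  forall g k, I (g ^+ k) -> I g.

Definition quadrics_through (K : fieldType) (I : {mpoly K[6]} -> Prop)
    (q : {mpoly K[6]}) : Prop :=
  q \is 2.-homog /\ I q.

(* The ideal of the scheme Sing C: C has codimension 4, and its ideal sheaf is
   generated by the quadrics w_0, .., w_5, so that Sing C is cut out on C by
   the 4 x 4 minors of the Jacobian matrix of w. *)
Definition jacobian_minor (K : fieldType) m n (w : 'I_m -> {mpoly K[n]}) (t : nat)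
    (r : 'I_t -> 'I_m) (c : 'I_t -> 'I_n) : {mpoly K[n]} :=
  \det (\matrix_(i < t, j < t) (w (r i))^`M(c j)).

Definition sing_ideal (K : fieldType) (I : {mpoly K[6]} -> Prop)
    (w : 'I_6 -> {mpoly K[6]}) (g : {mpoly K[6]}) : Prop :=
  exists h : {ffun 'I_4 -> 'I_6} -> {ffun 'I_4 -> 'I_6} -> {mpoly K[6]},
    I (g - \sum_r \sum_c h r c * jacobian_minor w r c).

(** * The exterior algebra of K^6

    An element is the family of its coordinates on the basis
    e_S = e_i1 /\ .. /\ e_ik, S = {i1 < .. < ik}. *)

Definition ext (K : fieldType) := {ffun {set 'I_6} -> K^o}.

(* e_S /\ e_T = shuffle_sign S T * e_(S :|: T) for disjoint S and T. *)
Definition shuffle_sign (K : fieldType) (S T : {set 'I_6}) : K :=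
  (-1) ^+ #|[set x : 'I_6 * 'I_6 | [&& x.1 \in S, x.2 \in T & (x.2 < x.1)%N]]|.

Definition wedge (K : fieldType) (x y : ext K) : ext K :=
  [ffun S : {set 'I_6} => \sum_(T : {set 'I_6} | T \subset S)
     shuffle_sign K T (S :\: T) * x T * y (S :\: T)].

Definition ext_basis (K : fieldType) (S : {set 'I_6}) : ext K :=
  [ffun T : {set 'I_6} => (T == S)%:R].

Definition ext_vec (K : fieldType) (v : 'rV[K]_6) : ext K :=
  \sum_(i < 6) v 0 i *: ext_basis K [set i].

(* Plucker vector of the plane P(U), U the row space of M (it is zero if the
   rows of M are dependent). *)
Definition plucker (K : fieldType) (M : 'M[K]_(3, 6)) : ext K :=
  wedge (wedge (ext_vec (row ord0 M)) (ext_vec (row (inord 1) M)))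
        (ext_vec (row ord_max M)).

Definition lagrangian (K : fieldType) (A : {vspace ext K}) : Prop :=
  [/\ forall a, a \in A -> forall S : {set 'I_6}, #|S| != 3 -> a S = 0,
      forall a b, a \in A -> b \in A -> wedge a b = 0 &
      (\dim A = 10)%N].

(** * Subschemes of the Grassmannian of planes of P(W)

    W is identified with K^6 by means of a basis.  Subschemes of
    P(/\^3 W) are given by ideals in the polynomial ring on all the
    coordinates of the exterior algebra. *)

Notation ext_dim := #|{: {set 'I_6}}|.

Definition ext_eval (K : fieldType) (g : {mpoly K[ext_dim]}) (x : ext K) : K :=
  g.@[fun i => x (enum_val i)].

(* Ideal of the scheme-theoretic intersection P(A) . G: the sum of the ideal
   of the cone over G and of the ideal of A. *)
Definition section_ideal (K : fieldType) (A : {vspace ext K})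
    (g : {mpoly K[ext_dim]}) : Prop :=
  exists g1 g2, [/\ g = g1 + g2,
    forall M, ext_eval g1 (plucker M) = 0 &
    forall a, a \in A -> ext_eval g2 a = 0].

(* The local ring at the point x of the scheme defined by I is the base
   field. *)
Definition multiplicity_one (K : fieldType) (I : {mpoly K[ext_dim]} -> Prop)
    (x : ext K) : Prop :=
  forall d (g : {mpoly K[ext_dim]}), g \is d.-homog -> ext_eval g x = 0 ->
    exists h, ext_eval h x != 0 /\ I (h * g).

(* F = P(A) . G with A Lagrangian and <F> = P(A), where <F> is the linear span
   of the scheme F. *)
Definition morin_configuration (K : fieldType) (A : {vspace ext K}) : Prop :=
  lagrangian A /\
  forall l : {mpoly K[ext_dim]}, l \is 1.-homog -> saturation (section_ideal A) l ->
    forall a, a \in A -> ext_eval l a = 0.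

Definition finite_section (K : fieldType) (A : {vspace ext K}) : Prop :=
  exists s : seq (ext K), forall M, plucker M \in A ->
    exists2 y, y \in s & exists c : K, plucker M = c *: y.

(* P gives bases of the five planes P_1, .., P_5.  The last clause says that
   P(A) . G contains, with multiplicity one, a 5-tuple projectively equivalent
   to them; all smooth quintic Del Pezzo surfaces are projectively equivalent,
   so that the surface used to define P does not matter. *)
Definition morin_del_pezzo (K : fieldType) (J : Type) (P : J -> 'M[K]_(3, 6))
    (A : {vspace ext K}) : Prop :=
  [/\ morin_configuration A, finite_section A &
      exists2 g : 'M[K]_6, g \in unitmx &
        forall k, plucker (P k *m g) \in A /\
                  multiplicity_one (section_ideal A) (plucker (P k *m g))].

(* For z in Sing C, P_z is the plane of the a in W with a *m J(z) = 0, where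
   J(z) is the 6 x 6 Jacobian matrix of the basis w of W, which has rank 3 at
   z.  Its Plucker coordinates are the complementary 3 x 3 minors, with sign,
   of any three columns c of J(z) of rank 3. *)
Definition sing_plucker (K : fieldType) (w : 'I_6 -> {mpoly K[6]})
    (c : 'I_3 -> 'I_6) (S : {set 'I_6}) : {mpoly K[6]} :=
  if #|S| == 3%N then
    shuffle_sign K S (~: S) *:
      jacobian_minor w (fun i : 'I_3 => nth ord0 (enum (~: S)) i) c
  else 0.

(* Homogeneous ideal of F_C.  A Morin configuration is a scheme: when C is not
   nodal, F_C carries at the points P_z the structure of the scheme Sing C.
   The ideal consists of the forms vanishing at P_1, .., P_5 and on the
   image of the scheme Sing C under z |-> P_z. *)
Definition FC_ideal (K : fieldType) (J : Type) (P : J -> 'M[K]_(3, 6))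
    (I : {mpoly K[6]} -> Prop) (w : 'I_6 -> {mpoly K[6]})
    (g : {mpoly K[ext_dim]}) : Prop :=
  (forall k, ext_eval g (plucker (P k)) = 0) /\
  (forall c : 'I_3 -> 'I_6, saturation (sing_ideal I w)
     (psubst (fun i => sing_plucker w c (enum_val i)) g)).

Definition FC_eq_section (K : fieldType) (J : Type) (P : J -> 'M[K]_(3, 6))
    (I : {mpoly K[6]} -> Prop) (w : 'I_6 -> {mpoly K[6]})
    (A : {vspace ext K}) : Prop :=
  forall d (g : {mpoly K[ext_dim]}), g \is d.-homog ->
    (FC_ideal P I w g <-> saturation (section_ideal A) g).

(* The rows of M are a basis of the linear system N contained in W. *)
Definition net_basis (K : fieldType) (w : 'I_6 -> {mpoly K[6]})
    (N : {mpoly K[6]} -> Prop) (M : 'M[K]_(3, 6)) : Prop :=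
  lin_basis N (fun i => lcomb w (row i M)).

(** * The hypersurface V_A

    U, V are 3 x 6 matrices whose rows are bases of U and of the complement V.
    Coordinates: xi on U, and eta on /\^2 V = /\^2 (W/U), in the basis
    V_(i+1) /\ V_(i+2), indices mod 3. *)

Definition bivector (K : fieldType) (M : 'M[K]_(3, 6)) (i : 'I_3) : ext K :=
  wedge (ext_vec (row (ordS i) M)) (ext_vec (row (ordS (ordS i)) M)).

Definition segre_vector (K : fieldType) (U V : 'M[K]_(3, 6)) (xi eta : 'rV[K]_3) :
    ext K :=
  wedge (ext_vec (xi *m U)) (\sum_(i < 3) eta 0 i *: bivector V i).

(* a2 is the (/\^2 U) /\ V component of an element a of A whose U /\ (/\^2 V)
   component is a1. *)
Definition second_component (K : fieldType) (A : {vspace ext K})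
    (U V : 'M[K]_(3, 6)) (a1 a2 : ext K) : Prop :=
  (exists c : 'M[K]_3, a2 =
     \sum_(i < 3) \sum_(j < 3) c i j *: wedge (bivector U i) (ext_vec (row j V))) /\
  exists c : K, a1 + a2 + c *: plucker U \in A.

(* s is the bidegree (2, 2) equation a1 /\ a2 of V_A on P_u x P_u^perp. *)
Definition VA_equation (K : fieldType) (A : {vspace ext K}) (U V : 'M[K]_(3, 6))
    (s : {mpoly K[3 + 3]}) : Prop :=
  bihomog 2 2 s /\
  forall xi eta : 'rV[K]_3,
    (exists a2, second_component A U V (segre_vector U V xi eta) a2) /\
    (forall a2, second_component A U V (segre_vector U V xi eta) a2 ->
       wedge (segre_vector U V xi eta) a2 =
         peval s (row_mx xi eta) *: ext_basis K [set: 'I_6]).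

(** * The Segre product P^1 x P^2 and the map q x p

    The polynomial ring of P^1 x P^2 has 2 + 3 variables, t_0, t_1 and
    x_0, x_1, x_2. *)

(* The embedding K^2 (x) K^3 -> K^6 of matrix L, in coordinates. *)
Definition segre_map (K : fieldType) (L : 'M[K]_(2 * 3, 6)) (k : 'I_6) :
    {mpoly K[2 + 3]} :=
  \sum_(i < 2) \sum_(j < 3)
     L (mxvec_index i j) k *: ('X_(lshift 3 i) * 'X_(rshift 2 j)).

Definition base_locus_is_segre (K : fieldType) (N : {mpoly K[6]} -> Prop)
    (L : 'M[K]_(2 * 3, 6)) : Prop :=
  row_free L /\
  forall v : 'rV[K]_6, (forall g, N g -> peval g v = 0) <->
    exists (t : 'rV[K]_2) (x : 'rV[K]_3), v = mxvec (t^T *m x) *m L.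

(* H^0(J(2,2)), J the ideal sheaf of C in P^1 x P^2, where C is contained in
   the image of P^1 x P^2: a form of bidegree (2, 2) is the pullback of a
   quadratic form, and vanishes on C when that form belongs to the ideal of
   C. *)
Definition J22 (K : fieldType) (I : {mpoly K[6]} -> Prop) (L : 'M[K]_(2 * 3, 6))
    (G : {mpoly K[2 + 3]}) : Prop :=
  bihomog 2 2 G /\ exists g, I g /\ G = psubst (segre_map L) g.

(* Homogeneous coordinates of q x p : P^1 x P^2 -> P^2 x P^2, the rational map
   q being given by the basis b of the net |J(2,2)|. *)
Definition q_times_p (K : fieldType) (b : 'I_3 -> {mpoly K[2 + 3]})
    (i : 'I_(3 + 3)) : {mpoly K[2 + 3]} :=
  match split i with
  | inl j => b j
  | inr j => 'X_(rshift 2 j)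
  end.

Definition same_rational_map (K : fieldType) m n (u v : 'I_m -> {mpoly K[n]}) :
    Prop :=
  [/\ exists i, u i != 0, exists i, v i != 0 &
      forall i j, u i * v j = u j * v i].

(* A rational map P^1 x P^2 -> P^2 x P^2 is birational onto its image when it
   has a rational left inverse (psi, chi). *)
Definition birational_onto_image (K : fieldType)
    (Phi : 'I_(3 + 3) -> {mpoly K[2 + 3]}) : Prop :=
  exists (psi : 'I_2 -> {mpoly K[3 + 3]}) (chi : 'I_3 -> {mpoly K[3 + 3]}),
    [/\ exists d e, forall i, bihomog d e (psi i),
        exists d e, forall i, bihomog d e (chi i),
        same_rational_map (fun i => psubst Phi (psi i)) (fun i => 'X_(lshift 3 i)) &
        same_rational_map (fun i => psubst Phi (chi i)) (fun i => 'X_(rshift 2 i))].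

(* The (closure of the) image of Phi is the hypersurface s = 0, as divisors:
   the bihomogeneous ideal of the image is generated by s. *)
Definition image_is_hypersurface (K : fieldType)
    (Phi : 'I_(3 + 3) -> {mpoly K[2 + 3]}) (s : {mpoly K[3 + 3]}) : Prop :=
  forall d e (h : {mpoly K[3 + 3]}), bihomog d e h ->
    (psubst Phi h = 0 <-> exists k, h = k * s).

(* An identification of P^2 x P^2 with P_u x P_u^perp, linear on each factor
   and exchanging the factors if [swap] is true. *)
Definition identification (K : fieldType) (swap : bool) (a b : 'M[K]_3)
    (i : 'I_(3 + 3)) : {mpoly K[3 + 3]} :=
  match split i with
  | inl j => \sum_(k < 3) a k j *: 'X_(if swap then rshift 3 k else lshift 3 k)
  | inr j => \sum_(k < 3) b k j *: 'X_(if swap then lshift 3 k else rshift 3 k)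
  end.

(* Main.v *)
(** In suitable coordinates (t, x) on the base locus P^1 x P^2 of P_u, the
    surface Y is a divisor F = t_0 q_0(x) + t_1 q_1(x) of bidegree (1, 2), and W
    is spanned by the net P_u, by two quadrics restricting to t_0 F and t_1 F,
    and by Q, which restricts to a form G of bidegree (2, 2).  Hence q x p is
    (t, x) |-> ((t_0 F : t_1 F : G), x); it has the inverse t = (y_0 : y_1), and
    its image has the equation s' = y_2 F(y_0, y_1, x) - G(y_0, y_1, x), because
    F^d h(y_0, y_1, y_2, x) = h(y_0 F, y_1 F, y_2 F, x) is congruent to
    h(y_0 F, y_1 F, G, x) modulo s', for h of degree d in y, and F can be
    cancelled modulo s'.

    The space A is recovered from explicit trivectors pi(x) and al(s, x).  As
    linear forms on /\^3 W they vanish at P_1, .., P_5 and on the scheme of the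
    P_z, z in Sing C; so they vanish on F_C, hence on A = <F_C>, and belong to A
    because A is its own orthogonal.  The vector a = y_2 pi(x) - al((y_0, y_1), x)
    lies over the point (x, y) of P_u x P_u^perp, and a_1 /\ a_2 is a constant
    multiple of s'. *)
Require Import Defs.
From mathcomp Require Import all_boot all_order all_algebra.
From mathcomp Require Import reals complex mpoly.
From mathcomp Require Import perm ring.

Set Implicit Arguments.
Unset Strict Implicit.
Unset Printing Implicit Defensive.
Import GRing.Theory Num.Theory.
Local Open Scope ring_scope.

(** * Polynomials as functions *)

(** The obstacle is membership in A. Since F_C carries the scheme structure of Sing C, vanishing at
    the points P_z is not enough: an ideal membership is required. For pi it is immediate, because
    pi is built from quadrics through Y: its form vanishes along all of Y, and its pairing with each
    P_i is a determinant of six vectors of the hyperplane of quadrics through Y. For al, which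
    involves Q, both arguments fail. Along Y, the product of al by t_a x_i is a 4 x 4 Jacobian minor
    of Q, two of the 2 x 2 minors and one phi_a, with s (x) y among the directions. The pairing of
    al(s, y) with P_i is bilinear in (s, y), hence a linear form on P^5, and since Y spans P^5 it is
    tested at points of Y. There the bivector wedged with Q is the Plucker vector of the pencil of
    quadrics through Y singular at the point, and P_i meets this pencil. This argument needs
    coordinates on each of the five Segre threefolds. The parametrization L in the theorem is
    arbitrary, so linear maps preserving rank one have to be classified. *)

Lemma digits_inj N n (f g : 'I_n -> nat) :
  (forall i, f i < N)%N -> (forall i, g i < N)%N ->
  (\sum_i f i * N ^ i = \sum_i g i * N ^ i)%N -> f =1 g.
Proof.
elim: n f g => [|n IHn] f g fN gN; first by move=> _ [].
have N0 : (0 < N)%N by apply: leq_ltn_trans (fN ord0).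
have shift (h : 'I_n.+1 -> nat) :
    (\sum_i h i * N ^ i = h ord0 + (\sum_(i < n) h (lift ord0 i) * N ^ i) * N)%N.
  rewrite big_ord_recl expn0 muln1 big_distrl /=; congr (_ + _)%N.
  by apply: eq_bigr => i _; rewrite /bump leq0n add1n expnSr mulnA.
rewrite !shift => E.
have E0 : f ord0 = g ord0.
  by move/(congr1 (modn^~ N)): E; rewrite addnC modnMDl addnC modnMDl !modn_small.
move: E; rewrite E0 => /addnI /eqP; rewrite eqn_pmul2r // => /eqP E i.
case: (unliftP ord0 i) => [j|] -> //.
by apply: (IHn (f \o lift ord0) (g \o lift ord0) _ _ E j) => k; [apply: fN|apply: gN].
Qed.

(** In characteristic zero 1, .., [size p] are distinct, which is one root too many. Only nonzero
    points are required, so that scaling arguments with an invertible factor can use it. *)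
Lemma poly_eq0_eval (K : numFieldType) (p : {poly K}) :
  (forall x, x != 0 -> p.[x] = 0) -> p = 0.
Proof.
move=> p0; apply/eqP; apply: contraT => pn0.
have := @max_poly_roots K p [seq (i.+1)%:R | i <- iota 0 (size p)] pn0.
rewrite size_map size_iota ltnn => -> //.
  by apply/allP => x /mapP[i _ ->]; rewrite /root p0 // pnatr_eq0.
by rewrite map_inj_uniq ?iota_uniq // => i j /eqP; rewrite eqr_nat => /eqP[].
Qed.

Lemma expr_sum (R : pzSemiRingType) I (r : seq I) (F : I -> nat) (x : R) :
  x ^+ (\sum_(i <- r) F i) = \prod_(i <- r) x ^+ F i.
Proof. exact: (big_morph _ (exprD x) (expr0 x)). Qed.

Section Evaluation.
Variable K : numFieldType.
Implicit Types (n : nat).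

(** Kronecker substitution: with x_i = x ^ (N ^ i) and N larger than every exponent of p, distinct
    monomials become distinct powers of x, by uniqueness of base N digits. The coefficients of p are
    thus those of a univariate polynomial. *)
Lemma mpoly_eq0_eval n (p : {mpoly K[n]}) : (forall v, peval p v = 0) -> p = 0.
Proof.
move=> p0; apply/mpolyP => m; rewrite mcoeff0.
have [ms|] := boolP (m \in msupp p); last by rewrite -mcoeff_eq0 => /eqP.
pose N := msize p; pose e (m : 'X_{1..n}) := (\sum_i m i * N ^ i)%N.
pose P : {poly K} := \sum_(m <- msupp p) p@_m *: 'X^(e m).
have PE : P = 0.
  apply: poly_eq0_eval => x _; rewrite horner_sum.
  apply: etrans (p0 (\row_i x ^+ (N ^ i))); rewrite /peval mevalE; apply: eq_bigr => k _; rewrite hornerZ hornerXn; congr (_ * _).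
  by rewrite /e expr_sum; apply: eq_bigr => i _; rewrite mxE -exprM mulnC.
have mN k i : k \in msupp p -> (k i < N)%N.
  move=> ks; apply: leq_ltn_trans (msize_mdeg_lt ks).
  by rewrite mdegE (bigD1 i) //= leq_addr.
have : P`_(e m) = p@_m.
  rewrite coef_sum (bigD1_seq m) //= coefZ coefXn eqxx mulr1 big1_seq ?addr0 // => k /andP[km ks].
  rewrite coefZ coefXn; case: eqP => [E|]; last by rewrite mulr0.
  case/eqP: km; apply/mnmP => i; symmetry; move: i.
  by apply: (@digits_inj N) => [i|i|]; [exact: mN|exact: mN|].
by rewrite PE coef0.
Qed.

Lemma peval_inj n (p q : {mpoly K[n]}) : (forall v, peval p v = peval q v) -> p = q.
Proof.
move=> pq; apply/eqP; rewrite -subr_eq0; apply/eqP/mpoly_eq0_eval => v.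
by rewrite /peval mevalB; apply/eqP; rewrite subr_eq0; apply/eqP/pq.
Qed.

Lemma pevalD n (p q : {mpoly K[n]}) v : peval (p + q) v = peval p v + peval q v.
Proof. exact: mevalD. Qed.
Lemma pevalB n (p q : {mpoly K[n]}) v : peval (p - q) v = peval p v - peval q v.
Proof. exact: mevalB. Qed.
Lemma pevalN n (p : {mpoly K[n]}) v : peval (- p) v = - peval p v.
Proof. exact: mevalN. Qed.
Lemma pevalM n (p q : {mpoly K[n]}) v : peval (p * q) v = peval p v * peval q v.
Proof. exact: mevalM. Qed.
Lemma pevalZ n c (p : {mpoly K[n]}) v : peval (c *: p) v = c * peval p v.
Proof. exact: mevalZ. Qed.
Lemma pevalXn n (p : {mpoly K[n]}) v k : peval (p ^+ k) v = peval p v ^+ k.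
Proof. exact: rmorphXn. Qed.
Lemma pevalX n i (v : 'rV[K]_n) : peval 'X_i v = v 0 i.
Proof. exact: mevalXU. Qed.
Lemma pevalC n c (v : 'rV[K]_n) : peval c%:MP v = c.
Proof. exact: mevalC. Qed.
Lemma peval0 n (v : 'rV[K]_n) : peval 0 v = 0.
Proof. exact: meval0. Qed.
Lemma peval1 n (v : 'rV[K]_n) : peval 1 v = 1.
Proof. exact: meval1. Qed.
Lemma peval_sum n I (r : seq I) (P : pred I) (F : I -> {mpoly K[n]}) v :
  peval (\sum_(i <- r | P i) F i) v = \sum_(i <- r | P i) peval (F i) v.
Proof. exact: (raddf_sum (meval (fun i => v 0 i))). Qed.

Definition pevalE := (pevalD, pevalB, pevalN, pevalM, pevalZ, pevalXn, pevalX, pevalC,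
  peval0, peval1).

Lemma peval_psubst m n (F : 'I_m -> {mpoly K[n]}) g v :
  peval (psubst F g) v = peval g (\row_i peval (F i) v).
Proof.
rewrite /peval /psubst comp_mpoly_meval; apply: meval_eq => i.
by rewrite tnth_mktuple mxE.
Qed.

Lemma peval_lcomb m n (b : 'I_m -> {mpoly K[n]}) a v :
  peval (lcomb b a) v = \sum_i a 0 i * peval (b i) v.
Proof. by rewrite /lcomb peval_sum; apply: eq_bigr => i _; rewrite pevalZ. Qed.

(** The product p q vanishes everywhere and the polynomial ring is a domain. This is the density
    argument used whenever an identity is only accessible off a proper hypersurface. *)
Lemma mpoly_mul_eq0_eval n (p q : {mpoly K[n]}) :
  (forall v, peval p v != 0 -> peval q v = 0) -> p != 0 -> q = 0.
Proof.
move=> pq p0; have /eqP : p * q = 0.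
  apply: mpoly_eq0_eval => v; rewrite pevalM.
  by have [->|/pq->] := eqVneq (peval p v) 0; rewrite ?mul0r ?mulr0.
by rewrite mulf_eq0 (negPf p0) => /eqP.
Qed.

Definition divides n (d p : {mpoly K[n]}) := exists k, p = k * d.

Lemma dividesD n (d p q : {mpoly K[n]}) : divides d p -> divides d q -> divides d (p + q).
Proof. by move=> [k ->] [l ->]; exists (k + l); rewrite mulrDl. Qed.

Lemma dividesMl n (d p q : {mpoly K[n]}) : divides d p -> divides d (q * p).
Proof. by move=> [k ->]; exists (q * k); rewrite mulrA. Qed.

Lemma mpoly_ring_ind n (P : {mpoly K[n]} -> Prop) :
  (forall c, P c%:MP) -> (forall i, P 'X_i) ->
  (forall p q, P p -> P q -> P (p + q)) -> (forall p q, P p -> P q -> P (p * q)) ->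
  forall p, P p.
Proof.
move=> PC PX PD PM; elim/mpolyind => [|c m p _ _ Pp]; first by rewrite -mpolyC0.
apply: PD => //; rewrite -mul_mpolyC; apply: (PM) => //.
rewrite mpolyXE_id; apply: (big_ind P) => [||i _]; [by rewrite -mpolyC1|exact: PM|].
by elim: (m i) => [|k IHk]; [rewrite expr0 -mpolyC1|rewrite exprS; apply: PM].
Qed.

Lemma psubstC m n (F : 'I_m -> {mpoly K[n]}) c : psubst F c%:MP = c%:MP.
Proof. exact: comp_mpolyC. Qed.
Lemma psubstX m n (F : 'I_m -> {mpoly K[n]}) i : psubst F 'X_i = F i.
Proof. by rewrite /psubst comp_mpolyXU -tnth_nth tnth_mktuple. Qed.
Lemma psubstD m n (F : 'I_m -> {mpoly K[n]}) p q : psubst F (p + q) = psubst F p + psubst F q.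
Proof. exact: comp_mpolyD. Qed.
Lemma psubstM m n (F : 'I_m -> {mpoly K[n]}) p q : psubst F (p * q) = psubst F p * psubst F q.
Proof. exact: rmorphM. Qed.

(** Congruence modulo d is compatible with sums and products, and the ring is generated by constants
    and variables. *)
Lemma divides_psubst m n (d : {mpoly K[n]}) (F G : 'I_m -> {mpoly K[n]}) p :
  (forall i, divides d (F i - G i)) -> divides d (psubst F p - psubst G p).
Proof.
have addB (a b c e : {mpoly K[n]}) : a + b - (c + e) = (a - c) + (b - e) by ring.
have mulB (a b c e : {mpoly K[n]}) : a * b - c * e = a * (b - e) + e * (a - c) by ring.
move=> FG; elim/mpoly_ring_ind: p => [c|i|p q Hp Hq|p q Hp Hq].
- by exists 0; rewrite !psubstC subrr mul0r.
- by rewrite !psubstX.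
- by rewrite !psubstD addB; apply: dividesD.
by rewrite !psubstM mulB; apply: dividesD; apply: dividesMl.
Qed.

End Evaluation.

(** * Exterior algebra of a six-dimensional space *)

Lemma card_disjointU (T : finType) (A B : {set T}) :
  [disjoint A & B] -> #|A :|: B| = (#|A| + #|B|)%N.
Proof. by move=> dAB; rewrite cardsU disjoint_setI0 // cards0 subn0. Qed.

Section Exterior.
Variable K : numFieldType.
Implicit Types (S T U : {set 'I_6}) (x y z : ext K) (v : 'rV[K]_6).

Definition inversions S T :=
  [set x : 'I_6 * 'I_6 | [&& x.1 \in S, x.2 \in T & (x.2 < x.1)%N]].

Lemma shuffle_signE S T : shuffle_sign K S T = (-1) ^+ #|inversions S T|.
Proof. by []. Qed.

Lemma shuffle_signUl S T U : [disjoint S & T] ->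
  shuffle_sign K (S :|: T) U = shuffle_sign K S U * shuffle_sign K T U.
Proof.
move=> dST; rewrite !shuffle_signE -exprD; congr (_ ^+ _).
rewrite -card_disjointU; last first.
  rewrite -setI_eq0; apply/eqP/setP => -[i j]; rewrite !inE /=.
  case: (boolP (i \in S)) => //= iS; rewrite (disjointFr dST iS) andbF //.
by apply: eq_card => -[i j]; rewrite !inE /= -andb_orl.
Qed.

Lemma shuffle_signUr S T U : [disjoint S & T] ->
  shuffle_sign K U (S :|: T) = shuffle_sign K U S * shuffle_sign K U T.
Proof.
move=> dST; rewrite !shuffle_signE -exprD; congr (_ ^+ _).
rewrite -card_disjointU; last first.
  rewrite -setI_eq0; apply/eqP/setP => -[i j]; rewrite !inE /=.
  case: (boolP (j \in S)) => jS; rewrite ?andbF // (disjointFr dST jS) /= ?andbF //.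
by apply: eq_card => -[i j]; rewrite !inE /= -andb_orr -andb_orl.
Qed.

(** Every pair in S x T is an inversion for exactly one of the two orders, so the two inversion
    counts add up to the number of pairs. *)
Lemma shuffle_sign_swap S T : [disjoint S & T] ->
  shuffle_sign K S T * shuffle_sign K T S = (-1) ^+ (#|S| * #|T|).
Proof.
move=> dST; rewrite !shuffle_signE -exprD; congr (_ ^+ _).
pose sw (x : 'I_6 * 'I_6) := (x.2, x.1).
have swI : injective sw by move=> [i j] [k l] [-> ->].
rewrite -(card_imset (inversions T S) swI) -card_disjointU; last first.
  rewrite -setI_eq0; apply/eqP/setP => -[i j]; rewrite !inE /=.
  apply/negP => /andP[/and3P[iS jT ij] /imsetP[[k l]]].
  by rewrite inE /= => /and3P[_ _ lk] [E1 E2]; move: ij lk; rewrite E1 E2 ltnNge => /negP ? /ltnW.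
rewrite -cardsX; apply: eq_card => -[i j]; rewrite !inE /=.
apply/idP/andP => [/orP[/and3P[] //|/imsetP[[k l]]]|[iS jT]].
  by rewrite inE /= => /and3P[kT lS _] [-> ->].
case: (ltngtP j i) => ij; rewrite ?iS ?jT //=.
  by apply/imsetP; exists (j, i); rewrite // inE /= iS jT.
by move/val_inj: ij => ij; move: iS jT; rewrite ij => iS; rewrite (disjointFr dST iS).
Qed.

Lemma wedgeDl x y z : wedge (x + y) z = wedge x z + wedge y z.
Proof.
apply/ffunP => S; rewrite !ffunE -big_split; apply: eq_bigr => T _ /=.
by rewrite !ffunE mulrDr mulrDl.
Qed.
Lemma wedgeDr x y z : wedge z (x + y) = wedge z x + wedge z y.
Proof.
apply/ffunP => S; rewrite !ffunE -big_split; apply: eq_bigr => T _ /=.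
by rewrite !ffunE mulrDr.
Qed.
Lemma wedgeZl (k : K) x y : wedge (k *: x) y = k *: wedge x y.
Proof.
apply/ffunP => S; rewrite !ffunE scaler_sumr; apply: eq_bigr => T _ /=.
by rewrite !ffunE /= /GRing.scale /=; ring.
Qed.
Lemma wedgeZr (k : K) x y : wedge x (k *: y) = k *: wedge x y.
Proof.
apply/ffunP => S; rewrite !ffunE scaler_sumr; apply: eq_bigr => T _ /=.
by rewrite !ffunE /= /GRing.scale /=; ring.
Qed.
Lemma wedge0l x : wedge 0 x = 0.
Proof. by apply/ffunP => S; rewrite !ffunE big1 // => T _; rewrite ffunE mulr0 mul0r. Qed.
Lemma wedge0r x : wedge x 0 = 0.
Proof. by apply/ffunP => S; rewrite !ffunE big1 // => T _; rewrite ffunE mulr0. Qed.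
Lemma wedgeNl x y : wedge (- x) y = - wedge x y.
Proof. by rewrite -scaleN1r wedgeZl scaleN1r. Qed.
Lemma wedge_suml I (r : seq I) (P : pred I) (F : I -> ext K) y :
  wedge (\sum_(i <- r | P i) F i) y = \sum_(i <- r | P i) wedge (F i) y.
Proof. by elim/big_rec2: _ => [|i a b _ <-]; rewrite ?wedge0l ?wedgeDl. Qed.
Lemma wedge_sumr I (r : seq I) (P : pred I) (F : I -> ext K) y :
  wedge y (\sum_(i <- r | P i) F i) = \sum_(i <- r | P i) wedge y (F i).
Proof. by elim/big_rec2: _ => [|i a b _ <-]; rewrite ?wedge0r ?wedgeDr. Qed.

(** Both sides run over the ordered partitions of S into three blocks; the signs agree because
    inversions are additive in each argument. *)
Lemma wedgeA x y z : wedge x (wedge y z) = wedge (wedge x y) z.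
Proof.
apply/ffunP => S; rewrite !ffunE.
under eq_bigr => T TS do rewrite ffunE big_distrr /=.
under [RHS]eq_bigr => T TS do rewrite ffunE mulrC mulrA big_distrr /=.
rewrite [RHS](exchange_big_dep (fun T => T \subset S)) /=; last first.
  by move=> T U TS UT; apply: subset_trans UT TS.
apply: eq_bigr => T TS.
rewrite [RHS](reindex_onto (fun U => T :|: U) (fun U => U :\: T)) /=; last first.
  move=> U /andP[_ TU]; apply/setP => i; rewrite !inE.
  by case: (boolP (i \in T)) => [/(subsetP TU)->|].
apply: eq_big => [U|U].
  apply/idP/idP.
    rewrite subsetD => /andP[US dUT]; rewrite subUset TS US subsetUl /=.
    by rewrite setDUl setDv set0U; apply/eqP/setDidPl.
  case/andP => /andP[]; rewrite subUset subsetUl => /andP[_ US] _ /eqP <-.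
  by apply: setSD; rewrite subUset TS.
rewrite subsetD => /andP[US dUT].
have -> : (T :|: U) :\: T = U by rewrite setDUl setDv set0U; apply/setDidPl.
have -> : S :\: T :\: U = S :\: (T :|: U) by rewrite setDDl.
have -> : S :\: T = U :|: (S :\: (T :|: U)).
  apply/setP => i; rewrite !inE; case: (boolP (i \in U)) => [iU|_] /=; rewrite ?orbF //.
  by rewrite (subsetP US) // (disjointFr dUT iU).
have d1 : [disjoint U & S :\: (T :|: U)].
  by rewrite -setI_eq0; apply/eqP/setP => i; rewrite !inE; case: (i \in U); rewrite ?orbT ?andbF.
rewrite shuffle_signUr // shuffle_signUl; last by rewrite disjoint_sym.
by ring.
Qed.

Lemma wedge1l x : wedge (ext_basis K set0) x = x.
Proof.
apply/ffunP => S; rewrite !ffunE (bigD1 set0) ?sub0set //= big1 ?addr0 => [|T /andP[_ T0]].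
  rewrite setD0 ffunE eqxx mulr1 shuffle_signE (_ : inversions _ _ = set0) ?cards0 ?mul1r //.
  by apply/setP => -[i j]; rewrite !inE.
by rewrite ffunE (negPf T0) mulr0 mul0r.
Qed.

Lemma ext_vecE v S : ext_vec v S = \sum_i v 0 i * (S == [set i])%:R.
Proof. by rewrite /ext_vec sum_ffunE; apply: eq_bigr => i _; rewrite !ffunE. Qed.

(** Only T = S minus j contributes, with the sign of moving e_j past the larger elements of S. This
    matches a determinant expansion along the last row. *)
Lemma wedge_vecE x v S :
  wedge x (ext_vec v) S =
  \sum_(j in S) (-1) ^+ #|[set i in S | (j < i)%N]| * x (S :\ j) * v 0 j.
Proof.
rewrite ffunE; under eq_bigr => T TS do rewrite ext_vecE big_distrr /=.
rewrite exchange_big /= [RHS]big_mkcond; apply: eq_bigr => j _.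
have [jS|jS] := boolP (j \in S); last first.
  apply: big1 => T TS; case: eqP => [E|]; last by rewrite !mulr0.
  by move: jS (set11 j); rewrite -E inE => /negPf->; rewrite andbF.
rewrite (bigD1 (S :\ j)) ?subsetDl //= [X in _ + X]big1 ?addr0 => [|T /andP[TS Tj]].
  have -> : S :\: (S :\ j) = [set j] by rewrite setDDr setDv set0U; apply/setIidPr; rewrite sub1set.
  rewrite eqxx mulr1; congr (_ * _ * _); rewrite shuffle_signE; congr (_ ^+ _).
  have inj : injective (fun i : 'I_6 => (i, j)) by move=> ? ? [].
  rewrite -(card_imset _ inj); apply: eq_card => -[k l]; rewrite !inE /=.
  apply/and3P/imsetP => [[/andP[_ kS] /eqP-> jk]|[i']].
    by exists k; rewrite // inE kS.
  rewrite inE => /andP[iS ji] [-> ->]; split=> //; rewrite iS andbT.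
  by apply: contraTneq ji => ->; rewrite ltnn.
case: eqP => [E|]; last by rewrite !mulr0.
by case/eqP: Tj; rewrite -E setDDr setDv set0U; symmetry; apply/setIidPr.
Qed.

Definition wl (s : seq 'rV[K]_6) : ext K :=
  foldl (fun x v => wedge x (ext_vec v)) (ext_basis K set0) s.

Lemma wl_rcons s v : wl (rcons s v) = wedge (wl s) (ext_vec v).
Proof. by rewrite /wl -cats1 foldl_cat. Qed.

Lemma wl_cat s t : wl (s ++ t) = wedge (wl s) (wl t).
Proof.
elim/last_ind: t => [|t v IHt]; last by rewrite -rcons_cat !wl_rcons IHt wedgeA.
rewrite cats0 /= {2}/wl /=; apply/ffunP => S; rewrite ffunE (bigD1 S) //= setDv ffunE eqxx mulr1.
rewrite big1 ?addr0 => [|T /andP[TS nTS]].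
  rewrite shuffle_signE (_ : inversions _ _ = set0) ?cards0 ?mul1r //.
  by apply/setP => -[i j]; rewrite !inE andbF.
rewrite ffunE setD_eq0 (_ : _ \subset _ = false) ?mulr0 //.
by apply: contraNF nTS => ST; rewrite eqEsubset TS.
Qed.

Definition sel S (j : nat) : 'I_6 := nth ord0 (enum S) j.

Lemma enum_sorted S : sorted ltn (map val (enum S)).
Proof.
have -> : enum S = filter (mem S) (enum 'I_6) by rewrite !enumT.
apply: (subseq_sorted ltn_trans (map_subseq _ (filter_subseq _ _))).
by rewrite val_enum_ord iota_ltn_sorted.
Qed.

Lemma sel_in S c : (c < #|S|)%N -> sel S c \in S.
Proof. by move=> cS; rewrite -mem_enum mem_nth // -cardE. Qed.

Lemma sel_lt S c d : (c < #|S|)%N -> (d < #|S|)%N -> (sel S c < sel S d)%N = (c < d)%N.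
Proof.
have mono e f : (f < #|S|)%N -> (e < f)%N -> (sel S e < sel S f)%N.
  move=> fS ef; have eS := ltn_trans ef fS.
  have := sorted_ltn_nth ltn_trans 0%N (enum_sorted S).
  move=> /(_ e f); rewrite !inE size_map -cardE => /(_ eS fS ef).
  by rewrite !(nth_map ord0) -?cardE.
move=> cS dS; case: (ltngtP c d) => [cd|dc|->]; [exact: mono| |by rewrite ltnn].
by apply/negbTE; rewrite -leqNgt ltnW // mono.
Qed.

Lemma sel_inj S c d : (c < #|S|)%N -> (d < #|S|)%N -> sel S c = sel S d -> c = d.
Proof.
move=> cS dS E; have := sel_lt cS dS; have := sel_lt dS cS.
by rewrite E !ltnn; case: ltngtP.
Qed.

Lemma sel_onto S i : i \in S -> exists2 c, (c < #|S|)%N & sel S c = i.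
Proof.
rewrite -mem_enum => iS; exists (index i (enum S)); first by rewrite cardE index_mem.
by rewrite /sel nth_index.
Qed.

Lemma sel_rem S c j : (c < #|S|)%N -> sel (S :\ sel S c) j = sel S (bump c j).
Proof.
move=> cS; rewrite /sel; set i := nth _ _ c.
have -> : enum (S :\ i) = rem i (enum S).
  rewrite rem_filter ?enum_uniq // /enum_mem -filter_predI; apply: eq_filter => k.
  by rewrite /= !inE.
have ci : index i (enum S) = c by rewrite index_uniq ?enum_uniq // -cardE.
have sz : size (enum S) = #|S| by rewrite cardE.
have cS' : (c <= size (enum S))%N by rewrite sz ltnW.
rewrite remE ci nth_cat size_takel // /bump.
case: (ltnP j c) => [jc|cj]; first by rewrite nth_take // add0n.
by rewrite nth_drop addSn subnKC.
Qed.

Lemma card_gt_sel S c : (c < #|S|)%N ->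
  #|[set i in S | (sel S c < i)%N]| = (#|S| - c.+1)%N.
Proof.
move=> cS; pose g (k : 'I_(#|S| - c.+1)) := sel S (c.+1 + k).
have gS (k : 'I_(#|S| - c.+1)) : (c.+1 + k < #|S|)%N by rewrite -ltn_subRL.
have gI : injective g.
  by move=> k l /(sel_inj (gS k) (gS l)) /addnI /val_inj.
rewrite -[RHS]card_ord -(card_imset _ gI); apply: eq_card => i; rewrite inE.
apply/andP/imsetP => [[/sel_onto[d dS <-]]|[k _ ->]].
  rewrite sel_lt // => cd.
  have dk : (d - c.+1 < #|S| - c.+1)%N by rewrite ltn_sub2r //; apply: leq_ltn_trans dS.
  by exists (Ordinal dk); rewrite // /g /= subnKC.
by rewrite sel_in // sel_lt // leq_addr.
Qed.

(** Coordinates of a decomposable multivector are maximal minors: removing the last vector and one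
    element of S is a cofactor expansion along the last row. *)
Lemma wlE k s S : size s = k ->
  wl s S = if #|S| == k then \det (\matrix_(i < k, j < k) (nth 0 s i : 'rV_6) 0 (sel S j)) else 0.
Proof.
elim: k s S => [|k IHk] s S.
  move/size0nil=> ->; rewrite /wl /= ffunE det_mx00 cards_eq0; by case: (S == set0).
case/lastP: s => // s v; rewrite size_rcons => -[sk]; rewrite wl_rcons wedge_vecE.
case: (eqVneq #|S| k.+1) => [Sk|Sk]; last first.
  apply: big1 => j jS; rewrite (IHk _ _ sk) ifF ?mulr0 ?mul0r //.
  by apply: contraNF Sk => /eqP <-; rewrite (cardsD1 j S) jS.
rewrite (expand_det_row _ ord_max) -big_enum (big_nth ord0) -cardE Sk big_mkord.
apply: eq_bigr => c _; rewrite -/(sel S c) mxE nth_rcons sk ltnn eqxx [RHS]mulrC.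
congr (_ * _); rewrite card_gt_sel Sk ?ltn_ord // /cofactor subSS; congr (_ * _).
  (* The wedge counts the k - c elements of S beyond position c, the cofactor has sign exponent k +
     c; the parities agree. *)
  have ck : (c <= k)%N by rewrite -ltnS.
  by rewrite -signr_odd oddB // -oddD signr_odd.
rewrite (IHk _ _ sk) ifT; last first.
  by have := Sk; rewrite (cardsD1 (sel S c)) sel_in ?Sk // add1n => -[->].
congr (\det _); apply/matrixP => i j; rewrite !mxE nth_rcons sk sel_rem ?Sk //=.
by have -> : bump k i = i by [rewrite /bump leqNgt ltn_ord]; rewrite ltn_ord.
Qed.

End Exterior.

Definition o0 : 'I_3 := @Ordinal 3 0 isT.
Definition o1 : 'I_3 := @Ordinal 3 1 isT.
Definition o2 : 'I_3 := @Ordinal 3 2 isT.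

Lemma sum3E (V : nmodType) (F : 'I_3 -> V) : \sum_(i < 3) F i = F o0 + F o1 + F o2.
Proof.
rewrite !big_ord_recl big_ord0 addr0 addrA.
by congr (F _ + F _ + F _); apply: val_inj.
Qed.

Lemma ord3P (i : 'I_3) : [\/ i = o0, i = o1 | i = o2].
Proof.
by case: i => [[|[|[|i]]] // H]; [apply: Or31|apply: Or32|apply: Or33]; apply: val_inj.
Qed.

Lemma ordSE : (ordS o0 = o1) * (ordS o1 = o2) * (ordS o2 = o0).
Proof. by split; [split|]; apply: val_inj. Qed.

Definition l3 (T : Type) (a b c : T) (i : 'I_3) : T := nth a [:: a; b; c] i.

Lemma det2E (R : comNzRingType) (N : 'M[R]_2) :
  \det N = N ord0 ord0 * N ord_max ord_max - N ord0 ord_max * N ord_max ord0.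
Proof.
rewrite (expand_det_row _ ord0) !big_ord_recl big_ord0 /cofactor !det_mx11 !mxE /=.
rewrite addr0 expr0 expr1 mul1r mulN1r mulrN.
by congr (N _ _ * N _ _ - N _ _ * N _ _); apply: val_inj.
Qed.

Lemma det3E (R : comNzRingType) (M : 'M[R]_3) :
  \det M = M o0 o0 * (M o1 o1 * M o2 o2 - M o1 o2 * M o2 o1)
         - M o0 o1 * (M o1 o0 * M o2 o2 - M o1 o2 * M o2 o0)
         + M o0 o2 * (M o1 o0 * M o2 o1 - M o1 o1 * M o2 o0).
Proof.
rewrite (expand_det_row _ o0) sum3E /cofactor.
rewrite !det2E !mxE /=.
do ?[rewrite (_ : lift o0 ord0 = o1); last exact: val_inj].
do ?[rewrite (_ : lift o0 ord_max = o2); last exact: val_inj].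
do ?[rewrite (_ : lift o1 ord0 = o0); last exact: val_inj].
do ?[rewrite (_ : lift o1 ord_max = o2); last exact: val_inj].
do ?[rewrite (_ : lift o2 ord0 = o0); last exact: val_inj].
do ?[rewrite (_ : lift o2 ord_max = o1); last exact: val_inj].
by ring.
Qed.

(** Cauchy-Binet before grouping by subsets: f runs over all maps, the non-injective ones giving
    zero minors. The ungrouped form is all that is needed to place a determinant in a span of
    minors. *)
Lemma det_mul_expand (R : comNzRingType) m n (A : 'M[R]_(n, m)) (B : 'M[R]_(m, n)) :
  \det (A *m B) =
  \sum_(f : {ffun 'I_n -> 'I_m}) (\prod_i A i (f i)) * \det (\matrix_(i, j) B (f i) j).
Proof.
rewrite /determinant.
under eq_bigr => s _.
  under eq_bigr => i _ do rewrite mxE.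
  rewrite bigA_distr_bigA big_distrr /=.
  under eq_bigr => f _ do rewrite big_split /=.
  over.
rewrite exchange_big; apply: eq_bigr => f _ /=; rewrite big_distrr /=.
apply: eq_bigr => s _; rewrite mulrCA; congr (_ * (_ * _)).
by apply: eq_bigr => i _; rewrite mxE.
Qed.

(** * Trivectors, Cauchy-Binet and the wedge pairing *)

Section Exterior3.
Variable K : numFieldType.
Implicit Types (S T : {set 'I_6}) (x y z : ext K) (a b c d e f v : 'rV[K]_6).

Lemma extD x y S : (x + y) S = x S + y S. Proof. by rewrite ffunE. Qed.
Lemma extN x S : (- x) S = - x S. Proof. by rewrite ffunE. Qed.
Lemma ext0 S : (0 : ext K) S = 0. Proof. by rewrite ffunE. Qed.
Lemma extZ (k : K) x S : (k *: x) S = k * x S. Proof. by rewrite ffunE. Qed.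
Definition extE := (extD, extN, ext0, extZ).

Definition w3 a b c : ext K := locked (wl [:: a; b; c]).

Lemma w3_wl a b c : w3 a b c = wl [:: a; b; c].
Proof. by rewrite /w3 -lock. Qed.

Lemma wl1 v : wl [:: v] = ext_vec v.
Proof. exact: wedge1l. Qed.

Lemma wedge_vec2 a b : wedge (ext_vec a) (ext_vec b) = wl [:: a; b].
Proof. by rewrite -!wl1 -wl_cat. Qed.

Lemma wedge_vec3 a b c : wedge (wedge (ext_vec a) (ext_vec b)) (ext_vec c) = w3 a b c.
Proof. by rewrite w3_wl wedge_vec2 -wl1 -wl_cat. Qed.

Lemma wedge_vec3r a b c : wedge (ext_vec a) (wedge (ext_vec b) (ext_vec c)) = w3 a b c.
Proof. by rewrite wedgeA wedge_vec3. Qed.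

Lemma pluckerE (M : 'M[K]_(3, 6)) : plucker M = w3 (row o0 M) (row o1 M) (row o2 M).
Proof.
have e0 : ord0 = o0 by exact: val_inj.
have e1 : inord 1 = o1 by apply: val_inj; rewrite /= inordK.
have e2 : ord_max = o2 by exact: val_inj.
by rewrite /plucker wedge_vec3 e0 e1 e2.
Qed.

Lemma w3E a b c S : w3 a b c S =
  if #|S| == 3%N then
    a 0 (sel S 0) * (b 0 (sel S 1) * c 0 (sel S 2) - b 0 (sel S 2) * c 0 (sel S 1))
  - a 0 (sel S 1) * (b 0 (sel S 0) * c 0 (sel S 2) - b 0 (sel S 2) * c 0 (sel S 0))
  + a 0 (sel S 2) * (b 0 (sel S 0) * c 0 (sel S 1) - b 0 (sel S 1) * c 0 (sel S 0))
  else 0.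
Proof. by rewrite w3_wl (@wlE _ 3) //; case: ifP => // _; rewrite det3E !mxE. Qed.

Lemma w3_supp a b c S : #|S| != 3%N -> w3 a b c S = 0.
Proof. by move=> S3; rewrite w3E (negPf S3). Qed.

Definition det6 a b c d e f : K :=
  \det (\matrix_(i < 6) (nth 0 [:: a; b; c; d; e; f] i : 'rV_6)).

Lemma wedge_w3 a b c d e f :
  wedge (w3 a b c) (w3 d e f) = det6 a b c d e f *: ext_basis K [set: 'I_6].
Proof.
rewrite !w3_wl -wl_cat /=; apply/ffunP => S; rewrite (@wlE _ 6) // ffunE [in RHS]ffunE.
have -> : (#|S| == 6%N) = (S == setT).
  by rewrite eqEcard subsetT cardsT card_ord eqn_leq [X in X && _](leq_trans (max_card _)) ?card_ord.
case: (S =P setT) => [->|_]; last by rewrite scaler0.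
rewrite [RHS]mulr1; congr (\det _); apply/matrixP => i j; rewrite !mxE; congr (_ 0 _).
by rewrite /sel enum_setT -enumT nth_ord_enum.
Qed.

Lemma wedge_top x y :
  wedge x y setT = \sum_T shuffle_sign K T (~: T) * x T * y (~: T).
Proof. by rewrite ffunE; apply: eq_big => [T|T _]; rewrite ?subsetT ?setTD. Qed.

(** Expand everything over maps f from the rows to the six indices. Such an f contributes to T only
    if its image lies in T. For injective f this singles out T as the image; otherwise the minor of
    N has two equal rows. *)
Lemma Cauchy_Binet3 (N : 'M[K]_(6, 3)) (r : 'I_3 -> 'rV[K]_6) :
  \sum_(T : {set 'I_6} | #|T| == 3%N) w3 (r o0) (r o1) (r o2) T * \det (\matrix_(i < 3, j < 3) N (sel T i) j)
  = \det (\matrix_(i < 3, j < 3) \sum_k r i 0 k * N k j).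
Proof.
pose A := \matrix_(i < 3) r i.
have -> : (\matrix_(i < 3, j < 3) \sum_k r i 0 k * N k j) = A *m N.
  by apply/matrixP => i j; rewrite !mxE; apply: eq_bigr => k _; rewrite !mxE.
rewrite det_mul_expand.
have w3A T : #|T| == 3%N -> w3 (r o0) (r o1) (r o2) T =
   \sum_(f : {ffun 'I_3 -> 'I_6}) (\prod_i A i (f i)) *
      \det (\matrix_(i < 3, j < 3) (f i == sel T j)%:R).
  move=> T3; rewrite w3_wl (@wlE _ 3) // T3.
  have -> : \matrix_(i < 3, j < 3) (nth 0 [:: r o0; r o1; r o2] i : 'rV_6) 0 (sel T j) =
     A *m (\matrix_(k < 6, j < 3) (k == sel T j)%:R).
    apply/matrixP => i j; rewrite !mxE (bigD1 (sel T j)) //= big1 => [|k kT].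
      by rewrite !mxE eqxx mulr1 addr0; congr (_ 0 _); case: (ord3P i) => ->.
    by rewrite !mxE (negPf kT) mulr0.
  rewrite det_mul_expand; apply: eq_bigr => f _; congr (_ * \det _).
  by apply/matrixP => i j; rewrite !mxE.
under eq_bigr => T T3 do rewrite w3A // big_distrl /=.
rewrite exchange_big /=; apply: eq_bigr => f _.
under eq_bigr => T T3 do rewrite -mulrA -det_mulmx.
rewrite -big_distrr /=; congr (_ * _).
set M := \matrix_(i, j) N (f i) j.
have step T : #|T| == 3%N ->
    \det ((\matrix_(i < 3, j < 3) (f i == sel T j)%:R) *m (\matrix_(i < 3, j < 3) N (sel T i) j))
    = if [forall i, f i \in T] then \det M else 0.
  move=> /eqP T3; case: ifP => [/forallP fT|/forallPn /= [i fi]].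
    congr (\det _); apply/matrixP => i j; rewrite !mxE.
    have [k kT fk] := sel_onto (fT i); rewrite T3 in kT.
    rewrite (bigD1 (Ordinal kT)) //= big1 => [|l lk]; first by rewrite !mxE /= fk eqxx mul1r addr0.
    rewrite !mxE -fk; case: eqP => [E|]; last by rewrite mul0r.
    case/eqP: lk; apply: val_inj => /=; symmetry; apply: sel_inj E; by rewrite T3 ?ltn_ord.
  rewrite (expand_det_row _ i) big1 // => j _; rewrite mxE big1 ?mul0r // => k _.
  rewrite !mxE; case: eqP => [E|]; last by rewrite mul0r.
  by case/negP: fi; rewrite E sel_in // T3.
under eq_bigr => T T3 do rewrite step //.
rewrite -big_mkcondr /=.
have [fI|] := boolP (injectiveb f); last first.
  case/injectivePn => i [j ij fij].
  have -> : \det M = 0.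
    by apply: (determinant_alternate ij) => k; rewrite !mxE fij.
  by rewrite big1.
have cf : #|f @: setT| = 3%N by rewrite card_imset ?cardsT ?card_ord //; apply/injectiveP.
rewrite (big_pred1 (f @: setT)) // => T /=.
apply/andP/eqP => [[/eqP T3 /forallP fT]|->].
  apply/eqP; rewrite eq_sym eqEcard T3 cf leqnn andbT.
  by apply/subsetP => _ /imsetP[i _ ->].
by rewrite cf; split=> //; apply/forallP => i; rewrite imset_f.
Qed.

(** The wedge pairing with x, written as a linear polynomial in all coordinates of the exterior
    algebra so that it can be fed to the ideals of subschemes. *)
Definition linear_form_of x : {mpoly K[ext_dim]} :=
  \sum_i (shuffle_sign K (~: enum_val i) (enum_val i) * x (~: enum_val i)) *: 'X_i.

Lemma linear_form_homog x : linear_form_of x \is 1.-homog.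
Proof. by apply: rpred_sum => i _; apply: rpredZ; rewrite dhomogX /= mdeg1. Qed.

Lemma ext_eval_linear_form x y : ext_eval (linear_form_of x) y = wedge x y setT.
Proof.
rewrite /ext_eval raddf_sum wedge_top (reindex_inj (can_inj (@setCK _))) /=.
rewrite (reindex (@enum_val _ (mem {: {set 'I_6}}))) /=; last first.
  exists enum_rank => S _; [exact: enum_valK|exact: enum_rankK].
by apply: eq_bigr => i _; rewrite mevalZ mevalXU setCK.
Qed.

End Exterior3.

(** * A Lagrangian subspace is its own orthogonal *)

Section Lagrangian.
Variable K : numFieldType.
Implicit Types (S T : {set 'I_6}) (x y z : ext K).

Definition triple := {T : {set 'I_6} | #|T| == 3%N}.

Lemma card_triple : #|{: triple}| = 20%N.
Proof.
rewrite card_sig -[RHS]/('C(6, 3)) -[in RHS](card_ord 6) -card_draws.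
by apply: eq_card => T; rewrite !inE.
Qed.

Lemma shuffle_sign_neq0 S T : shuffle_sign K S T != 0.
Proof. by rewrite /shuffle_sign signr_eq0. Qed.

Lemma setC_card3 T : (#|~: T| == 3%N) = (#|T| == 3%N).
Proof.
have := cardsC T; rewrite card_ord => E.
by apply/eqP/eqP => E'; move: E; rewrite E' ?addn3 ?add3n => -[].
Qed.

(** Dimension count: the orthogonal of A in the trivectors has dimension 20 - 10 = 10 and contains
    A, hence equals A. *)
Lemma lagrangian_maximal (A : {vspace ext K}) x : lagrangian A ->
  (forall S, #|S| != 3%N -> x S = 0) -> (forall a, a \in A -> wedge x a setT = 0) -> x \in A.
Proof.
case=> Asupp Aiso Adim xsupp xA.
pose b (i : 'I_(\dim A)) := (vbasis A)`_i.
have bA i : b i \in A by apply: vbasis_mem; rewrite mem_nth ?size_tuple.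
have bfree (c : 'rV[K]_(\dim A)) : \sum_i c 0 i *: b i = 0 -> c = 0.
  move=> c0; apply/rowP => i; rewrite mxE.
  have /freeP -> // : free (vbasis A) by exact: (basis_free (vbasisP A)).
pose I := 'I_#|{: triple}|.
pose tr (j : I) : {set 'I_6} := val (enum_val j).
have trE S : #|S| == 3%N -> exists j, tr j = S.
  move=> S3; exists (enum_rank (Sub S S3 : triple)); by rewrite /tr enum_rankK.
have tr3 j : #|tr j| == 3%N := valP (enum_val j).
pose M := \matrix_(i < \dim A, j < #|{: triple}|) b i (tr j).
(* [Phi y] lists the coefficients of the functional pairing y with a trivector, so y is orthogonal
   to A exactly when [Phi y] is killed by the transpose of M. *)
pose Phi y := \row_(j < #|{: triple}|) (shuffle_sign K (~: tr j) (tr j) * y (~: tr j)).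
pose M' := \matrix_(i < \dim A) Phi (b i).
have PhiK y z : (forall S, #|S| != 3%N -> y S = 0) -> (forall S, #|S| != 3%N -> z S = 0) ->
    Phi y = Phi z -> y = z.
  move=> ys zs E; apply/ffunP => S; have [S3|S3] := boolP (#|S| == 3%N); last by rewrite ys ?zs.
  have /trE[j jS] : #|~: S| == 3%N by rewrite setC_card3.
  move/rowP/(_ j): E; rewrite !mxE jS setCK => /mulfI; apply; exact: shuffle_sign_neq0.
have sum_supp (c : 'rV[K]_(\dim A)) S : #|S| != 3%N -> (\sum_i c 0 i *: b i) S = 0.
  move=> S3; rewrite sum_ffunE big1 // => i _; rewrite ffunE Asupp //; exact: mulr0.
have PhiM' (c : 'rV[K]_(\dim A)) : c *m M' = Phi (\sum_i c 0 i *: b i).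
  apply/rowP => j; rewrite !mxE sum_ffunE big_distrr /=; apply: eq_bigr => i _.
  by rewrite !mxE ffunE /= mulrCA.
have rM : \rank M = 10%N.
  rewrite -Adim; apply/eqP; rewrite -/(row_free M); apply: inj_row_free => c cM.
  apply: bfree; apply/ffunP => S; rewrite [RHS]ffunE.
  have [S3|] := boolP (#|S| == 3%N); last exact: sum_supp.
  have [j jS] := trE _ S3; move/rowP/(_ j): cM; rewrite !mxE sum_ffunE => E.
  by rewrite -[RHS]E; apply: eq_bigr => i _; rewrite mxE ffunE jS.
have rM' : \rank M' = 10%N.
  rewrite -Adim; apply/eqP; rewrite -/(row_free M'); apply: inj_row_free => c.
  rewrite PhiM' => E; apply: bfree; apply: PhiK => [|S _|]; [exact: sum_supp|by rewrite ffunE|].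
  by rewrite E; apply/rowP => j; rewrite !mxE ffunE mulr0.
have ker y : (forall S, #|S| != 3%N -> y S = 0) -> (forall a, a \in A -> wedge y a setT = 0) ->
    Phi y *m M^T = 0.
  move=> ys yA; apply/rowP => i; rewrite !mxE.
  apply: etrans (yA _ (bA i)); rewrite wedge_top [RHS](bigID (fun T => #|T| == 3%N)) /=.
  rewrite [X in _ + X]big1 ?addr0 => [|T T3]; last by rewrite ys // mulr0 mul0r.
  rewrite [RHS](reindex_inj (can_inj (@setCK _))) /=; under [RHS]eq_bigl => T do rewrite setC_card3.
  (* The default of [insubd] is an arbitrary triple that makes the inverse total; only sets of three
     elements are ever passed to it. *)
  rewrite [RHS](reindex_onto tr (fun S => enum_rank (insubd (enum_val (cast_ord (esym card_triple) ord0)) S))) /=.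
    apply: eq_big => [j|j _]; last by rewrite !mxE setCK.
    rewrite tr3 /=; symmetry; apply/eqP; apply: (can_inj enum_rankK) => //=.
    by rewrite /tr valKd enum_valK.
  by move=> S S3; rewrite /tr enum_rankK insubdK.
have sub : (M' <= kermx M^T)%MS.
  apply/row_subP => i; rewrite rowK; apply/sub_kermxP; apply: ker => [S S3|a aA].
    exact: Asupp.
  by rewrite Aiso // ffunE.
have : (Phi x <= M')%MS.
  apply: submx_trans (_ : (kermx M^T <= M')%MS); first exact/sub_kermxP/ker.
  rewrite -(mxrank_leqif_sup sub) mxrank_ker mxrank_tr rM rM'.
  by rewrite card_triple.
case/submxP => c; rewrite PhiM' => /(PhiK _ _ xsupp (sum_supp c)) ->.
by apply: rpred_sum => i _; apply: rpredZ.
Qed.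

End Lagrangian.

(** * Forms and polarity *)

Section Homogeneous.
Variable K : numFieldType.
Implicit Types n : nat.

Lemma dhomog_pevalZ n d (g : {mpoly K[n]}) c (z : 'rV[K]_n) : g \is d.-homog ->
  peval g (c *: z) = c ^+ d * peval g z.
Proof.
move/dhomogP => gd; rewrite /peval !mevalE big_distrr /=.
rewrite big_seq [RHS]big_seq; apply: eq_bigr => m ms.
rewrite mulrCA; congr (_ * _); rewrite -(gd m ms) /= mdegE expr_sum -big_split /=.
by apply: eq_bigr => i _; rewrite !mxE exprMn.
Qed.

Lemma dhomogS_split n d (g : {mpoly K[n]}) : g \is d.+1.-homog ->
  exists2 h : 'I_n -> {mpoly K[n]}, (forall i, h i \is d.-homog) & g = \sum_i h i * 'X_i.
Proof.
move/dhomogP => gd; rewrite [g]mpolyE big_seq.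
apply: (big_ind (fun g => exists2 h : 'I_n -> {mpoly K[n]},
  (forall i, h i \is d.-homog) & g = \sum_i h i * 'X_i)).
- by exists (fun=> 0) => [i|]; [exact: rpred0|rewrite big1 // => i _; rewrite mul0r].
- move=> _ _ [h1 hh1 ->] [h2 hh2 ->]; exists (fun i => h1 i + h2 i) => [i|]; first exact: rpredD.
  by rewrite -big_split; apply: eq_bigr => i _; rewrite mulrDl.
move=> m /gd /= md.
have [i mi] : exists i, m i != 0%N.
  apply/existsP; apply: contraTT isT => /existsPn /= m0.
  by move: md; rewrite mdegE big1 // => i _; apply/eqP; have := m0 i; rewrite negbK.
have mE : m = (U_(i) + (m - U_(i)))%MM.
  by rewrite addmC submK // lep1mP.
exists (fun j => if j == i then g@_m *: 'X_[m - U_(i)] else 0) => [j|].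
  case: ifP => _; last exact: rpred0.
  by apply: rpredZ; rewrite dhomogX /=; move: md; rewrite {1}mE mdegD mdeg1 add1n => -[->].
rewrite (bigD1 i) //= eqxx big1 => [|j /negPf->]; last by rewrite mul0r.
by rewrite addr0 -scalerAl -mpolyXD addmC -mE.
Qed.

Lemma dhomog0_const n (g : {mpoly K[n]}) : g \is 0.-homog -> exists c, g = c%:MP.
Proof.
move/dhomogP => g0; exists (g@_0%MM); apply/mpolyP => m; rewrite mcoeffC.
have [ms|ms] := boolP (m \in msupp g); last first.
  rewrite (memN_msupp_eq0 ms); case: eqP => [E|_]; last by rewrite mulr0.
  by move: ms; rewrite mulr1 E => /memN_msupp_eq0 ->.
by have /eqP := g0 m ms; rewrite mdeg_eq0 => /eqP ->; rewrite eqxx mulr1.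
Qed.

Lemma dhomog1_lcomb n (g : {mpoly K[n]}) : g \is 1.-homog ->
  exists a, g = lcomb (fun i => 'X_i) a.
Proof.
case/dhomogS_split => h hh ->.
pose a i := peval (h i) 0; exists (\row_i a i); apply: eq_bigr => i _.
by have [c E] := dhomog0_const (hh i); rewrite mxE /a E pevalC mul_mpolyC.
Qed.

Lemma dhomog2_quadratic n (g : {mpoly K[n]}) : g \is 2.-homog ->
  exists S : 'M[K]_n, g = \sum_i \sum_j S i j *: ('X_i * 'X_j).
Proof.
case/dhomogS_split => h hh ->.
have hE i := dhomog1_lcomb (hh i).
pose S := \matrix_(i, j) (h i)@_(U_(j)); exists S.
apply: eq_bigr => i _; have [a E] := hE i.
have -> : h i = lcomb (fun i => 'X_i) (row i S).
  rewrite {1}E; congr lcomb; apply/rowP => j; rewrite !mxE E /lcomb raddf_sum (bigD1 j) //=.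
  rewrite mcoeffZ mcoeffX eqxx mulr1 big1 ?addr0 // => k kj; rewrite mcoeffZ mcoeffX.
  by rewrite eq_mnm1 (negPf kj) mulr0.
by rewrite mulr_suml; apply: eq_bigr => j _; rewrite mxE -scalerAl mulrC.
Qed.

(** On the line through z, the coefficient of l ^ j is the value at z of the component of degree j;
    comparison with c l ^ d isolates the component of degree d. *)
Lemma peval_pihomog n d (g : {mpoly K[n]}) (z : 'rV[K]_n) c :
  (forall l, l != 0 -> peval g (l *: z) = l ^+ d * c) -> peval (pihomog mdeg d g) z = c.
Proof.
(* N bounds the degrees in g and also exceeds d, so that the index d occurs even when g has smaller
   degree. *)
move=> gz; pose N := maxn (msize g) d.+1.
have gE : g = \sum_(j < N) pihomog mdeg j g by apply: pihomog_partitionE; exact: leq_maxl.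
pose P := \sum_(j < N) peval (pihomog mdeg j g) z *: 'X^j - c *: 'X^d : {poly K}.
have P0 : P = 0.
  apply: poly_eq0_eval => l l0; rewrite hornerD hornerN hornerZ hornerXn horner_sum.
  apply/eqP; rewrite subr_eq0 [c * _]mulrC -gz // {2}gE peval_sum; apply/eqP.
  apply: eq_bigr => j _; rewrite hornerZ hornerXn mulrC.
  by rewrite (dhomog_pevalZ (d := j)) // pihomogP.
have dN : (d < N)%N by rewrite leq_max leqnn orbT.
have : P`_d = peval (pihomog mdeg d g) z - c.
  rewrite coefB coefZ coefXn eqxx mulr1 coef_sum (bigD1 (Ordinal dN)) //=.
  rewrite coefZ coefXn eqxx mulr1 big1 ?addr0 // => j jd; rewrite coefZ coefXn.
  rewrite (_ : (d == j :> nat) = false) ?mulr0 //.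
  by apply: contraNF jd => /eqP E; apply/eqP/val_inj; rewrite /= E.
by rewrite P0 coef0 => /esym /eqP; rewrite subr_eq0 => /eqP.
Qed.

(** For a quadratic form, the associated symmetric bilinear form, equal to twice g on the diagonal;
    it is also the differential of g at z in the direction e. *)
Definition polar n (g : {mpoly K[n]}) (z e : 'rV[K]_n) :=
  peval g (z + e) - peval g z - peval g e.

Lemma polarE n (g : {mpoly K[n]}) (S : 'M[K]_n) z e :
  g = \sum_i \sum_j S i j *: ('X_i * 'X_j) ->
  polar g z e = \sum_i \sum_j S i j * (z 0 i * e 0 j + e 0 i * z 0 j).
Proof.
move=> ->; rewrite /polar !peval_sum -!sumrB; apply: eq_bigr => i _.
rewrite !peval_sum -!sumrB; apply: eq_bigr => j _.
by rewrite !pevalE !mxE; ring.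
Qed.

Lemma polarC n (g : {mpoly K[n]}) z e : polar g z e = polar g e z.
Proof. by rewrite /polar [z + e]addrC addrAC. Qed.

Lemma peval_mderiv n (g : {mpoly K[n]}) z i : g \is 2.-homog ->
  peval g^`M(i) z = polar g z (delta_mx 0 i).
Proof.
case/dhomog2_quadratic => S gS; rewrite (polarE _ _ gS) gS raddf_sum peval_sum.
apply: eq_bigr => k _; rewrite raddf_sum peval_sum; apply: eq_bigr => l _ /=.
rewrite mderivZ mderivM !mderivX !pevalE !mxE /= !mnm1E; congr (_ * _).
(* The truncated difference of exponents left by the derivative is 0 whenever its coefficient is
   not. *)
have U0 (a b : 'I_n) : (a == b)%:R * peval 'X_[K, U_(a) - U_(b)] z = (a == b)%:R.
  case: eqP => [->|_]; last by rewrite mul0r.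
  by rewrite (_ : (U_(b) - U_(b) = 0)%MM) ?mpolyX0 ?peval1 ?mulr1 //; apply/mnmP => j; rewrite mnmBE mnm0E subnn.
by rewrite !U0; ring.
Qed.

Lemma polarDr n (g : {mpoly K[n]}) z e e' : g \is 2.-homog ->
  polar g z (e + e') = polar g z e + polar g z e'.
Proof.
case/dhomog2_quadratic => S gS; rewrite !(polarE _ _ gS) -big_split; apply: eq_bigr => i _.
rewrite -big_split; apply: eq_bigr => j _ /=; rewrite !mxE; ring.
Qed.

Lemma polarZr n (g : {mpoly K[n]}) z c e : g \is 2.-homog ->
  polar g z (c *: e) = c * polar g z e.
Proof.
case/dhomog2_quadratic => S gS; rewrite !(polarE _ _ gS) big_distrr; apply: eq_bigr => i _ /=.
rewrite big_distrr; apply: eq_bigr => j _ /=; rewrite !mxE; ring.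
Qed.

Lemma polarDl n (g : {mpoly K[n]}) z z' e : g \is 2.-homog ->
  polar g (z + z') e = polar g z e + polar g z' e.
Proof. by move=> g2; rewrite polarC polarDr // !(polarC g e). Qed.

Lemma polarZl n (g : {mpoly K[n]}) c z e : g \is 2.-homog ->
  polar g (c *: z) e = c * polar g z e.
Proof. by move=> g2; rewrite polarC polarZr // polarC. Qed.

Lemma polarDg n (g h : {mpoly K[n]}) z e : polar (g + h) z e = polar g z e + polar h z e.
Proof. by rewrite /polar !pevalE; ring. Qed.

Lemma polarZg n c (g : {mpoly K[n]}) z e : polar (c *: g) z e = c * polar g z e.
Proof. by rewrite /polar !pevalE; ring. Qed.

Lemma polar_diag n (g : {mpoly K[n]}) z : g \is 2.-homog -> polar g z z = 2%:R * peval g z.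
Proof.
move=> g2; rewrite /polar -[z + z](_ : 2%:R *: z = _); last by rewrite scaler_nat mulr2n.
by rewrite (dhomog_pevalZ _ _ g2); ring.
Qed.

Lemma peval_homog0 n d (g : {mpoly K[n]}) : g \is d.+1.-homog -> peval g 0 = 0.
Proof. by move=> gd; rewrite -(scale0r (0 : 'rV_n)) (dhomog_pevalZ _ _ gd) expr0n mul0r. Qed.

Section Bihomogeneous.
Variables m n : nat.
Implicit Types g h : {mpoly K[m + n]}.

Lemma bihomog_eval d e g c c' (y : 'rV[K]_m) (x : 'rV[K]_n) : bihomog d e g ->
  peval g (row_mx (c *: y) (c' *: x)) = c ^+ d * c' ^+ e * peval g (row_mx y x).
Proof.
move=> gd; rewrite /peval !mevalE big_distrr /= big_seq [RHS]big_seq; apply: eq_bigr => mu ms.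
rewrite mulrCA; congr (_ * _); have [<- <-] := gd mu ms.
rewrite !expr_sum !big_split_ord /= mulrACA -!big_split /=.
congr (_ * _); apply: eq_bigr => i _.
  by rewrite !row_mxEl mxE exprMn.
by rewrite !row_mxEr mxE exprMn.
Qed.

Lemma bihomogD d e g h : bihomog d e g -> bihomog d e h -> bihomog d e (g + h).
Proof.
move=> gd hd mu /msuppD_le; rewrite mem_cat => /orP[]; [exact: gd|exact: hd].
Qed.

Lemma bihomogZ d e c g : bihomog d e g -> bihomog d e (c *: g).
Proof. by move=> gd mu /msuppZ_le; exact: gd. Qed.

Lemma bihomog0 d e : bihomog d e (0 : {mpoly K[m + n]}).
Proof. by move=> mu; rewrite msupp0. Qed.

Lemma bihomog_sum d e I (r : seq I) (F : I -> {mpoly K[m + n]}) :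
  (forall i, bihomog d e (F i)) -> bihomog d e (\sum_(i <- r) F i).
Proof.
move=> Fd; apply: (big_ind (bihomog d e)) => //; [exact: bihomog0|exact: bihomogD].
Qed.

Lemma bihomogM d e d' e' g h : bihomog d e g -> bihomog d' e' h ->
  bihomog (d + d') (e + e') (g * h).
Proof.
move=> gd hd mu /msuppM_le /allpairsP[[k l] /= [/gd [<- <-] /hd [<- <-] ->]].
by rewrite -!big_split /=; split; apply: eq_bigr => i _; rewrite mnmDE.
Qed.

Lemma bihomogXl i : bihomog 1 0 ('X_(lshift n i) : {mpoly K[m + n]}).
Proof.
move=> mu; rewrite msuppX inE => /eqP ->; split.
  rewrite (bigD1 i) //= mnm1E eqxx big1 // => j ji.
  by rewrite mnm1E (inj_eq (@lshift_inj _ _)) eq_sym (negPf ji).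
by rewrite big1 // => j _; rewrite mnm1E eq_lrshift.
Qed.

Lemma bihomogXr i : bihomog 0 1 ('X_(rshift m i) : {mpoly K[m + n]}).
Proof.
move=> mu; rewrite msuppX inE => /eqP ->; split.
  by rewrite big1 // => j _; rewrite mnm1E eq_rlshift.
rewrite (bigD1 i) //= mnm1E eqxx big1 // => j ji.
by rewrite mnm1E (inj_eq (@rshift_inj _ _)) eq_sym (negPf ji).
Qed.

End Bihomogeneous.

End Homogeneous.

(** * The Segre threefold and the Del Pezzo surface *)

Definition b0 : 'I_2 := @Ordinal 2 0 isT.
Definition b1 : 'I_2 := @Ordinal 2 1 isT.

Lemma sum2E (V : nmodType) (F : 'I_2 -> V) : \sum_(i < 2) F i = F b0 + F b1.
Proof.
by rewrite !big_ord_recl big_ord0 addr0; congr (F _ + F _); apply: val_inj.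
Qed.

Lemma ord2P (i : 'I_2) : i = b0 \/ i = b1.
Proof. by case: i => [[|[|i]] // H]; [left|right]; apply: val_inj. Qed.

(** * Differentials of the quadrics at a point of the Segre threefold *)

Section Gradients.
Variable K : numFieldType.
Implicit Types (x y z : 'rV[K]_3) (e : 'M[K]_(2, 3)).

Definition dot (a x : 'rV[K]_3) := \sum_i a 0 i * x 0 i.

Lemma dotE (a x : 'rV[K]_3) : dot a x = a 0 o0 * x 0 o0 + a 0 o1 * x 0 o1 + a 0 o2 * x 0 o2.
Proof. exact: sum3E. Qed.

Lemma dotDl (a b x : 'rV[K]_3) : dot (a + b) x = dot a x + dot b x.
Proof. by rewrite !dotE !mxE; ring. Qed.
Lemma dotZl c (a x : 'rV[K]_3) : dot (c *: a) x = c * dot a x.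
Proof. by rewrite !dotE !mxE; ring. Qed.
Lemma dotDr (a x y : 'rV[K]_3) : dot a (x + y) = dot a x + dot a y.
Proof. by rewrite !dotE !mxE; ring. Qed.
Lemma dotZr c (a x : 'rV[K]_3) : dot a (c *: x) = c * dot a x.
Proof. by rewrite !dotE !mxE; ring. Qed.

Definition row3 (T : Type) (a b c : T) : 'rV[T]_3 := \row_i l3 a b c i.

Lemma row3E (T : Type) (a b c : T) :
  (row3 a b c 0 o0 = a) * (row3 a b c 0 o1 = b) * (row3 a b c 0 o2 = c).
Proof. by rewrite !mxE. Qed.

Definition cross x y : 'rV[K]_3 :=
  row3 (x 0 o1 * y 0 o2 - x 0 o2 * y 0 o1)
       (x 0 o2 * y 0 o0 - x 0 o0 * y 0 o2)
       (x 0 o0 * y 0 o1 - x 0 o1 * y 0 o0).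

Definition crossE x y := row3E (x 0 o1 * y 0 o2 - x 0 o2 * y 0 o1)
       (x 0 o2 * y 0 o0 - x 0 o0 * y 0 o2)
       (x 0 o0 * y 0 o1 - x 0 o1 * y 0 o0).

Definition trip x y z := dot x (cross y z).

Lemma tripE x y z : trip x y z =
  x 0 o0 * (y 0 o1 * z 0 o2 - y 0 o2 * z 0 o1) + x 0 o1 * (y 0 o2 * z 0 o0 - y 0 o0 * z 0 o2)
  + x 0 o2 * (y 0 o0 * z 0 o1 - y 0 o1 * z 0 o0).
Proof. by rewrite /trip dotE !crossE. Qed.

Definition vals (T : Type) (g : T -> K) (e e' e'' : T) : 'rV[K]_3 := row3 (g e) (g e') (g e'').
Definition valsE (T : Type) (g : T -> K) (e e' e'' : T) := row3E (g e) (g e') (g e'').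

Variables (t : 'rV[K]_2) (x u0 u1 : 'rV[K]_3).
Let t0 := t 0 b0.
Let t1 := t 0 b1.

Definition uform (s : 'rV[K]_2) y := s 0 b0 * dot u0 y + s 0 b1 * dot u1 y.

(** Modulo x, the normal component of e at the point t (x) x of the Segre threefold: it is a
    multiple of x on tangent vectors t (x) v + s (x) x. With u0 = x q0 and u1 = x q1, [grad_minor]
    and [grad_phi] are the differentials of the 2 x 2 minors and of the quadrics restricting to t_a
    F, and the hypothesis [tx0] says that the point lies on Y. *)
Definition eps e : 'rV[K]_3 := t0 *: row b1 e - t1 *: row b0 e.
Definition grad_minor i e := cross x (eps e) 0 i.
Definition grad_phi (a : 'I_2) e :=
  t 0 a * (dot u0 (row b0 e) + dot u1 (row b1 e)) + uform t (row a e).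

Hypothesis tx0 : uform t x = 0.

(** For fixed t the quadric t0 phi_1 - t1 phi_0 vanishes on the plane over t, so its differential
    factors through [eps]. *)
Lemma grad_phi_eps e : t0 * grad_phi b1 e = t1 * grad_phi b0 e + uform t (eps e).
Proof. by rewrite /grad_phi /uform /eps !dotE !mxE /t0 /t1; ring. Qed.

(** The wedge of [grad_phi a] with the 2-form [trip x (eps e) (eps e')]. That 2-form is what the
    wedges of two minor differentials share, since (x × v) × (x × w) is the determinant of x, v, w
    times x. *)
Definition omega a e e' e'' :=
  trip x (eps e) (eps e') * grad_phi a e'' + trip x (eps e') (eps e'') * grad_phi a e
  + trip x (eps e'') (eps e) * grad_phi a e'.

Lemma omega_swap a e e' e'' : omega a e e'' e' = - omega a e e' e''.
Proof. by rewrite /omega !tripE; ring. Qed.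

Lemma trip_minors a i e e' e'' :
  trip (vals (grad_minor (ordS i)) e e' e'') (vals (grad_minor (ordS (ordS i))) e e' e'')
       (vals (grad_phi a) e e' e'') = x 0 i * omega a e e' e''.
Proof.
by case: (ord3P i) => ->; rewrite !ordSE !tripE !valsE /grad_minor !crossE /omega !tripE; ring.
Qed.

(** By [grad_phi_eps] the two sides differ by a cyclic sum which Cramer's rule in 3-space turns into
    a multiple of F(t, x), zero on Y. *)
Lemma omega_prop e e' e'' : t0 * omega b1 e e' e'' = t1 * omega b0 e e' e''.
Proof.
have -> : t0 * omega b1 e e' e'' =
   trip x (eps e) (eps e') * (t0 * grad_phi b1 e'')
   + trip x (eps e') (eps e'') * (t0 * grad_phi b1 e)
   + trip x (eps e'') (eps e) * (t0 * grad_phi b1 e') by rewrite /omega; ring.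
rewrite !grad_phi_eps; apply/eqP; rewrite -subr_eq0; apply/eqP.
transitivity (uform t x * trip (eps e) (eps e') (eps e'')); last by rewrite tx0 mul0r.
by rewrite /omega !tripE /uform !dotE; ring.
Qed.

Lemma omega_prop2 a a' e e' e'' : t 0 a * omega a' e e' e'' = t 0 a' * omega a e e' e''.
Proof. by case: (ord2P a) => ->; case: (ord2P a') => ->; rewrite ?omega_prop. Qed.

Section Beta.
Variables (s : 'rV[K]_2) (y : 'rV[K]_3).
Let z := s^T *m y.

Lemma eps_rank1 : eps z = (t0 * s 0 b1 - t1 * s 0 b0) *: y.
Proof. by apply/rowP => i; rewrite !mxE !big_ord1 !mxE; ring. Qed.

Lemma grad_phi_rank1 a : grad_phi a z = t 0 a * uform s y + s 0 a * uform t y.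
Proof.
rewrite /grad_phi /uform !dotE !mxE !big_ord1 !mxE; ring.
Qed.

Definition dbeta e e' :=
  dot y (cross x (eps e)) * (s 0 b1 * grad_phi b0 e' - s 0 b0 * grad_phi b1 e')
  - dot y (cross x (eps e')) * (s 0 b1 * grad_phi b0 e - s 0 b0 * grad_phi b1 e)
  - uform s y * trip x (eps e) (eps e').

(** The right side is the contraction of the 3-form [omega a] with the vector s (x) y, up to sign.
    After expansion on this rank one vector the two sides differ by a multiple of the relation C,
    which is Cramer's rule for four vectors together with F(t, x) = 0. *)
Lemma dbeta_omega a e e' : t 0 a * dbeta e e' = - omega a z e e'.
Proof.
have P1 := grad_phi_eps e; have P2 := grad_phi_eps e'.
have -> : omega a z e e' =
    (t0 * s 0 b1 - t1 * s 0 b0) *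
      (trip x y (eps e) * grad_phi a e' - trip x y (eps e') * grad_phi a e)
    + trip x (eps e) (eps e') * (t 0 a * uform s y + s 0 a * uform t y).
  by rewrite /omega eps_rank1 grad_phi_rank1 !tripE !mxE; ring.
have C : trip x y (eps e) * uform t (eps e') - trip x y (eps e') * uform t (eps e)
     + trip x (eps e) (eps e') * uform t y = 0.
  transitivity (trip y (eps e) (eps e') * uform t x); last by rewrite tx0 mulr0.
  by rewrite !tripE /uform !dotE; ring.
have D v : dot y (cross x v) = - trip x y v by rewrite dotE !crossE tripE; ring.
rewrite /dbeta !D; apply/eqP; rewrite -subr_eq0 opprK; apply/eqP.
set f0 := grad_phi b0 in P1 P2 *; set f1 := grad_phi b1 in P1 P2 *.
have {P1}Q1 : uform t (eps e) = t0 * f1 e - t1 * f0 e by rewrite P1; ring.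
have {P2}Q2 : uform t (eps e') = t0 * f1 e' - t1 * f0 e' by rewrite P2; ring.
rewrite {}Q1 {}Q2 in C.
rewrite -[RHS](mulr0 (s 0 a)) -[in RHS]C.
by case: (ord2P a) => ->; rewrite -/f0 -/f1 -/t0 -/t1; ring.
Qed.

End Beta.

(** The first summand comes from the leading term of [pi_elt], the second from its corrections. The
    factor t_a makes both omegas multiples of [omega a]; the sum is then a combination of three
    instances of the relation C, with the differentials of phi_a as coefficients. *)
Lemma pi_eq0 (y : 'rV[K]_3) a e e' e'' :
  t 0 a * (trip (vals (fun e => dot y (cross x (eps e))) e e' e'')
       (vals (grad_phi b0) e e' e'') (vals (grad_phi b1) e e' e'')
  + (dot u0 y * omega b0 e e' e'' + dot u1 y * omega b1 e e' e'')) = 0.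
Proof.
have P0 := grad_phi_eps e; have P1 := grad_phi_eps e'; have P2 := grad_phi_eps e''.
have D v : dot y (cross x v) = - trip x y v by rewrite dotE !crossE tripE; ring.
have C v w : trip x y v * uform t w - trip x y w * uform t v + trip x v w * uform t y = 0.
  transitivity (trip y v w * uform t x); last by rewrite tx0 mulr0.
  by rewrite !tripE /uform !dotE; ring.
have W : t 0 a * (dot u0 y * omega b0 e e' e'' + dot u1 y * omega b1 e e' e'') =
    uform t y * omega a e e' e''.
  rewrite mulrDr ![t 0 a * (_ * _)]mulrCA !(omega_prop2 a) /uform; ring.
rewrite mulrDr W tripE !valsE !D /omega.
have C0 := C (eps e) (eps e'); have C1 := C (eps e') (eps e''); have C2 := C (eps e'') (eps e).
have {P0}Q0 : uform t (eps e) = t0 * grad_phi b1 e - t1 * grad_phi b0 e by rewrite P0; ring.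
have {P1}Q1 : uform t (eps e') = t0 * grad_phi b1 e' - t1 * grad_phi b0 e' by rewrite P1; ring.
have {P2}Q2 : uform t (eps e'') = t0 * grad_phi b1 e'' - t1 * grad_phi b0 e'' by rewrite P2; ring.
transitivity (grad_phi a e'' * 0 + grad_phi a e * 0 + grad_phi a e' * (0 : K)); last by ring.
rewrite -[in X in _ = X + _ + _]C0 -[in X in _ = _ + X + _]C1 -[in X in _ = _ + X]C2.
rewrite Q0 Q1 Q2; by case: (ord2P a) => ->; rewrite -/t0 -/t1; ring.
Qed.

End Gradients.

(** * Coordinates on the Segre threefold and the divisor of bidegree (1, 2) *)

Section SegreCoordinates.
Variable K : numFieldType.
Implicit Types (t s : 'rV[K]_2) (x y : 'rV[K]_3) (L : 'M[K]_(2 * 3, 6)).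

(* The point t (x) x of the Segre threefold, in the embedding of matrix L. *)
Definition sg L t x : 'rV[K]_6 := mxvec (t^T *m x) *m L.

Lemma mxvec_mulE (e : 'M[K]_(2, 3)) (m : nat) (N : 'M[K]_(2 * 3, m)) k :
  (mxvec e *m N) 0 k = \sum_i \sum_j e i j * N (mxvec_index i j) k.
Proof.
rewrite mxE (reindex _ (curry_mxvec_bij _ _)) /= pair_bigA /=.
by apply: eq_bigr => -[i j] _; rewrite mxvecE.
Qed.

Lemma rank1E t x i j : (t^T *m x) i j = t 0 i * x 0 j.
Proof. by rewrite !mxE big_ord1 !mxE. Qed.

Lemma rank1Dl t s x : (t + s)^T *m x = t^T *m x + s^T *m x.
Proof. by rewrite raddfD mulmxDl. Qed.
Lemma rank1Dr t x y : t^T *m (x + y) = t^T *m x + t^T *m y.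
Proof. exact: mulmxDr. Qed.
Lemma rank1Zr c t x : t^T *m (c *: x) = c *: (t^T *m x).
Proof. by rewrite scalemxAr. Qed.
Lemma rank1Zl c t x : (c *: t)^T *m x = c *: (t^T *m x).
Proof. by rewrite linearZ -scalemxAl. Qed.

Lemma sgDl L t s x : sg L (t + s) x = sg L t x + sg L s x.
Proof. by rewrite /sg rank1Dl raddfD mulmxDl. Qed.
Lemma sgDr L t x y : sg L t (x + y) = sg L t x + sg L t y.
Proof. by rewrite /sg rank1Dr raddfD mulmxDl. Qed.
Lemma sgZl L c t x : sg L (c *: t) x = c *: sg L t x.
Proof. by rewrite /sg rank1Zl linearZ -scalemxAl. Qed.
Lemma sgZr L c t x : sg L t (c *: x) = c *: sg L t x.
Proof. by rewrite /sg rank1Zr linearZ -scalemxAl. Qed.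

Lemma mx_rank1_rows (e : 'M[K]_(2, 3)) :
  e = (delta_mx 0 b0)^T *m row b0 e + (delta_mx 0 b1)^T *m row b1 e.
Proof.
apply/matrixP => i j; rewrite !mxE !big_ord1 !mxE !eqxx /=.
by case: (ord2P i) => -> /=; rewrite ?mul1r ?mul0r ?addr0 ?add0r.
Qed.

Lemma row_delta_sum (n : nat) (y : 'rV[K]_n) : y = \sum_i y 0 i *: delta_mx 0 i.
Proof. exact: row_sum_delta. Qed.

(** Writing e as the sum of two rank one matrices, one per row, turns q(e) into a polar form in the
    two rows. It vanishes on equal rows, where the sum has rank one, so it is alternating; on a
    3-space such a form is a vector paired with the cross product. *)
Lemma quadric_on_rank1 L (q : {mpoly K[6]}) : q \is 2.-homog ->
  (forall t x, peval q (sg L t x) = 0) ->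
  exists al : 'rV[K]_3, forall e : 'M_(2, 3),
    peval q (mxvec e *m L) = dot al (cross (row b0 e) (row b1 e)).
Proof.
move=> q2 q0.
pose s0 : 'rV[K]_2 := delta_mx 0 b0; pose s1 : 'rV[K]_2 := delta_mx 0 b1.
pose g x y := polar q (sg L s0 x) (sg L s1 y).
have gD x x' y : g (x + x') y = g x y + g x' y by rewrite /g sgDr polarDl.
have gZ c x y : g (c *: x) y = c * g x y by rewrite /g sgZr polarZl.
have gD' x y y' : g x (y + y') = g x y + g x y' by rewrite /g sgDr polarDr.
have gZ' c x y : g x (c *: y) = c * g x y by rewrite /g sgZr polarZr.
have gxx x : g x x = 0 by rewrite /g /polar -sgDl !q0; ring.
have gC x y : g y x = - g x y.
  have := gxx (x + y); rewrite gD !gD' !gxx addr0 add0r => /eqP.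
  by rewrite addrC addr_eq0 => /eqP.
pose d i : 'rV[K]_3 := delta_mx 0 i.
exists (row3 (g (d o1) (d o2)) (g (d o2) (d o0)) (g (d o0) (d o1))) => e.
have -> : peval q (mxvec e *m L) = g (row b0 e) (row b1 e).
  by rewrite {1}(mx_rank1_rows e) raddfD mulmxDl /g /polar -!/(sg L _ _) !q0; ring.
have dE (y : 'rV[K]_3) : y = y 0 o0 *: d o0 + y 0 o1 *: d o1 + y 0 o2 *: d o2.
  by rewrite {1}(row_delta_sum y) sum3E.
set x := row b0 e; set y := row b1 e.
rewrite {1}(dE x) {1}(dE y) !gD !gD' !gZ !gZ' !gxx dotE !row3E.
rewrite (gC (d o1) (d o2)) (gC (d o2) (d o0)) (gC (d o0) (d o1)); ring.
Qed.

Definition qform (q : 'M[K]_3) x y := dot (x *m q) y.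

Lemma qformC (q : 'M[K]_3) x y : q^T = q -> qform q x y = qform q y x.
Proof.
move=> qs; have qE i j : q j i = q i j by rewrite -[in LHS]qs mxE.
rewrite /qform !dotE !mxE !sum3E (qE o0 o1) (qE o0 o2) (qE o1 o2); ring.
Qed.

(* The root of the linear form [Fval q0 q1 ^~ x]; it is 0 when x is a common
   zero of q0 and q1. *)
Definition zpt (q0 q1 : 'M[K]_3) x : 'rV[K]_2 := \row_i (if i == b0 then qform q1 x x else - qform q0 x x).

Definition Fval (q0 q1 : 'M[K]_3) t x := t 0 b0 * qform q0 x x + t 0 b1 * qform q1 x x.

Definition Fpoly (q0 q1 : 'M[K]_3) : {mpoly K[3 + 3]} :=
  \sum_i \sum_j (q0 i j *: ('X_(lshift 3 o0) * ('X_(rshift 3 i) * 'X_(rshift 3 j)))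
               + q1 i j *: ('X_(lshift 3 o1) * ('X_(rshift 3 i) * 'X_(rshift 3 j)))).

Definition lead2 (y : 'rV[K]_3) : 'rV[K]_2 := \row_i (if i == b0 then y 0 o0 else y 0 o1).

Lemma lead2E y : (lead2 y 0 b0 = y 0 o0) * (lead2 y 0 b1 = y 0 o1).
Proof. by rewrite !mxE. Qed.

Lemma zptE q0 q1 x : (zpt q0 q1 x 0 b0 = qform q1 x x) * (zpt q0 q1 x 0 b1 = - qform q0 x x).
Proof. by rewrite !mxE. Qed.

Lemma peval_Fpoly q0 q1 y x : peval (Fpoly q0 q1) (row_mx y x) = Fval q0 q1 (lead2 y) x.
Proof.
rewrite /Fpoly !peval_sum sum3E !peval_sum !sum3E.
rewrite !pevalE !row_mxEl !row_mxEr /Fval /qform !dotE !mxE !sum3E !eqxx /=.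
ring.
Qed.

Lemma Fval_zpt q0 q1 a x : Fval q0 q1 (a *: zpt q0 q1 x) x = 0.
Proof. by rewrite /Fval !mxE /=; ring. Qed.

End SegreCoordinates.

(* Y is the divisor [Fval q0 q1 = 0] in the coordinates of L on the Segre
   threefold of the k-th pencil of conics, and x |-> (zpt x, x) inverts the
   projection of Y to P^2.  [adapted_divides] expresses that F is irreducible. *)
Record adapted (K : numFieldType) (p : 'I_4 -> 'rV[K]_3) (f : 'I_6 -> {mpoly K[3]})
    (k : option 'I_4) (L : 'M[K]_(2 * 3, 6)) (q0 q1 : 'M[K]_3) : Prop := Adapted {
  adapted_sym0 : q0^T = q0;
  adapted_sym1 : q1^T = q1;
  adapted_free : row_free L;
  adapted_point : forall v, exists t x,
    (\row_i peval (f i) v = sg L t x) /\ Fval q0 q1 t x = 0;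
  adapted_divides : forall H : {mpoly K[3 + 3]},
    (forall a y2 x, peval H (row_mx (row3 (a * qform q1 x x) (- (a * qform q0 x x)) y2) x) = 0) ->
    divides (Fpoly q0 q1) H;
  adapted_dP : forall g, g \is 2.-homog -> dP_ideal f g ->
    forall x, peval g (sg L (zpt q0 q1 x) x) = 0;
  adapted_dP_inv : forall g, (forall a x, peval g (sg L (a *: zpt q0 q1 x) x) = 0) ->
    dP_ideal f g;
  adapted_segre : forall v, segre_threefold p f k v <-> exists t x, v = sg L t x }.

(** * Membership in the Lagrangian space *)

Section LinearCombinations.
Variable K : numFieldType.

Lemma lcombD m n (w : 'I_m -> {mpoly K[n]}) a b : lcomb w (a + b) = lcomb w a + lcomb w b.
Proof. by rewrite /lcomb -big_split; apply: eq_bigr => i _; rewrite mxE scalerDl. Qed.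
Lemma lcombZ m n (w : 'I_m -> {mpoly K[n]}) c a : lcomb w (c *: a) = c *: lcomb w a.
Proof. by rewrite /lcomb scaler_sumr; apply: eq_bigr => i _; rewrite mxE scalerA. Qed.
Lemma lcomb0 m n (w : 'I_m -> {mpoly K[n]}) : lcomb w 0 = 0.
Proof. by rewrite /lcomb big1 // => i _; rewrite mxE scale0r. Qed.
Lemma lcomb_sum m n (w : 'I_m -> {mpoly K[n]}) l (c : 'I_l -> K) (a : 'I_l -> 'rV[K]_m) :
  lcomb w (\sum_i c i *: a i) = \sum_i c i *: lcomb w (a i).
Proof.
elim/big_ind2: _ => [|? ? ? ? <- <-|i _]; [exact: lcomb0|by rewrite lcombD|by rewrite lcombZ].
Qed.
Lemma lcomb_mul m n (w : 'I_m -> {mpoly K[n]}) l (a : 'rV[K]_l) (M : 'M[K]_(l, m)) :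
  lcomb w (a *m M) = lcomb (fun i => lcomb w (row i M)) a.
Proof. by rewrite mulmx_sum_row lcomb_sum. Qed.

Lemma row_choice m n (P : 'I_m -> 'rV[K]_n -> Prop) :
  (forall i, exists a, P i a) -> exists M : 'M[K]_(m, n), forall i, P i (row i M).
Proof.
case/fin_all_exists => g gP; exists (\matrix_i g i) => i; by rewrite rowK.
Qed.

Lemma dP_idealP (f : 'I_6 -> {mpoly K[3]}) g :
  dP_ideal f g <-> forall v, peval g (\row_i peval (f i) v) = 0.
Proof.
split=> [fg v|fg]; first by rewrite -peval_psubst fg peval0.
by apply: mpoly_eq0_eval => v; rewrite peval_psubst.
Qed.

Lemma dP_ideal_curve (f : 'I_6 -> {mpoly K[3]}) Q g : dP_ideal f g -> curve_ideal f Q g.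
Proof. by move=> fg; exists 0; rewrite mul0r subr0. Qed.

Lemma peval_det n m (M : 'M[{mpoly K[n]}]_m) v :
  peval (\det M) v = \det (map_mx (fun g => peval g v) M).
Proof. exact: (esym (det_map_mx (meval (fun i => v 0 i)) M)). Qed.

End LinearCombinations.

(** * A criterion for membership in A *)

Section Membership.
Variable K : numFieldType.
Variables (f : 'I_6 -> {mpoly K[3]}) (Q : {mpoly K[6]}) (w : 'I_6 -> {mpoly K[6]}).
Hypothesis hw : lin_basis (quadrics_through (curve_ideal f Q)) w.
Implicit Types (r : 'rV[K]_6) (c : 'I_3 -> 'I_6).

Lemma wq_through r : quadrics_through (curve_ideal f Q) (lcomb w r).
Proof. by apply/hw.1; exists r. Qed.

Lemma wq_homog r : lcomb w r \is 2.-homog.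
Proof. by have [] := wq_through r. Qed.

Lemma w_homog i : w i \is 2.-homog.
Proof.
have -> : w i = lcomb w (delta_mx 0 i); last exact: wq_homog.
rewrite /lcomb (bigD1 i) //= !mxE !eqxx scale1r big1 ?addr0 // => j ji.
by rewrite mxE (negPf ji) andbF scale0r.
Qed.

Lemma lcomb_w_inj r r' : lcomb w r = lcomb w r' -> r = r'.
Proof.
move=> E; apply/eqP; rewrite -subr_eq0; apply/eqP/hw.2.
by rewrite -scaleN1r lcombD lcombZ scaleN1r E subrr.
Qed.

Lemma polar_lcomb r z e : polar (lcomb w r) z e = \sum_k r 0 k * polar (w k) z e.
Proof.
rewrite /polar !peval_lcomb -!sumrB; apply: eq_bigr => k _; ring.
Qed.

(** Up to sign, the value of the linear form of x on the plane P_z, as a form in z: the Plucker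
    coordinates of P_z being complementary minors, no singular point has to be chosen. *)
Definition form3 c (x : ext K) : {mpoly K[6]} :=
  \sum_(T : {set 'I_6} | #|T| == 3%N) x T *: jacobian_minor w (fun i : 'I_3 => sel T i) c.

Lemma form3D c x y : form3 c (x + y) = form3 c x + form3 c y.
Proof. by rewrite /form3 -big_split; apply: eq_bigr => T _; rewrite ffunE scalerDl. Qed.

Lemma form3Z c k x : form3 c (k *: x) = k *: form3 c x.
Proof.
rewrite /form3 scaler_sumr; apply: eq_bigr => T _; by rewrite ffunE scalerA.
Qed.

Lemma form3_sum c I (s : seq I) (F : I -> ext K) :
  form3 c (\sum_(i <- s) F i) = \sum_(i <- s) form3 c (F i).
Proof.
apply: (big_morph (form3 c) (form3D c)).
by rewrite /form3 big1 // => T _; rewrite ffunE scale0r.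
Qed.

Lemma peval_form3 c r0 r1 r2 z :
  peval (form3 c (w3 r0 r1 r2)) z =
  trip (row3 (polar (lcomb w r0) z (delta_mx 0 (c o0))) (polar (lcomb w r0) z (delta_mx 0 (c o1)))
             (polar (lcomb w r0) z (delta_mx 0 (c o2))))
       (row3 (polar (lcomb w r1) z (delta_mx 0 (c o0))) (polar (lcomb w r1) z (delta_mx 0 (c o1)))
             (polar (lcomb w r1) z (delta_mx 0 (c o2))))
       (row3 (polar (lcomb w r2) z (delta_mx 0 (c o0))) (polar (lcomb w r2) z (delta_mx 0 (c o1)))
             (polar (lcomb w r2) z (delta_mx 0 (c o2)))).
Proof.
pose N := \matrix_(k < 6, j < 3) polar (w k) z (delta_mx 0 (c j)).
have := Cauchy_Binet3 N (l3 r0 r1 r2); rewrite /l3 /= det3E !mxE -!/(N _ _) => E.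
rewrite tripE !row3E !polar_lcomb.
transitivity (\sum_(T : {set 'I_6} | #|T| == 3%N)
   w3 r0 r1 r2 T * \det (\matrix_(i < 3, j < 3) N (sel T i) j)).
  rewrite /form3 peval_sum; apply: eq_bigr => T _; rewrite pevalZ peval_det; congr (_ * \det _).
  by apply/matrixP => i j; rewrite !mxE peval_mderiv // w_homog.
rewrite E /=.
have NE r j : \sum_k r 0 k * N k j = \sum_k r 0 k * polar (w k) z (delta_mx 0 (c j)).
  by apply: eq_bigr => k _; rewrite mxE.
rewrite !NE; ring.
Qed.

(** A 4 x 4 Jacobian minor with respect to arbitrary quadrics of W (rows of R) and arbitrary
    directions (columns of E). *)
Definition form4 (R : 'M[K]_(4, 6)) (E : 'M[K]_(6, 4)) : {mpoly K[6]} :=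
  \det (map_mx (@mpolyC 6 K) R *m (\matrix_(k, l) (w k)^`M(l)) *m map_mx (@mpolyC 6 K) E).

Lemma peval_form4 R E z :
  peval (form4 R E) z = \det (\matrix_(i, j) polar (lcomb w (row i R)) z (\sum_l E l j *: delta_mx 0 l)).
Proof.
rewrite /form4 peval_det; congr (\det _); apply/matrixP => i j; rewrite !mxE peval_sum.
have -> : polar (lcomb w (row i R)) z (\sum_l E l j *: delta_mx 0 l) =
   \sum_l E l j * polar (lcomb w (row i R)) z (delta_mx 0 l).
  apply: (big_ind2 (fun a b => polar (lcomb w (row i R)) z a = b)).
  - by rewrite /polar addr0 subrr sub0r (peval_homog0 (wq_homog _)) oppr0.
  - by move=> a b a' b' <- <-; rewrite polarDr ?wq_homog.
  by move=> l _; rewrite polarZr ?wq_homog.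
apply: eq_bigr => l _; rewrite !mxE pevalM peval_sum pevalC mulrC; congr (_ * _).
rewrite polar_lcomb; apply: eq_bigr => k _.
by rewrite !mxE pevalM pevalC peval_mderiv // w_homog.
Qed.

Definition minor_span (g : {mpoly K[6]}) :=
  exists h : {ffun 'I_4 -> 'I_6} -> {ffun 'I_4 -> 'I_6} -> {mpoly K[6]},
    g = \sum_r \sum_c h r c * jacobian_minor w r c.

Lemma minor_spanD g g' : minor_span g -> minor_span g' -> minor_span (g + g').
Proof.
move=> [h ->] [h' ->]; exists (fun R C => h R C + h' R C).
rewrite -big_split; apply: eq_bigr => r _; rewrite -big_split; apply: eq_bigr => c _ /=.
by rewrite mulrDl.
Qed.

Lemma minor_spanZ k g : minor_span g -> minor_span (k *: g).
Proof.
move=> [h ->]; exists (fun R C => k *: h R C).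
rewrite scaler_sumr; apply: eq_bigr => r _; rewrite scaler_sumr; apply: eq_bigr => c _.
by rewrite scalerAl.
Qed.

Lemma minor_span_sum I (s : seq I) (F : I -> {mpoly K[6]}) :
  (forall i, minor_span (F i)) -> minor_span (\sum_(i <- s) F i).
Proof.
move=> Fs; apply: (big_ind minor_span) => //; last exact: minor_spanD.
exists (fun _ _ => 0); rewrite big1 // => r _; rewrite big1 // => c _; exact: mul0r.
Qed.

Lemma form4_span R E : minor_span (form4 R E).
Proof.
exists (fun (r c : {ffun 'I_4 -> 'I_6}) => (\prod_i (R i (r i))%:MP) * (\prod_j (E (c j) j)%:MP)).
rewrite /form4 -mulmxA det_mul_expand; apply: eq_bigr => r _.
set J := \matrix_(k, l) (w k)^`M(l).
have -> : \det (\matrix_(i, j) (J *m map_mx (@mpolyC 6 K) E) (r i) j) =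
    \det ((map_mx (@mpolyC 6 K) E)^T *m (\matrix_(i, j) J (r i) j)^T).
  rewrite -trmx_mul det_tr; congr (\det _); apply/matrixP => i j; rewrite !mxE.
  by apply: eq_bigr => l _; rewrite !mxE.
rewrite det_mul_expand big_distrr; apply: eq_bigr => c _ /=; rewrite -!mulrA; congr (_ * _).
  by apply: eq_bigr => i _; rewrite mxE.
congr (_ * _); first by apply: eq_bigr => i _; rewrite !mxE.
rewrite /jacobian_minor -det_tr; congr (\det _); apply/matrixP => i j; by rewrite !mxE.
Qed.

Variables (J : Type) (P : J -> 'M[K]_(3, 6)) (A : {vspace ext K}).
Hypothesis hFC : FC_eq_section P (curve_ideal f Q) w A.
Hypothesis hM : morin_configuration A.

(** The two shuffle signs multiply to (-1) ^ (3 * 3), whence the minus sign. *)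
Lemma psubst_linear_form c (x : ext K) : (forall S : {set 'I_6}, #|S| != 3%N -> x S = 0) ->
  psubst (fun i => sing_plucker w c (enum_val i)) (linear_form_of x) = - form3 c x.
Proof.
move=> xs; rewrite /psubst /linear_form_of raddf_sum /=.
under eq_bigr => i _ do rewrite comp_mpolyZ comp_mpolyXU -tnth_nth tnth_mktuple.
transitivity (\sum_(S : {set 'I_6}) (shuffle_sign K (~: S) S * x (~: S)) *: sing_plucker w c S).
  rewrite [RHS](reindex (@enum_val _ (mem {: {set 'I_6}}))) //.
  exists enum_rank => S _; [exact: enum_valK|exact: enum_rankK].
rewrite (reindex_inj (can_inj (@setCK _))) /= /form3 -sumrN [RHS]big_mkcond /=.
apply: eq_bigr => T _; rewrite setCK /sing_plucker (setC_card3 T).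
case: ifP => [T3|_]; last by rewrite scaler0.
rewrite setCK scalerA mulrAC shuffle_sign_swap -?setI_eq0 ?setICr //.
have T3' : #|~: T| == 3%N by rewrite setC_card3.
by rewrite (eqP T3) (eqP T3') -signr_odd expr1 mulN1r scaleNr.
Qed.

(** By maximality the linear form of x only has to vanish on A, and A is spanned by the scheme F_C.
    At Sing C one multiplication by a linear form brings it into the ideal of the minors, so
    saturation exponent 1 suffices. *)
Lemma mem_lagrangian (x : ext K) : (forall S : {set 'I_6}, #|S| != 3%N -> x S = 0) ->
  (forall k, wedge x (plucker (P k)) setT = 0) ->
  (forall c a, exists2 m, minor_span m & dP_ideal f (lcomb (fun i => 'X_i) a * form3 c x - m)) ->
  x \in A.
Proof.
move=> xs xP xJ; have [lagA spanA] := hM; apply: lagrangian_maximal => // a aA.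
rewrite -ext_eval_linear_form; apply: (spanA _ (linear_form_homog x)) => //.
apply/(hFC (linear_form_homog x)); split=> [k|c]; first by rewrite ext_eval_linear_form.
rewrite psubst_linear_form //; exists 1%N => h /dhomog1_lcomb [b ->].
have [m [hm mE] dm] := xJ c (- b).
exists hm, 0; rewrite -mE mul0r subr0.
by move: dm; rewrite -[- b]scaleN1r lcombZ scaleN1r mulNr mulrN.
Qed.

End Membership.

Definition p0 : 'I_4 := @Ordinal 4 0 isT.
Definition p1 : 'I_4 := @Ordinal 4 1 isT.
Definition p2 : 'I_4 := @Ordinal 4 2 isT.
Definition p3 : 'I_4 := @Ordinal 4 3 isT.

Lemma det4E (K : numFieldType) (M : 'M[K]_4) :
  let D a b c := trip (row3 (M p1 a) (M p1 b) (M p1 c)) (row3 (M p2 a) (M p2 b) (M p2 c))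
                      (row3 (M p3 a) (M p3 b) (M p3 c)) in
  \det M = M p0 p0 * D p1 p2 p3 - M p0 p1 * D p0 p2 p3 + M p0 p2 * D p0 p1 p3
           - M p0 p3 * D p0 p1 p2.
Proof.
move=> D; rewrite (expand_det_row _ p0) !big_ord_recl big_ord0 addr0 /cofactor !det3E !mxE.
do ?[rewrite (_ : ord0 = p0); last exact: val_inj].
rewrite (_ : lift p0 ord0 = p1); last exact: val_inj.
rewrite (_ : lift p0 (lift ord0 ord0) = p2); last exact: val_inj.
rewrite (_ : lift p0 (lift ord0 (lift ord0 ord0)) = p3); last exact: val_inj.
do ?[rewrite (_ : lift p0 o0 = p1); last exact: val_inj].
do ?[rewrite (_ : lift p0 o1 = p2); last exact: val_inj].
do ?[rewrite (_ : lift p0 o2 = p3); last exact: val_inj].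
do ?[rewrite (_ : lift p1 o0 = p0); last exact: val_inj].
do ?[rewrite (_ : lift p1 o1 = p2); last exact: val_inj].
do ?[rewrite (_ : lift p1 o2 = p3); last exact: val_inj].
do ?[rewrite (_ : lift p2 o0 = p0); last exact: val_inj].
do ?[rewrite (_ : lift p2 o1 = p1); last exact: val_inj].
do ?[rewrite (_ : lift p2 o2 = p3); last exact: val_inj].
do ?[rewrite (_ : lift p3 o0 = p0); last exact: val_inj].
do ?[rewrite (_ : lift p3 o1 = p1); last exact: val_inj].
do ?[rewrite (_ : lift p3 o2 = p2); last exact: val_inj].
rewrite /D !tripE !row3E /=; ring.
Qed.

(** * Points of P^5 as 2 x 3 matrices *)

Section Coordinates.
Variable K : numFieldType.
Implicit Types (e : 'M[K]_(2, 3)) (v z : 'rV[K]_6).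
Variable L : 'M[K]_(2 * 3, 6).
Hypothesis Lfree : row_free L.

Lemma L_inv : L *m pinvmx L = 1%:M.
Proof. exact: mulmxVp. Qed.

Lemma L_inv' : pinvmx L *m L = 1%:M.
Proof. by apply: mulVpmx; move: Lfree; rewrite /row_free /row_full. Qed.

Definition coords v : 'M[K]_(2, 3) := vec_mx (v *m pinvmx L).

Lemma coordsK v : mxvec (coords v) *m L = v.
Proof. by rewrite /coords vec_mxK -mulmxA L_inv' mulmx1. Qed.

Lemma mxvecK_coords e : coords (mxvec e *m L) = e.
Proof. by rewrite /coords -mulmxA L_inv mulmx1 mxvecK. Qed.

Lemma coord_poly i j : exists2 g : {mpoly K[6]}, g \is 1.-homog &
  forall e, peval g (mxvec e *m L) = e i j.
Proof.
exists (lcomb (fun i => 'X_i) (\row_k pinvmx L k (mxvec_index i j))).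
  by apply: rpred_sum => k _; apply: rpredZ; rewrite dhomogX /= mdeg1.
move=> e; rewrite peval_lcomb -[in RHS](mxvecK_coords e) /coords mxE [RHS]mxE.
by apply: eq_bigr => k _; rewrite pevalX mxE mulrC.
Qed.

Lemma minor_poly i : exists2 g : {mpoly K[6]}, g \is 2.-homog &
  forall e, peval g (mxvec e *m L) = cross (row b0 e) (row b1 e) 0 i.
Proof.
have [g00 h00 E00] := coord_poly b0 (ordS i).
have [g01 h01 E01] := coord_poly b0 (ordS (ordS i)).
have [g10 h10 E10] := coord_poly b1 (ordS i).
have [g11 h11 E11] := coord_poly b1 (ordS (ordS i)).
exists (g00 * g11 - g01 * g10).
  by apply: rpredB; [exact: (dhomogM h00 h11)|exact: (dhomogM h01 h10)].
move=> e; rewrite !pevalE E00 E01 E10 E11.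
by case: (ord3P i) => ->; rewrite !ordSE !crossE !mxE.
Qed.

Lemma phi_poly (q0 q1 : 'M[K]_3) a : exists2 g : {mpoly K[6]}, g \is 2.-homog &
  forall e, peval g (mxvec e *m L) =
    qform q0 (row b0 e) (row a e) + qform q1 (row b1 e) (row a e).
Proof.
have [X XP] : exists X : 'I_2 -> 'I_3 -> {mpoly K[6]}, forall i j, X i j \is 1.-homog /\
    forall e, peval (X i j) (mxvec e *m L) = e i j.
  have H i : exists X : 'I_3 -> {mpoly K[6]}, forall j, X j \is 1.-homog /\
      forall e, peval (X j) (mxvec e *m L) = e i j.
    apply: (@fin_all_exists _ (fun=> {mpoly K[6]}) (fun j g => g \is 1.-homog /\
      forall e, peval g (mxvec e *m L) = e i j)) => j.
    by have [g h E] := coord_poly i j; exists g.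
  exact: (@fin_all_exists _ (fun=> 'I_3 -> {mpoly K[6]}) (fun i X => forall j, X j \is 1.-homog /\
      forall e, peval (X j) (mxvec e *m L) = e i j) H).
exists (\sum_i \sum_j (q0 i j *: (X b0 i * X a j) + q1 i j *: (X b1 i * X a j))).
  apply: rpred_sum => i _; apply: rpred_sum => j _; apply: rpredD; apply: rpredZ;
    exact: (dhomogM (XP _ _).1 (XP _ _).1).
move=> e; rewrite !peval_sum sum3E !peval_sum !sum3E !pevalE !(XP _ _).2.
rewrite /qform !dotE !mxE !sum3E !mxE; ring.
Qed.

End Coordinates.

Section Net.
Variable K : numFieldType.
Variables (p : 'I_4 -> 'rV[K]_3) (f : 'I_6 -> {mpoly K[3]}).
Variables (k : option 'I_4) (L : 'M[K]_(2 * 3, 6)) (q0 q1 : 'M[K]_3).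
Hypothesis ad : adapted p f k L q0 q1.

Lemma segre_netP q : segre_net p f k q <->
  q \is 2.-homog /\ forall t x, peval q (sg L t x) = 0.
Proof.
split=> -[q2 q0']; split=> //.
  by move=> t x; apply: q0'; apply/(adapted_segre ad); exists t, x.
by move=> v /(adapted_segre ad)[t [x ->]].
Qed.

Lemma segre_net_minors q : q \is 2.-homog ->
  (segre_net p f k q <-> exists al : 'rV[K]_3, forall e : 'M_(2, 3),
     peval q (mxvec e *m L) = dot al (cross (row b0 e) (row b1 e))).
Proof.
move=> q2; rewrite segre_netP; split=> [[_ qv]|[al qal]]; first exact: quadric_on_rank1.
split=> // t x; rewrite /sg qal dotE !crossE !mxE !big_ord1 !mxE; ring.
Qed.

Lemma segre_net_dP q : segre_net p f k q -> dP_ideal f q.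
Proof.
case/segre_netP => _ qv; apply/dP_idealP => v.
by have [t [x [-> _]]] := adapted_point ad v.
Qed.

(** The 2 x 2 minors belong to the net, so a base point is a matrix of rank at most one; the case
    distinction extracts the two factors of such a matrix. *)
Lemma base_locus_adapted : base_locus_is_segre (segre_net p f k) L.
Proof.
have Lf := adapted_free ad; split=> // v; split=> [vN|[t [x ->]] g]; last first.
  by case/segre_netP => _; apply.
have cr i : cross (row b0 (coords L v)) (row b1 (coords L v)) 0 i = 0.
  have [g g2 gE] := minor_poly Lf i.
  rewrite -gE coordsK //; apply: vN; apply/(segre_net_minors g2); exists (delta_mx 0 i) => e.
  by rewrite gE dotE !mxE !eqxx /=; case: (ord3P i) => ->; rewrite /= ?mul1r ?mul0r ?addr0 ?add0r.
set e := coords L v in cr; rewrite -(coordsK Lf v) -/e.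
set x := row b0 e in cr; set y := row b1 e in cr.
have [x0|xn0] := eqVneq x 0.
  exists (delta_mx 0 b1), y; congr (mxvec _ *m _); rewrite [LHS]mx_rank1_rows -/x x0.
  by rewrite mulmx0 add0r.
have [c yE] : exists c, y = c *: x.
  have /rV0Pn[j xj] := xn0; exists (y 0 j / x 0 j); apply/rowP => i; rewrite [RHS]mxE.
  apply: (mulIf xj); rewrite mulrAC divfK //.
  have E0 := cr o0; have E1 := cr o1; have E2 := cr o2; rewrite !crossE in E0 E1 E2.
  apply/eqP; rewrite -subr_eq0; apply/eqP.
  case: (ord3P i) => ->; case: (ord3P j) => ->.
  - by rewrite mulrC subrr.
  - by rewrite -[RHS]oppr0 -[in RHS]E2; ring.
  - by rewrite -[RHS]E1; ring.
  - by rewrite -[RHS]E2; ring.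
  - by rewrite mulrC subrr.
  - by rewrite -[RHS]oppr0 -[in RHS]E0; ring.
  - by rewrite -[RHS]oppr0 -[in RHS]E1; ring.
  - by rewrite -[RHS]E0; ring.
  by rewrite mulrC subrr.
exists (\row_i (if i == b0 then 1 else c)), x; congr (mxvec _ *m _).
apply/matrixP => i j; rewrite rank1E mxE; have /rowP/(_ j) := yE; rewrite !mxE => yj.
by case: (ord2P i) => -> /=; rewrite ?mul1r.
Qed.

End Net.

(* Coordinates in the basis w of the quadrics spanning W: the 2 x 2 minors, two
   quadrics restricting to t_a F on P^1 x P^2, and Q. *)
Record quadric_rows (K : numFieldType) (Q : {mpoly K[6]}) (w : 'I_6 -> {mpoly K[6]})
    (L : 'M[K]_(2 * 3, 6)) (q0 q1 : 'M[K]_3)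
    (mu : 'M[K]_(3, 6)) (ph : 'M[K]_(2, 6)) (ka : 'rV[K]_6) : Prop := QuadricRows {
  quadric_minor : forall i (e : 'M_(2, 3)),
    peval (lcomb w (row i mu)) (mxvec e *m L) = cross (row b0 e) (row b1 e) 0 i;
  quadric_phi : forall a (e : 'M_(2, 3)),
    peval (lcomb w (row a ph)) (mxvec e *m L) =
      qform q0 (row b0 e) (row a e) + qform q1 (row b1 e) (row a e);
  quadric_section : lcomb w ka = Q }.

Section Existence.
Variable K : numFieldType.
Variables (p : 'I_4 -> 'rV[K]_3) (f : 'I_6 -> {mpoly K[3]}) (Q : {mpoly K[6]}).
Variables (w : 'I_6 -> {mpoly K[6]}) (k : option 'I_4) (L : 'M[K]_(2 * 3, 6)) (q0 q1 : 'M[K]_3).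
Hypothesis Q2 : Q \is 2.-homog.
Hypothesis hw : lin_basis (quadrics_through (curve_ideal f Q)) w.
Hypothesis ad : adapted p f k L q0 q1.

Lemma dP_row q : q \is 2.-homog -> dP_ideal f q -> exists a, lcomb w a = q.
Proof.
move=> q2 qf; have /hw.1 [a ->] : quadrics_through (curve_ideal f Q) q.
  by split=> //; apply: dP_ideal_curve.
by exists a.
Qed.

Lemma quadric_rows_exist : exists mu ph ka, quadric_rows Q w L q0 q1 mu ph ka.
Proof.
have Lf := adapted_free ad.
have [mu muE] : exists mu : 'M[K]_(3, 6), forall i, forall e : 'M_(2, 3),
    peval (lcomb w (row i mu)) (mxvec e *m L) = cross (row b0 e) (row b1 e) 0 i.
  apply: (row_choice (P := fun i r => forall e : 'M_(2, 3),
    peval (lcomb w r) (mxvec e *m L) = cross (row b0 e) (row b1 e) 0 i)) => i; have [g g2 gE] := minor_poly Lf i.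
  have [|a aE] := dP_row g2; last by exists a => e; rewrite aE.
  apply/dP_idealP => v; have [t [x [-> _]]] := adapted_point ad v.
  by rewrite /sg gE; case: (ord3P i) => ->; rewrite !crossE !mxE !big_ord1 !mxE; ring.
have [ph phE] : exists ph : 'M[K]_(2, 6), forall a, forall e : 'M_(2, 3),
    peval (lcomb w (row a ph)) (mxvec e *m L) =
      qform q0 (row b0 e) (row a e) + qform q1 (row b1 e) (row a e).
  apply: (row_choice (P := fun a r => forall e : 'M_(2, 3), peval (lcomb w r) (mxvec e *m L) =
      qform q0 (row b0 e) (row a e) + qform q1 (row b1 e) (row a e))) => a; have [g g2 gE] := phi_poly Lf q0 q1 a.
  have [|r rE] := dP_row g2; last by exists r => e; rewrite rE.
  apply/dP_idealP => v; have [t [x [-> F0]]] := adapted_point ad v.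
  rewrite /sg gE -[RHS](mulr0 (t 0 a)) -[in RHS]F0 /Fval /qform !dotE !mxE !sum3E !mxE !big_ord1 !mxE.
  ring.
have [ka kaE] : exists a, lcomb w a = Q.
  have /hw.1 [a ->] : quadrics_through (curve_ideal f Q) Q; last by exists a.
  by split=> //; exists 1; rewrite mul1r subrr; apply/dP_idealP => v; rewrite peval0.
by exists mu, ph, ka; split.
Qed.

End Existence.

Lemma polar_minor (K : numFieldType) L (g : {mpoly K[6]}) (al : 'rV[K]_3) :
  (forall e : 'M_(2, 3), peval g (mxvec e *m L) = dot al (cross (row b0 e) (row b1 e))) ->
  forall t x (e : 'M_(2, 3)),
    polar g (sg L t x) (mxvec e *m L) = dot al (cross x (eps t e)).
Proof.
move=> gE t x e; rewrite /polar /sg -mulmxDl -raddfD /= !gE.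
rewrite !dotE !crossE !mxE !big_ord1 !mxE; ring.
Qed.

(** * The basis of W formed by the minors, the two multiples of F, and Q *)

Section Rows.
Variable K : numFieldType.
Variables (p : 'I_4 -> 'rV[K]_3) (f : 'I_6 -> {mpoly K[3]}) (Q : {mpoly K[6]}).
Variables (w : 'I_6 -> {mpoly K[6]}) (k : option 'I_4) (L : 'M[K]_(2 * 3, 6)) (q0 q1 : 'M[K]_3).
Variables (mu : 'M[K]_(3, 6)) (ph : 'M[K]_(2, 6)) (ka : 'rV[K]_6).
Hypothesis hf : forall a, lcomb f a = 0 -> a = 0.
Hypothesis QY : ~ dP_ideal f Q.
Hypothesis ad : adapted p f k L q0 q1.
Hypothesis qr : quadric_rows Q w L q0 q1 mu ph ka.

Lemma minor_rowE (al : 'rV[K]_3) (e : 'M_(2, 3)) :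
  peval (lcomb w (al *m mu)) (mxvec e *m L) = dot al (cross (row b0 e) (row b1 e)).
Proof.
rewrite lcomb_mul peval_lcomb; apply: eq_bigr => i _; by rewrite (quadric_minor qr).
Qed.

Lemma minor_row_rank1 (al : 'rV[K]_3) t x : peval (lcomb w (al *m mu)) (sg L t x) = 0.
Proof. rewrite /sg minor_rowE dotE !crossE !mxE !big_ord1 !mxE; ring. Qed.

Lemma phi_row_rank1 a t x : peval (lcomb w (row a ph)) (sg L t x) = t 0 a * Fval q0 q1 t x.
Proof.
rewrite /sg (quadric_phi qr) /Fval /qform !dotE !mxE !sum3E !mxE !big_ord1 !mxE; ring.
Qed.

Lemma phi_rows_rank1 (c : 'rV[K]_2) t x : peval (lcomb w (c *m ph)) (sg L t x) =
  (c 0 b0 * t 0 b0 + c 0 b1 * t 0 b1) * Fval q0 q1 t x.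
Proof. by rewrite lcomb_mul peval_lcomb sum2E !phi_row_rank1; ring. Qed.

Lemma polar_minor_row (al : 'rV[K]_3) t x (e : 'M_(2, 3)) :
  polar (lcomb w (al *m mu)) (sg L t x) (mxvec e *m L) = dot al (cross x (eps t e)).
Proof. exact: polar_minor (minor_rowE al) t x e. Qed.

Lemma polar_minor_row1 i t x (e : 'M_(2, 3)) :
  polar (lcomb w (row i mu)) (sg L t x) (mxvec e *m L) = grad_minor t x i e.
Proof.
rewrite rowE polar_minor_row /grad_minor dotE !mxE !eqxx /=.
by case: (ord3P i) => ->; rewrite /= ?mul1r ?mul0r ?addr0 ?add0r.
Qed.

Lemma polar_phi_row a t x (e : 'M_(2, 3)) :
  polar (lcomb w (row a ph)) (sg L t x) (mxvec e *m L) =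
    grad_phi t (x *m q0) (x *m q1) a e.
Proof.
rewrite /polar /sg -mulmxDl -raddfD /= !(quadric_phi qr).
have D q y y' z : qform q (y + y') z = qform q y z + qform q y' z :> K.
  by rewrite /qform mulmxDl dotDl.
have D' q y z z' : qform q y (z + z') = qform q y z + qform q y z' :> K by rewrite /qform dotDr.
have Z q c y z : qform q (c *: y) z = c * qform q y z :> K by rewrite /qform -scalemxAl dotZl.
have Z' q c y z : qform q y (c *: z) = c * qform q y z :> K by rewrite /qform dotZr.
have R i : row i (t^T *m x) = t 0 i *: x by apply/rowP => j; rewrite !mxE big_ord1 !mxE.
rewrite !raddfD /= !R !D !D' !Z !Z' /grad_phi /uform -!/(qform _ _ _).
rewrite (qformC (row b0 e) x (adapted_sym0 ad)) (qformC (row b1 e) x (adapted_sym1 ad)).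
by ring.
Qed.

(** h is a linear form on P^5 vanishing on Y, and Y spans P^5 because the six cubics f are
    independent. *)
Lemma linear_form_zpt (h : 'M[K]_(2, 3)) :
  (forall x, \sum_i \sum_j zpt q0 q1 x 0 i * x 0 j * h i j = 0) -> h = 0.
Proof.
move=> h0; have Lf := adapted_free ad.
pose a := mxvec h *m (pinvmx L)^T.
have aE (e : 'M_(2, 3)) : peval (lcomb (fun i => 'X_i) a) (mxvec e *m L) = \sum_i \sum_j e i j * h i j.
  transitivity ((a *m (mxvec e *m L)^T) 0 0).
    rewrite peval_lcomb [RHS]mxE; apply: eq_bigr => i _; rewrite pevalX; congr (_ * _).
    by rewrite [RHS]mxE.
  have -> : a *m (mxvec e *m L)^T = (mxvec e *m (mxvec h)^T)^T.
    by rewrite /a -mulmxA -trmx_mul -mulmxA (L_inv Lf) mulmx1 trmx_mul trmxK.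
  rewrite mxE mxvec_mulE; apply: eq_bigr => i _; apply: eq_bigr => j _.
  by rewrite mxE mxvecE.
have : dP_ideal f (lcomb (fun i => 'X_i) a).
  apply: (adapted_dP_inv ad) => c x; rewrite /sg aE -[RHS](mulr0 c) -[in RHS](h0 x) big_distrr.
  apply: eq_bigr => i _; rewrite big_distrr; apply: eq_bigr => j _ /=.
  by rewrite rank1E mxE; ring.
move/dP_idealP => fa.
have a0 : a = 0.
  apply: hf; apply: mpoly_eq0_eval => v; rewrite peval_lcomb.
  apply: etrans (fa v); rewrite peval_lcomb; apply: eq_bigr => i _; rewrite pevalX.
  by congr (_ * _); rewrite mxE.
have : a *m L^T = 0 by rewrite a0 mul0mx.
rewrite /a -mulmxA -trmx_mul (L_inv Lf) trmx1 mulmx1 => h0'.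
by apply: (can_inj mxvecK); rewrite h0' linear0.
Qed.

(** Otherwise [zpt] would be identically zero and every bilinear form, for instance the one with all
    coefficients 1, would satisfy the hypothesis of [linear_form_zpt]. *)
Lemma Fval_not0 : ~ forall t x, Fval q0 q1 t x = 0.
Proof.
move=> F0; have : (const_mx 1 : 'M[K]_(2, 3)) = 0.
  apply: linear_form_zpt => x.
  have z0 : zpt q0 q1 x = 0.
    have := F0 (delta_mx 0 b0) x; have := F0 (delta_mx 0 b1) x.
    rewrite /Fval !mxE !eqxx /= !mul0r !mul1r ?add0r ?addr0 => q1x q0x.
    by apply/rowP => i; rewrite !mxE q1x q0x oppr0; case: ifP.
  by rewrite big1 // => i _; rewrite big1 // => j _; rewrite z0 mxE !mul0r.
by move/matrixP/(_ b0 o0); rewrite !mxE => /eqP; rewrite oner_eq0.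
Qed.

Lemma Fval_linear_cancel (c : 'rV[K]_2) :
  (forall (t : 'rV[K]_2) x, (c 0 b0 * t 0 b0 + c 0 b1 * t 0 b1) * Fval q0 q1 t x = 0) -> c = 0.
Proof.
move=> cF.
have E x : [/\ c 0 b0 * qform q0 x x = 0, c 0 b1 * qform q1 x x = 0 &
    c 0 b0 * qform q1 x x + c 0 b1 * qform q0 x x = 0].
  have E0 : c 0 b0 * qform q0 x x = 0.
    by rewrite -[RHS](cF (delta_mx 0 b0) x) /Fval !mxE !eqxx /=; ring.
  have E1 : c 0 b1 * qform q1 x x = 0.
    by rewrite -[RHS](cF (delta_mx 0 b1) x) /Fval !mxE !eqxx /=; ring.
  split=> //; have := cF (const_mx 1) x; rewrite /Fval !mxE !mulr1 !mul1r mulrDl !mulrDr E0 E1.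
  by rewrite add0r addr0.
have [c0|c0] := eqVneq (c 0 b0) 0; last first.
  case: Fval_not0 => t x; have [/eqP] := E x; rewrite mulf_eq0 (negPf c0) => /eqP q0x _.
  rewrite q0x mulr0 addr0 => /eqP; rewrite mulf_eq0 (negPf c0) => /eqP q1x.
  by rewrite /Fval q0x q1x !mulr0 addr0.
have [c1|c1] := eqVneq (c 0 b1) 0; last first.
  case: Fval_not0 => t x; have [_ /eqP] := E x; rewrite mulf_eq0 (negPf c1) => /eqP q1x.
  rewrite q1x mulr0 add0r => /eqP; rewrite mulf_eq0 (negPf c1) => /eqP q0x.
  by rewrite /Fval q0x q1x !mulr0 addr0.
by apply/rowP => i; rewrite mxE; case: (ord2P i) => ->.
Qed.

Lemma rows_vanish_dP (al : 'rV[K]_3) (c : 'rV[K]_2) v :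
  peval (lcomb w (al *m mu + c *m ph)) (\row_i peval (f i) v) = 0.
Proof.
have [t [x [-> F0]]] := adapted_point ad v.
by rewrite lcombD pevalD minor_row_rank1 phi_rows_rank1 F0 mulr0 addr0.
Qed.

(** Q is separated from the rest by not containing Y, the phi_a from the minors by restricting to
    t_a F on the Segre threefold, and the minors from each other by test matrices. *)
Lemma rows_independent (al : 'rV[K]_3) (c : 'rV[K]_2) (d : K) :
  al *m mu + c *m ph + d *: ka = 0 -> [/\ al = 0, c = 0 & d = 0].
Proof.
move=> E.
have d0 : d = 0.
  apply/eqP; apply: contraT => dn0; case: QY; apply/dP_idealP => v.
  have := congr1 (fun r => peval (lcomb w r) (\row_i peval (f i) v)) E.
  rewrite lcombD lcombZ (quadric_section qr) pevalD rows_vanish_dP add0r lcomb0 peval0 pevalZ.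
  by move/eqP; rewrite mulf_eq0 (negPf dn0) => /eqP.
rewrite d0 scale0r addr0 in E.
have c0 : c = 0.
  apply: Fval_linear_cancel => t x; rewrite -phi_rows_rank1.
  have := congr1 (fun r => peval (lcomb w r) (sg L t x)) E.
  by rewrite lcombD pevalD minor_row_rank1 add0r lcomb0 peval0.
rewrite c0 mul0mx addr0 in E; split=> //.
have D i : al 0 i = 0.
  (* The rows are basis vectors i+1 and i+2, whose cross product is basis vector i. *)
  pose e : 'M[K]_(2, 3) := \matrix_(a, j) ((if a == b0 then ordS i else ordS (ordS i)) == j)%:R.
  have := congr1 (fun r => peval (lcomb w r) (mxvec e *m L)) E.
  rewrite minor_rowE lcomb0 peval0 dotE !crossE !mxE.
  by case: (ord3P i) => ->; rewrite !ordSE /= => <-; ring.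
by apply/rowP => i; rewrite D mxE.
Qed.

Definition rows_mx : 'M[K]_6 := col_mx mu (col_mx ph ka).

Lemma rows_mxE (r : 'rV[K]_6) : r *m rows_mx =
  lsubmx (r : 'rV_(3 + (2 + 1))) *m mu + lsubmx (rsubmx (r : 'rV_(3 + (2 + 1)))) *m ph
  + (rsubmx (rsubmx (r : 'rV_(3 + (2 + 1))))) 0 0 *: ka.
Proof.
rewrite /rows_mx -{1}[r](hsubmxK (r : 'rV_(3 + (2 + 1)))).
rewrite -[X in row_mx _ X](hsubmxK (rsubmx (r : 'rV_(3 + (2 + 1))))).
rewrite (mul_row_col (n1 := 3) (n2 := 2 + 1)) mul_row_col addrA; congr (_ + _).
by rewrite [X in X *m _]mx11_scalar mul_scalar_mx.
Qed.

Lemma rows_mx_unit : rows_mx \in unitmx.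
Proof.
rewrite -row_free_unit; apply: inj_row_free => r; rewrite rows_mxE => /rows_independent[E1 E2 E3].
rewrite -[r](hsubmxK (r : 'rV_(3 + (2 + 1)))) E1.
rewrite -[X in row_mx _ X](hsubmxK (rsubmx (r : 'rV_(3 + (2 + 1))))) E2.
by rewrite [X in row_mx _ (row_mx _ X)]mx11_scalar E3 raddf0 !row_mx0.
Qed.

Lemma rows_span (r : 'rV[K]_6) : exists al c d, r = al *m mu + c *m ph + d *: ka.
Proof.
by rewrite -[r](mulmxKV rows_mx_unit) rows_mxE; do 3 eexists.
Qed.

Lemma rows_span_dP (r : 'rV[K]_6) : dP_ideal f (lcomb w r) ->
  exists al c, r = al *m mu + c *m ph.
Proof.
have [al [c [d rE]]] := rows_span r; move/dP_idealP => rf.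
have d0 : d = 0.
  apply/eqP; apply: contraT => dn0; case: QY; apply/dP_idealP => v.
  have := rf v; rewrite rE lcombD lcombZ (quadric_section qr) pevalD rows_vanish_dP add0r pevalZ.
  by move/eqP; rewrite mulf_eq0 (negPf dn0) => /eqP.
by exists al, c; rewrite rE d0 scale0r addr0.
Qed.

End Rows.

Lemma det_row_swap (R : comNzRingType) n (M N : 'M[R]_n) (i j : 'I_n) : i != j ->
  (forall l, row l M = row (tperm i j l) N) -> \det M = - \det N.
Proof.
move=> ij MN; have -> : M = tperm_mx i j *m N.
  by rewrite -xrowE; apply/row_matrixP => l; rewrite MN; apply/rowP => c; rewrite !mxE.
by rewrite det_mulmx det_perm odd_tperm ij /= expr1 mulN1r.
Qed.

Section TopWedge.
Variable K : numFieldType.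

Definition top (x y : ext K) : K := locked (wedge x y setT).

Lemma topE x y : top x y = wedge x y setT.
Proof. by rewrite /top -lock. Qed.
Lemma topD x x' y : top (x + x') y = top x y + top x' y.
Proof. by rewrite !topE wedgeDl ffunE. Qed.
Lemma topN x y : top (- x) y = - top x y.
Proof. by rewrite !topE wedgeNl ffunE. Qed.
Lemma topB x x' y : top (x - x') y = top x y - top x' y.
Proof. by rewrite topD topN. Qed.
Lemma topZ (k : K) x y : top (k *: x) y = k * top x y.
Proof. by rewrite !topE wedgeZl ffunE. Qed.
Lemma topZr (k : K) x y : top x (k *: y) = k * top x y.
Proof. by rewrite !topE wedgeZr ffunE. Qed.
Lemma top0 y : top 0 y = 0.
Proof. by rewrite topE wedge0l ffunE. Qed.
Lemma top_sum I (r : seq I) (P : pred I) (F : I -> ext K) y :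
  top (\sum_(i <- r | P i) F i) y = \sum_(i <- r | P i) top (F i) y.
Proof. by rewrite topE wedge_suml sum_ffunE; apply: eq_bigr => i _; rewrite topE. Qed.

Implicit Types (a b c d e f : 'rV[K]_6).

Lemma top_w3 a b c d e f : top (w3 a b c) (w3 d e f) = det6 a b c d e f.
Proof. by rewrite topE wedge_w3 extE [ext_basis _ _ _]ffunE eqxx; exact: mulr1. Qed.

Lemma det6_swap03 a b c d e f : det6 a b c d e f = - det6 d b c a e f.
Proof.
pose i0 : 'I_6 := @Ordinal 6 0 isT; pose i3 : 'I_6 := @Ordinal 6 3 isT.
apply: (@det_row_swap _ _ _ _ i0 i3) => // l; rewrite !rowK.
case: tpermP => [->|->|] //; case: l => [[|[|[|[|[|[|l]]]]]] Hl] // H1 H2.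
  by case: H1; apply: val_inj.
by case: H2; apply: val_inj.
Qed.

Lemma det6_cov (v : 'cV[K]_6) a b c d e f : v != 0 ->
  a *m v = 0 -> b *m v = 0 -> c *m v = 0 -> d *m v = 0 -> e *m v = 0 -> f *m v = 0 ->
  det6 a b c d e f = 0.
Proof.
move=> v0 Ea Eb Ec Ed Ee Ef; rewrite /det6 -det_tr; apply/eqP/det0P.
exists v^T; first by rewrite -(inj_eq (@trmx_inj _ _ _)) trmxK trmx0.
rewrite -trmx_mul -[RHS]trmx0; congr (_ ^T); apply/row_matrixP => i.
rewrite row_mul rowK row0.
by case: i => [[|[|[|[|[|[|i]]]]]] Hi].
Qed.

(** The components of rho M along the two other rows drop out, and the cyclic order costs no sign.
    This places a chosen member of a net in the first slot of its Plucker vector. *)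
Lemma w3_rot (M : 'M[K]_(3, 6)) (rho : 'rV[K]_3) j :
  rho 0 j *: plucker M = w3 (rho *m M) (row (ordS j) M) (row (ordS (ordS j)) M).
Proof.
apply/ffunP => S; rewrite pluckerE extE !w3E; case: ifP => _; last exact: mulr0.
case: (ord3P j) => ->; rewrite !ordSE !mxE !sum3E; ring.
Qed.

End TopWedge.

(** * Vanishing at the five planes *)

Section NetWedge.
Variable K : numFieldType.
Variables (p : 'I_4 -> 'rV[K]_3) (f : 'I_6 -> {mpoly K[3]}) (Q : {mpoly K[6]}).
Variables (w : 'I_6 -> {mpoly K[6]}) (k : option 'I_4) (L : 'M[K]_(2 * 3, 6)) (q0 q1 : 'M[K]_3).
Variables (mu : 'M[K]_(3, 6)) (ph : 'M[K]_(2, 6)) (ka : 'rV[K]_6).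
Hypothesis hf : forall a, lcomb f a = 0 -> a = 0.
Hypothesis QY : ~ dP_ideal f Q.
Hypothesis ad : adapted p f k L q0 q1.
Hypothesis qr : quadric_rows Q w L q0 q1 mu ph ka.

Definition bcov (s : 'rV[K]_2) (y : 'rV[K]_3) : 'rV[K]_3 :=
  s 0 b0 *: (y *m q0) + s 0 b1 *: (y *m q1).

Lemma dot_bcov s y x : dot (bcov s y) x = uform (y *m q0) (y *m q1) s x.
Proof. by rewrite /bcov dotDl !dotZl. Qed.

Definition twist (s : 'rV[K]_2) : 'rV[K]_6 := s 0 b1 *: row b0 ph - s 0 b0 *: row b1 ph.

Definition mu_pair (r : 'rV[K]_6) i : ext K := w3 r (row (ordS i) mu) (row (ordS (ordS i)) mu).

(** The wedge of r with a bivector bilinear in (s, y). At a point (t, x) of Y that bivector is the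
    Plucker vector of the pencil of quadrics through Y singular there, spanned by x *m mu and al *m
    mu + twist t, where al × x = bcov t x. *)
Definition beta_wedge (r : 'rV[K]_6) (s : 'rV[K]_2) (y : 'rV[K]_3) : ext K :=
  w3 r (y *m mu) (twist s) - \sum_i bcov s y 0 i *: mu_pair r i.

Lemma mu_pair_cross r (al x : 'rV[K]_3) :
  \sum_i cross al x 0 i *: mu_pair r i = w3 r (al *m mu) (x *m mu).
Proof.
apply/ffunP => S; rewrite sum3E !extE /mu_pair !w3E.
case: ifP => _; last by rewrite !mulr0 !addr0.
rewrite !ordSE !crossE ![(_ *m mu) 0 _]mxE !sum3E ![row _ mu 0 _]mxE; ring.
Qed.

Lemma mu_pair_dot (b x : 'rV[K]_3) :
  \sum_i b 0 i *: mu_pair (x *m mu) i = dot b x *: w3 (row o0 mu) (row o1 mu) (row o2 mu).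
Proof.
apply/ffunP => S; rewrite sum3E !extE /mu_pair !w3E.
case: ifP => _; last by rewrite !mulr0 !addr0.
rewrite !ordSE dotE ![(_ *m mu) 0 _]mxE !sum3E ![row _ mu 0 _]mxE; ring.
Qed.

Lemma cross_eq0 (al x : 'rV[K]_3) : x != 0 -> cross al x = 0 -> exists nu, al = nu *: x.
Proof.
move=> x0 E; have [j xj] := rV0Pn _ x0.
have E0 : al 0 o1 * x 0 o2 = al 0 o2 * x 0 o1.
  by have /rowP/(_ o0)/eqP := E; rewrite crossE mxE subr_eq0 => /eqP.
have E1 : al 0 o2 * x 0 o0 = al 0 o0 * x 0 o2.
  by have /rowP/(_ o1)/eqP := E; rewrite crossE mxE subr_eq0 => /eqP.
have E2 : al 0 o0 * x 0 o1 = al 0 o1 * x 0 o0.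
  by have /rowP/(_ o2)/eqP := E; rewrite crossE mxE subr_eq0 => /eqP.
exists (al 0 j / x 0 j); apply/rowP => i; rewrite mxE; apply: (mulIf xj); rewrite mulrAC divfK //.
by case: (ord3P i) => ->; case: (ord3P j) => ->; rewrite ?E0 ?E1 ?E2.
Qed.

(** The first slot is a member of the singular pencil. If la = 0 it is a multiple of x *m mu, and
    the remaining term has the factor F(t, x); otherwise la times the bivector is the wedge of x *m
    mu with that member. *)
Lemma beta_wedge_singular (t : 'rV[K]_2) (x al : 'rV[K]_3) (la : K) :
  x != 0 -> Fval q0 q1 t x = 0 -> cross al x = la *: bcov t x ->
  beta_wedge (al *m mu + la *: twist t) t x = 0.
Proof.
move=> x0 F0 E.
have bx : dot (bcov t x) x = 0 by rewrite dot_bcov -[RHS]F0.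
rewrite /beta_wedge; set b := bcov t x in E bx *; set tw := twist t; set r := _ + _ *: _.
have [la0|lan0] := eqVneq la 0.
  have [|nu al_nu] := cross_eq0 (al := al) x0; first by rewrite E la0 scale0r.
  have -> : r = (nu *: x) *m mu by rewrite /r la0 scale0r addr0 al_nu.
  rewrite -scalemxAl; set X := x *m mu.
  have -> : w3 (nu *: X) X tw = 0.
    apply/ffunP => S; rewrite w3E [RHS]ext0; case: ifP => // _; rewrite !mxE; ring.
  have -> : \sum_i b 0 i *: mu_pair (nu *: X) i = nu *: \sum_i b 0 i *: mu_pair X i.
    rewrite scaler_sumr; apply: eq_bigr => i _; apply/ffunP => S.
    rewrite !extE /mu_pair !w3E.
    case: ifP => _; last by rewrite !mulr0.
    by rewrite !mxE; ring.
  by rewrite mu_pair_dot bx !scale0r scaler0 subrr.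
apply: (scalerI lan0); rewrite scaler0 scalerBr.
have -> : la *: \sum_i b 0 i *: mu_pair r i = w3 r (al *m mu) (x *m mu).
  rewrite -mu_pair_cross E scaler_sumr; apply: eq_bigr => i _.
  by rewrite scalerA; congr (_ *: _); rewrite [RHS]mxE.
apply/eqP; rewrite subr_eq0; apply/eqP/ffunP => S.
rewrite !extE !w3E; case: ifP => _; last by rewrite mulr0.
have rE i : r 0 i = (al *m mu) 0 i + la * tw 0 i.
  by rewrite /r [LHS]mxE; congr (_ + _); rewrite [LHS]mxE.
by rewrite !rE; ring.
Qed.

(** Directions s (x) x show that c is orthogonal to t, since otherwise both q0 and q1 vanish at x
    and t = 0. Directions s (x) v with t, s of determinant 1 then give the equation for al. *)
Lemma singular_row (t : 'rV[K]_2) (x : 'rV[K]_3) (al : 'rV[K]_3) (c : 'rV[K]_2) :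
  t = zpt q0 q1 x -> t != 0 ->
  (forall e : 'M_(2, 3), polar (lcomb w (al *m mu + c *m ph)) (sg L t x) (mxvec e *m L) = 0) ->
  exists la, al *m mu + c *m ph = al *m mu + la *: twist t /\ cross al x = la *: bcov t x.
Proof.
move=> tz t0 sing.
have F0 : uform (x *m q0) (x *m q1) t x = 0.
  by have := Fval_zpt q0 q1 1 x; rewrite scale1r -tz.
have G e : dot al (cross x (eps t e)) + c 0 b0 * grad_phi t (x *m q0) (x *m q1) b0 e
    + c 0 b1 * grad_phi t (x *m q0) (x *m q1) b1 e = 0.
  rewrite -[RHS](sing e) lcombD polarDg (polar_minor_row qr) -addrA; congr (_ + _).
  rewrite lcomb_mul /lcomb sum2E polarDg !polarZg.
  by rewrite !(polar_phi_row ad qr).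
have ct : c 0 b0 * t 0 b0 + c 0 b1 * t 0 b1 = 0.
  have H s : (c 0 b0 * t 0 b0 + c 0 b1 * t 0 b1) * uform (x *m q0) (x *m q1) s x = 0.
    rewrite -[RHS](G (s^T *m x)) eps_rank1 !grad_phi_rank1 F0.
    by rewrite dotE !crossE !mxE; ring.
  apply/eqP; apply: contraNT t0 => ctn0; apply/eqP/rowP => i; rewrite tz !mxE.
  have Hs s : uform (x *m q0) (x *m q1) s x = 0.
    by have /eqP := H s; rewrite mulf_eq0 (negPf ctn0) => /eqP.
  have := Hs (delta_mx 0 b0); have := Hs (delta_mx 0 b1).
  rewrite /uform !mxE !eqxx /= !mul0r !mul1r add0r addr0 /qform => -> ->.
  by rewrite oppr0; case: ifP.
have [la [c0 c1]] : exists la, c 0 b0 = la * t 0 b1 /\ c 0 b1 = - (la * t 0 b0).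
  have [t00|t00] := eqVneq (t 0 b0) 0.
    have t10 : t 0 b1 != 0.
      apply: contraNneq t0 => t10; apply/eqP/rowP => i; rewrite mxE.
      by case: (ord2P i) => ->.
    exists (c 0 b0 / t 0 b1); rewrite divfK // t00 mulr0 oppr0; split=> //.
    by apply: (mulIf t10); rewrite mul0r -[RHS]ct t00 mulr0 add0r.
  pose q := c 0 b1 / t 0 b0; have qE : q * t 0 b0 = c 0 b1 by rewrite /q divfK.
  exists (- q); split; last by rewrite mulNr opprK.
  apply: (mulIf t00); rewrite mulNr mulNr mulrAC qE.
  by apply/eqP; rewrite -addr_eq0 ct.
exists la; split.
  congr (_ + _); rewrite mulmx_sum_row sum2E c0 c1 /twist scalerBr !scalerA; congr (_ + _).
  by rewrite scaleNr.
have D (v : 'rV[K]_3) : dot (cross al x) v = dot (la *: bcov t x) v.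
  (* The determinant of t and s is normalized to 1, so that [eps] of s (x) v is v. *)
  have [s sv] : exists s : 'rV[K]_2, t 0 b0 * s 0 b1 - t 0 b1 * s 0 b0 = 1.
    have [t00|t00] := eqVneq (t 0 b0) 0.
      have t10 : t 0 b1 != 0.
        apply: contraNneq t0 => t10; apply/eqP/rowP => i; rewrite mxE.
        by case: (ord2P i) => ->.
      exists (\row_i (if i == b0 then - (t 0 b1)^-1 else 0)); rewrite !mxE /=.
      by rewrite mulr0 mulrN opprK divff // add0r.
    exists (\row_i (if i == b0 then 0 else (t 0 b0)^-1)); rewrite !mxE /=.
    by rewrite mulr0 subr0 divff.
  have := G (s^T *m v); have := grad_phi_eps t (x *m q0) (x *m q1) (s^T *m v).
  rewrite eps_rank1 sv scale1r -dot_bcov c0 c1 => P1 P2.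
  rewrite dotZl; apply/eqP; rewrite -subr_eq0; apply/eqP; rewrite -[RHS]P2.
  have -> : dot (bcov t x) v = t 0 b0 * grad_phi t (x *m q0) (x *m q1) b1 (s^T *m v)
      - t 0 b1 * grad_phi t (x *m q0) (x *m q1) b0 (s^T *m v) by rewrite P1; ring.
  rewrite !dotE !crossE; ring.
apply/rowP => i; have := D (delta_mx 0 i); rewrite !dotE !mxE /=.
by case: (ord3P i) => -> /=; rewrite ?mulr0 ?mulr1 ?addr0 ?add0r.
Qed.

Variables (k' : option 'I_4) (L' : 'M[K]_(2 * 3, 6)) (q0' q1' : 'M[K]_3).
Hypothesis ad' : adapted p f k' L' q0' q1'.
Variable P : 'M[K]_(3, 6).
Hypothesis hP : net_basis w (segre_net p f k') P.

(** In the second Segre threefold the point is t' (x) x', and the combination of minors with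
    coefficients x' has differential x' . (x' × eps), which is zero. *)
Lemma net_singular (x : 'rV[K]_3) : zpt q0 q1 x != 0 ->
  exists rho : 'rV[K]_3, rho != 0 /\
    forall e, polar (lcomb w (rho *m P)) (sg L (zpt q0 q1 x) x) e = 0.
Proof.
move=> t0; set z := sg L _ _.
have x0 : x != 0.
  apply/eqP => xE; case/eqP: t0; apply/rowP => i; rewrite xE !mxE /qform !mul0mx !dotE !mxE.
  by case: ifP => _; ring.
have [t' [x' zE]] : exists t' x', z = sg L' t' x'.
  apply/(base_locus_adapted ad').2 => g gN; have [g2 _] := gN.
  exact: (adapted_dP ad g2 (segre_net_dP ad' gN) x).
have x'0 : x' != 0.
  apply/eqP => x'0; have : z = 0.
    by rewrite zE x'0 /sg mulmx0 linear0 mul0mx.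
  move/(congr1 (mulmxr (pinvmx L))); rewrite /= /z /sg -mulmxA (L_inv (adapted_free ad)) mulmx1 mul0mx.
  move/(congr1 vec_mx); rewrite mxvecK linear0 => E.
  have [j xj] := rV0Pn _ x0; have [i ti] := rV0Pn _ t0.
  have := congr1 (fun M : 'M_(2, 3) => M i j) E; rewrite rank1E [RHS]mxE => /eqP.
  by rewrite mulf_eq0 (negPf ti) (negPf xj).
have [g g2 gE] : exists2 g : {mpoly K[6]}, g \is 2.-homog & forall e : 'M_(2, 3),
    peval g (mxvec e *m L') = dot x' (cross (row b0 e) (row b1 e)).
  have [g0 h0 E0] := minor_poly (adapted_free ad') o0.
  have [g1 h1 E1] := minor_poly (adapted_free ad') o1.
  have [g2 h2 E2] := minor_poly (adapted_free ad') o2.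
  exists (x' 0 o0 *: g0 + x' 0 o1 *: g1 + x' 0 o2 *: g2).
    by apply: rpredD; [apply: rpredD|]; apply: rpredZ.
  by move=> e; rewrite !pevalE E0 E1 E2 dotE.
have gN : segre_net p f k' g by apply/(segre_net_minors ad' g2); exists x'.
have [rho gr] := (hP.1 g).1 gN; exists rho.
have gr' : lcomb w (rho *m P) = g by rewrite lcomb_mul gr.
split=> [|e].
  apply/eqP => r0; have [j xj] := rV0Pn _ x'0.
  pose e : 'M[K]_(2, 3) := \matrix_(a, i) ((if a == b0 then ordS j else ordS (ordS j)) == i)%:R.
  have := gE e; rewrite -gr' r0 mul0mx lcomb0 peval0 dotE !crossE !mxE => E.
  case/eqP: xj; rewrite -[RHS]/0 E.
  by case: (ord3P j) => ->; rewrite !ordSE /=; ring.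
rewrite gr' zE -(coordsK (adapted_free ad') e) (polar_minor gE) dotE !crossE !mxE; ring.
Qed.

Lemma net_row_span (rho : 'rV[K]_3) : exists al c, rho *m P = al *m mu + c *m ph.
Proof.
apply: (rows_span_dP hf QY ad qr); rewrite lcomb_mul; apply: (segre_net_dP ad').
by apply/hP.1; exists rho.
Qed.

(** All six vectors lie in the hyperplane of quadrics through Y. *)
Lemma wedge_net_rows (a b c : 'rV[K]_6) :
  (exists al d, a = al *m mu + d *m ph) -> (exists al d, b = al *m mu + d *m ph) ->
  (exists al d, c = al *m mu + d *m ph) -> top (w3 a b c) (plucker P) = 0.
Proof.
have U := rows_mx_unit hf QY ad qr.
(* The functional reading the coefficient of [ka], the last row of [rows_mx]; its kernel is the
   hyperplane of quadrics through Y. *)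
pose v : 'cV[K]_6 := invmx (rows_mx mu ph ka) *m delta_mx (@Ordinal 6 5 isT) 0.
have rv : rows_mx mu ph ka *m v = delta_mx (@Ordinal 6 5 isT) 0 by rewrite /v mulKVmx.
have kv : (forall al : 'rV[K]_3, al *m mu *m v = 0) /\ (forall d : 'rV[K]_2, d *m ph *m v = 0).
  rewrite /rows_mx (mul_col_mx (m1 := 3) (m2 := 2 + 1)) mul_col_mx in rv.
  split=> al; rewrite -mulmxA.
    have -> : mu *m v = 0.
      rewrite -[mu *m v](col_mxKu _ (col_mx (ph *m v) (ka *m v))) rv.
      by apply/colP => i; rewrite !mxE; case: i => [[|[|[|i]]] Hi].
    by rewrite mulmx0.
  have -> : ph *m v = 0.
    rewrite -[ph *m v](col_mxKu _ (ka *m v)) -[col_mx _ _](col_mxKd (mu *m v)) rv.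
    by apply/colP => i; rewrite !mxE; case: i => [[|[|i]] Hi].
  by rewrite mulmx0.
have v0 : v != 0.
  apply: contra_eq_neq rv => ->; rewrite mulmx0 eq_sym; apply/eqP.
  by move/colP/(_ (@Ordinal 6 5 isT))/eqP; rewrite !mxE !eqxx oner_eq0.
have span0 (r : 'rV[K]_6) : (exists al d, r = al *m mu + d *m ph) -> r *m v = 0.
  by move=> [al [d ->]]; rewrite mulmxDl kv.1 kv.2 addr0.
have Pv i : row i P *m v = 0.
  by apply: span0; have := net_row_span (delta_mx 0 i); rewrite -rowE.
move=> /span0 Ea /span0 Eb /span0 Ec; rewrite pluckerE top_w3.
exact: (det6_cov v0).
Qed.

Lemma w3_twist r s (y : 'rV[K]_3) : w3 r (y *m mu) (twist s) =
  \sum_j y 0 j *: (s 0 b1 *: w3 r (row j mu) (row b0 ph) - s 0 b0 *: w3 r (row j mu) (row b1 ph)).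
Proof.
apply/ffunP => S; rewrite sum_ffunE.
under eq_bigr => j _ do rewrite extZ extD extN !extZ !w3E.
rewrite w3E; case: ifP => _; last by rewrite big1 // => j _; rewrite !mulr0 subrr mulr0.
rewrite sum3E /twist !mxE !sum3E; ring.
Qed.

Lemma top_beta_wedge r s y x : top (beta_wedge r s y) x =
  top (w3 r (y *m mu) (twist s)) x - \sum_i bcov s y 0 i * top (mu_pair r i) x.
Proof.
rewrite /beta_wedge topB; congr (_ - _); rewrite top_sum.
by apply: eq_bigr => i _; rewrite topZ.
Qed.

(** Bilinearity makes the pairing a linear form on P^5, so it suffices to treat the points (zpt x,
    x) of Y. There P contains a quadric singular at the point. With this quadric as first vector of
    [plucker P], exchanging it with [ka] changes the sign and leaves a wedge that is zero by
    [beta_wedge_singular]. *)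
Lemma kappa_beta_net s y : top (beta_wedge ka s y) (plucker P) = 0.
Proof.
pose Th s y := top (beta_wedge ka s y) (plucker P).
pose c j := top (w3 ka (row j mu) (row b0 ph)) (plucker P).
pose d j := top (w3 ka (row j mu) (row b1 ph)) (plucker P).
pose m j := top (mu_pair ka j) (plucker P).
have ThE s' y' : Th s' y' = \sum_j y' 0 j * (s' 0 b1 * c j - s' 0 b0 * d j)
    - \sum_i bcov s' y' 0 i * m i.
  rewrite /Th top_beta_wedge w3_twist top_sum; congr (_ - _); apply: eq_bigr => j _.
  by rewrite topZ topB !topZ.
pose h : 'M[K]_(2, 3) := \matrix_(i, j) Th (delta_mx 0 i) (delta_mx 0 j).
have ThD s' y' : Th s' y' = \sum_i \sum_j s' 0 i * y' 0 j * h i j.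
  rewrite sum2E !sum3E !mxE !ThE !sum3E /bcov.
  move: (c) (d) (m) => c' d' m'; rewrite !mxE !sum3E !mxE !eqxx /=.
  by ring.
suff h0 : h = 0.
  rewrite -/(Th s y) ThD big1 // => i _; rewrite big1 // => j _; by rewrite h0 mxE mulr0.
apply: (linear_form_zpt hf ad) => x; rewrite -ThD.
set t := zpt q0 q1 x.
have [t0|tn0] := eqVneq t 0.
  by rewrite ThD big1 // => i _; rewrite big1 // => j _; rewrite t0 mxE !mul0r.
have [rho [rho0 sing]] := net_singular tn0.
have x0 : x != 0.
  apply/eqP => xE; case/eqP: tn0; apply/rowP => i; rewrite /t xE !mxE /qform !mul0mx !dotE !mxE.
  by case: ifP => _; ring.
have [al [e rE]] := net_row_span rho.
have [|la [rE' Ec]] := singular_row (erefl t) tn0 (al := al) (c := e).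
  by move=> e'; rewrite -rE; apply: sing.
have F0 : Fval q0 q1 t x = 0 by rewrite /t -[zpt _ _ _]scale1r Fval_zpt.
have B0 := beta_wedge_singular x0 F0 Ec.
rewrite -rE' -rE in B0.
have [j rj] := rV0Pn _ rho0; apply: (mulfI rj); rewrite mulr0 /Th -topZr w3_rot.
set r := rho *m P in B0 *; set a := row _ P; set b := row _ P.
have swap v w' : top (w3 ka v w') (w3 r a b) = - top (w3 r v w') (w3 ka a b).
  by rewrite !top_w3 det6_swap03.
have sum_swap : top (beta_wedge ka t x) (w3 r a b) = - top (beta_wedge r t x) (w3 ka a b).
  apply: etrans (top_beta_wedge ka t x _) _.
  apply: etrans (esym (congr1 -%R (top_beta_wedge r t x _))).
  rewrite opprB addrC swap; congr (_ + _); rewrite -sumrN; apply: eq_bigr => i _.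
  by rewrite /mu_pair swap mulrN opprK.
by rewrite sum_swap B0 top0 oppr0.
Qed.

End NetWedge.

Lemma sum_minor_trip (K : numFieldType) (b x : 'rV[K]_3) (t : 'rV[K]_2) (g : 'M[K]_(2, 3) -> K) e e' e'' :
  \sum_i b 0 i * trip (vals g e e' e'') (vals (grad_minor t x (ordS i)) e e' e'')
      (vals (grad_minor t x (ordS (ordS i))) e e' e'') =
  dot b x * (g e * trip x (eps t e') (eps t e'') + g e' * trip x (eps t e'') (eps t e)
    + g e'' * trip x (eps t e) (eps t e')).
Proof.
rewrite sum3E !ordSE /vals /grad_minor.
move: (g e) (g e') (g e'') (eps t e) (eps t e') (eps t e'') => *.
by rewrite !tripE !row3E dotE; ring.
Qed.

(** * The trivectors pi and al belong to A *)

Section Elements.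
Variable K : numFieldType.
Variables (p : 'I_4 -> 'rV[K]_3) (f : 'I_6 -> {mpoly K[3]}) (Q : {mpoly K[6]}).
Variables (w : 'I_6 -> {mpoly K[6]}) (k : option 'I_4) (L : 'M[K]_(2 * 3, 6)) (q0 q1 : 'M[K]_3).
Variables (mu : 'M[K]_(3, 6)) (ph : 'M[K]_(2, 6)) (ka : 'rV[K]_6).
Hypothesis Q2 : Q \is 2.-homog.
Hypothesis hf : forall a, lcomb f a = 0 -> a = 0.
Hypothesis QY : ~ dP_ideal f Q.
Hypothesis hw : lin_basis (quadrics_through (curve_ideal f Q)) w.
Hypothesis ad : adapted p f k L q0 q1.
Hypothesis qr : quadric_rows Q w L q0 q1 mu ph ka.

Local Notation u0 x := (x *m q0).
Local Notation u1 x := (x *m q1).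

(* The corrections to the leading term make the linear form defined by
   [pi_elt y] (and by [al_elt s y] below) vanish on the scheme of the P_z. *)
Definition pi_elt (y : 'rV[K]_3) : ext K :=
  w3 (y *m mu) (row b0 ph) (row b1 ph)
  + \sum_i ((y *m q0) 0 i *: mu_pair mu (row b0 ph) i + (y *m q1) 0 i *: mu_pair mu (row b1 ph) i).

Definition hcoef (s : 'rV[K]_2) (y : 'rV[K]_3) (a : 'I_2) (i : 'I_3) : K :=
  polar Q (sg L s y) (sg L (delta_mx 0 a) (delta_mx 0 i)).

Definition al_elt (s : 'rV[K]_2) (y : 'rV[K]_3) : ext K :=
  beta_wedge q0 q1 mu ph ka s y
  + \sum_a \sum_i hcoef s y a i *: mu_pair mu (row a ph) i.

Lemma hcoef_sum s y (t : 'rV[K]_2) (x : 'rV[K]_3) :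
  \sum_a \sum_i t 0 a * x 0 i * hcoef s y a i = polar Q (sg L s y) (sg L t x).
Proof.
have sumr v I (r : seq I) (F : I -> 'rV[K]_6) : polar Q v (\sum_(i <- r) F i) = \sum_(i <- r) polar Q v (F i).
  elim/big_rec2: _ => [|i a b _ <-]; last by rewrite polarDr.
  by rewrite /polar addr0 subrr (peval_homog0 Q2) subr0.
have -> : sg L t x = \sum_a \sum_i (t 0 a * x 0 i) *: sg L (delta_mx 0 a) (delta_mx 0 i).
  rewrite {1}(row_delta_sum t) sum2E sgDl !sgZl {1 2}(row_delta_sum x) !sum3E !sgDr !sgZr.
  by rewrite sum2E !sum3E !scalerDr !scalerA.
rewrite sumr; apply: eq_bigr => a _; rewrite sumr; apply: eq_bigr => i _.
by rewrite polarZr.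
Qed.

Lemma vals_ext (T : Type) (g g' : T -> K) e e' e'' : g =1 g' -> vals g e e' e'' = vals g' e e' e''.
Proof. by move=> gg'; rewrite /vals !gg'. Qed.

Lemma dot_bcov_sym s y x : dot (bcov q0 q1 s y) x = uform (u0 x) (u1 x) s y.
Proof.
rewrite dot_bcov /uform -!/(qform _ _ _).
by rewrite (qformC y x (adapted_sym0 ad)) (qformC y x (adapted_sym1 ad)).
Qed.

Section AtPoint.
Variables (c : 'I_3 -> 'I_6) (t : 'rV[K]_2) (x : 'rV[K]_3).
Hypothesis F0 : Fval q0 q1 t x = 0.
Let E (j : 'I_3) := coords L (delta_mx 0 (c j)).
Let G r e := polar (lcomb w r) (sg L t x) (mxvec e *m L).
Let om a := omega t x (u0 x) (u1 x) a (E o0) (E o1) (E o2).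
Let tx0 : uform (u0 x) (u1 x) t x = 0 := F0.

(* The value at a point of Y of the linear form X on the planes P_z. *)
Definition d3 (X : ext K) : K := locked (peval (form3 w c X) (sg L t x)).

Lemma d3E X : d3 X = peval (form3 w c X) (sg L t x).
Proof. by rewrite /d3 -lock. Qed.
Lemma d3D X Y : d3 (X + Y) = d3 X + d3 Y.
Proof. by rewrite !d3E form3D pevalD. Qed.
Lemma d3Z l X : d3 (l *: X) = l * d3 X.
Proof. by rewrite !d3E form3Z pevalZ. Qed.
Lemma d3_sum I (r : seq I) (F : I -> ext K) : d3 (\sum_(i <- r) F i) = \sum_(i <- r) d3 (F i).
Proof. by rewrite d3E form3_sum peval_sum; apply: eq_bigr => i _; rewrite d3E. Qed.

Lemma d3_w3 r0 r1 r2 :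
  d3 (w3 r0 r1 r2) =
  trip (vals (G r0) (E o0) (E o1) (E o2)) (vals (G r1) (E o0) (E o1) (E o2))
       (vals (G r2) (E o0) (E o1) (E o2)).
Proof. by rewrite d3E (peval_form3 hw) /vals /G /E !(coordsK (adapted_free ad)). Qed.

Lemma d3_mu_phi a i : d3 (mu_pair mu (row a ph) i) = x 0 i * om a.
Proof.
rewrite /mu_pair d3_w3 /om -trip_minors.
rewrite (vals_ext _ _ _ (polar_phi_row ad qr a t x)).
rewrite !(vals_ext _ _ _ (polar_minor_row1 qr _ t x)).
by rewrite !tripE; ring.
Qed.

Lemma d3_pi y a : t 0 a * d3 (pi_elt y) = 0.
Proof.
rewrite -[RHS](pi_eq0 tx0 y a (E o0) (E o1) (E o2)); congr (_ * _).
rewrite /pi_elt d3D d3_w3 d3_sum; congr (_ + _).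
  rewrite (vals_ext _ _ _ (polar_minor_row qr y t x)).
  by rewrite !(vals_ext _ _ _ (polar_phi_row ad qr _ t x)).
transitivity (\sum_i ((y *m q0) 0 i * (x 0 i * om b0) + (y *m q1) 0 i * (x 0 i * om b1))).
  by apply: eq_bigr => i _; rewrite d3D d3Z [X in _ + X]d3Z !d3_mu_phi.
have -> : dot (u0 x) y = dot (y *m q0) x by exact: qformC (adapted_sym0 ad).
have -> : dot (u1 x) y = dot (y *m q1) x by exact: qformC (adapted_sym1 ad).
rewrite sum3E !dotE -!/(om _).
by move: (om b0) (om b1) (y *m q0) (y *m q1) => ? ? ? ?; ring.
Qed.

Let kq e := polar Q (sg L t x) (mxvec e *m L).

Lemma G_kappa : G ka =1 kq.
Proof. by move=> e; rewrite /G (quadric_section qr). Qed.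

Let db s y := dbeta t x (u0 x) (u1 x) s y.

Lemma d3_beta s y : d3 (beta_wedge q0 q1 mu ph ka s y) =
  kq (E o0) * db s y (E o1) (E o2) + kq (E o1) * db s y (E o2) (E o0)
  + kq (E o2) * db s y (E o0) (E o1).
Proof.
rewrite /beta_wedge -[- \sum_i _]scaleN1r d3D d3Z d3_sum.
rewrite d3_w3 (vals_ext _ _ _ G_kappa) (vals_ext _ _ _ (polar_minor_row qr y t x)).
have Gt e : G (twist ph s) e = s 0 b1 * grad_phi t (u0 x) (u1 x) b0 e
    - s 0 b0 * grad_phi t (u0 x) (u1 x) b1 e.
  rewrite /G /twist lcombD lcombZ -scaleNr lcombZ polarDg !polarZg !(polar_phi_row ad qr).
  by rewrite mulNr.
rewrite (vals_ext _ _ _ Gt).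
have -> : \sum_i d3 (bcov q0 q1 s y 0 i *: mu_pair mu ka i) =
   dot (bcov q0 q1 s y) x * (kq (E o0) * trip x (eps t (E o1)) (eps t (E o2))
     + kq (E o1) * trip x (eps t (E o2)) (eps t (E o0)) + kq (E o2) * trip x (eps t (E o0)) (eps t (E o1))).
  transitivity (\sum_i bcov q0 q1 s y 0 i * trip (vals kq (E o0) (E o1) (E o2))
      (vals (grad_minor t x (ordS i)) (E o0) (E o1) (E o2))
      (vals (grad_minor t x (ordS (ordS i))) (E o0) (E o1) (E o2))).
    apply: eq_bigr => i _; rewrite d3Z /mu_pair d3_w3 (vals_ext _ _ _ G_kappa).
    by rewrite !(vals_ext _ _ _ (polar_minor_row1 qr _ t x)).
  exact: sum_minor_trip.
rewrite dot_bcov_sym tripE !valsE /db /dbeta.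
move: (kq (E o0)) (kq (E o1)) (kq (E o2)) (uform _ _ s y) (eps t (E o0)) (eps t (E o1)) (eps t (E o2)).
move: (grad_phi t (u0 x) (u1 x)) => g ? ? ? ? e0 e1 e2.
move: (g b0 (E o0)) (g b0 (E o1)) (g b0 (E o2)) (g b1 (E o0)) (g b1 (E o1)) (g b1 (E o2)) => *.
by move: (dot y _) (dot y _) (dot y _) (trip _ _ _) (trip _ _ _) (trip _ _ _) => *; ring.
Qed.

Definition rows4 a i : 'M[K]_(4, 6) :=
  \matrix_(l < 4) nth 0 [:: ka; row (ordS i) mu; row (ordS (ordS i)) mu; row a ph] l.

Definition cols4 (s : 'rV[K]_2) (y : 'rV[K]_3) : 'M[K]_(6, 4) :=
  \matrix_(l < 6, j < 4)
    (nth 0 [:: sg L s y; delta_mx 0 (c o0); delta_mx 0 (c o1); delta_mx 0 (c o2)] j : 'rV_6) 0 l.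

(** Expansion along the row of Q: the column s (x) y gives polar Q times [omega a], and the other
    three columns give contractions of [omega a] with s (x) y. *)
Lemma peval_form4_point s y a i :
  peval (form4 w (rows4 a i) (cols4 s y)) (sg L t x) =
  x 0 i * (polar Q (sg L s y) (sg L t x) * om a
    - kq (E o0) * omega t x (u0 x) (u1 x) a (s^T *m y) (E o1) (E o2)
    + kq (E o1) * omega t x (u0 x) (u1 x) a (s^T *m y) (E o0) (E o2)
    - kq (E o2) * omega t x (u0 x) (u1 x) a (s^T *m y) (E o0) (E o1)).
Proof.
rewrite (peval_form4 hw).
have -> : \matrix_(i0, j) polar (lcomb w (row i0 (rows4 a i))) (sg L t x)
     (\sum_l cols4 s y l j *: delta_mx 0 l) =
   \matrix_(i0 < 4, j < 4) G (nth 0 [:: ka; row (ordS i) mu; row (ordS (ordS i)) mu; row a ph] i0)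
      (nth 0 [:: s^T *m y; E o0; E o1; E o2] j).
  apply/matrixP => l j; rewrite !mxE rowK /G; congr polar.
  transitivity (nth 0 [:: sg L s y; delta_mx 0 (c o0); delta_mx 0 (c o1); delta_mx 0 (c o2)] j).
    by rewrite [RHS]row_delta_sum; apply: eq_bigr => m _; rewrite mxE.
  by case: j => [[|[|[|[|j]]]] Hj] //=; rewrite /E (coordsK (adapted_free ad)).
rewrite det4E !mxE /= !G_kappa.
have kz : kq (s^T *m y) = polar Q (sg L s y) (sg L t x) by rewrite /kq polarC.
rewrite kz.
have D e e' e'' : trip
    (row3 (G (row (ordS i) mu) e) (G (row (ordS i) mu) e') (G (row (ordS i) mu) e''))
    (row3 (G (row (ordS (ordS i)) mu) e) (G (row (ordS (ordS i)) mu) e') (G (row (ordS (ordS i)) mu) e''))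
    (row3 (G (row a ph) e) (G (row a ph) e') (G (row a ph) e'')) =
    x 0 i * omega t x (u0 x) (u1 x) a e e' e''.
  rewrite -trip_minors -!/(vals _ _ _ _).
  rewrite (vals_ext _ _ _ (polar_phi_row ad qr a t x)).
  by rewrite !(vals_ext _ _ _ (polar_minor_row1 qr _ t x)).
rewrite !D -/(om a).
move: (polar _ _ _) (om a) (kq (E o0)) (kq (E o1)) (kq (E o2)) => *.
by move: (omega _ _ _ _ _ _ _ _) (omega _ _ _ _ _ _ _ _) (omega _ _ _ _ _ _ _ _) => *; ring.
Qed.

(** The contractions of [omega a] are - t_a [dbeta], which recovers the part from [beta_wedge]. The
    term polar Q times [omega a] becomes t_a times the [hcoef] correction because the omegas are
    proportional to t; this is the origin of that correction. *)
Lemma d3_al s y a i :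
  t 0 a * x 0 i * d3 (al_elt s y) = peval (form4 w (rows4 a i) (cols4 s y)) (sg L t x).
Proof.
rewrite peval_form4_point /al_elt d3D d3_beta.
have -> : d3 (\sum_a \sum_i hcoef s y a i *: mu_pair mu (row a ph) i)
    = \sum_a' \sum_j hcoef s y a' j * x 0 j * om a'.
  rewrite d3_sum; apply: eq_bigr => a' _.
  rewrite d3_sum; apply: eq_bigr => j _.
  by rewrite d3Z d3_mu_phi mulrA.
have B e e' : t 0 a * db s y e e' = - omega t x (u0 x) (u1 x) a (s^T *m y) e e'.
  exact: dbeta_omega.
have O : t 0 a * (\sum_a' \sum_j hcoef s y a' j * x 0 j * om a') = polar Q (sg L s y) (sg L t x) * om a.
  rewrite -hcoef_sum big_distrr big_distrl; apply: eq_bigr => a' _ /=.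
  rewrite big_distrr big_distrl; apply: eq_bigr => j _ /=.
  have := omega_prop2 tx0 a a' (E o0) (E o1) (E o2); rewrite -!/(om _) => W.
  transitivity (hcoef s y a' j * x 0 j * (t 0 a * om a')); first by ring.
  rewrite W; ring.
have B0 := B (E o1) (E o2); have B1 := B (E o2) (E o0); have B2 := B (E o0) (E o1).
move: B0 B1 B2 O; rewrite (omega_swap t x (u0 x) (u1 x) a (s^T *m y) (E o0) (E o2)).
move: (db s y (E o1) (E o2)) (db s y (E o2) (E o0)) (db s y (E o0) (E o1)) => D0 D1 D2.
move: (omega t x (u0 x) (u1 x) a (s^T *m y) (E o1) (E o2))
  (omega t x (u0 x) (u1 x) a (s^T *m y) (E o0) (E o2))
  (omega t x (u0 x) (u1 x) a (s^T *m y) (E o0) (E o1)) => W0 W1 W2.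
move: (\sum_a' _) (polar Q _ _ * om a) (kq (E o0)) (kq (E o1)) (kq (E o2)) (t 0 a) (x 0 i).
move=> H C k0 k1 k2 ta xi B0 B1 B2 O; rewrite -O.
transitivity (xi * (k0 * (ta * D0) + k1 * (ta * D1) + k2 * (ta * D2) + ta * H)); first by ring.
by rewrite B0 B1 B2; ring.
Qed.

End AtPoint.

Variables (J : Type) (P : J -> 'M[K]_(3, 6)) (A : {vspace ext K}).
Hypothesis hFC : FC_eq_section P (curve_ideal f Q) w A.
Hypothesis hM : morin_configuration A.
Hypothesis hP : forall j, exists k' L' q0' q1',
  adapted p f k' L' q0' q1' /\ net_basis w (segre_net p f k') (P j).

Lemma mu_pair_supp r i (S : {set 'I_6}) : #|S| != 3%N -> mu_pair mu r i S = 0.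
Proof. exact: w3_supp. Qed.

Lemma linear_form_sg a (t : 'rV[K]_2) (x : 'rV[K]_3) :
  peval (lcomb (fun i => 'X_i) a) (sg L t x) =
  \sum_i \sum_j t 0 i * x 0 j * peval (lcomb (fun i => 'X_i) a) (sg L (delta_mx 0 i) (delta_mx 0 j)).
Proof.
have D v v' : peval (lcomb (fun i => 'X_i) a) (v + v') =
    peval (lcomb (fun i => 'X_i) a) v + peval (lcomb (fun i => 'X_i) a) v'.
  rewrite !peval_lcomb -big_split; apply: eq_bigr => i _ /=.
  by rewrite !pevalX mxE mulrDr.
have Z c v : peval (lcomb (fun i => 'X_i) a) (c *: v) = c * peval (lcomb (fun i => 'X_i) a) v.
  rewrite !peval_lcomb big_distrr; apply: eq_bigr => i _ /=.
  by rewrite !pevalX mxE mulrCA.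
rewrite {1}(row_delta_sum t) sum2E sgDl !sgZl {1 2}(row_delta_sum x) !sum3E !sgDr !sgZr !D !Z.
by rewrite sum2E !sum3E !D !Z; ring.
Qed.

Lemma row_mu_span i : exists al d, row i mu = al *m mu + d *m ph.
Proof. by exists (delta_mx 0 i), 0; rewrite mul0mx addr0 rowE. Qed.

Lemma row_ph_span a : exists al d, row a ph = al *m mu + d *m ph.
Proof. by exists 0, (delta_mx 0 a); rewrite mul0mx add0r rowE. Qed.

Lemma top_mu_phi_net a i j : top (mu_pair mu (row a ph) i) (plucker (P j)) = 0.
Proof.
have [k' [L' [q0' [q1' [ad' hPj]]]]] := hP j.
apply: (wedge_net_rows hf QY ad qr ad' hPj); [exact: row_ph_span|exact: row_mu_span|exact: row_mu_span].
Qed.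

Lemma supp_sum I (r : seq I) (F : I -> ext K) (S : {set 'I_6}) :
  (forall i, F i S = 0) -> (\sum_(i <- r) F i) S = 0.
Proof. by move=> F0; rewrite sum_ffunE big1. Qed.

Lemma pi_elt_mem y : pi_elt y \in A.
Proof.
apply: (mem_lagrangian hFC hM) => [S S3|j|c a].
- rewrite /pi_elt extD w3_supp // supp_sum ?addr0 // => i.
  by rewrite extD !extZ !mu_pair_supp // !mulr0 addr0.
- rewrite -topE /pi_elt topD top_sum big1 ?addr0 => [|i _]; last first.
    by rewrite topD !topZ !top_mu_phi_net !mulr0 addr0.
  have [k' [L' [q0' [q1' [ad' hPj]]]]] := hP j.
  apply: (wedge_net_rows hf QY ad qr ad' hPj); [|exact: row_ph_span|exact: row_ph_span].
  by exists y, 0; rewrite mul0mx addr0.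
(* The form of [pi_elt] vanishes on all of Y, so the zero combination of minors serves. *)
exists 0; first by exists (fun _ _ => 0); rewrite big1 // => R _; rewrite big1 // => C _; exact: mul0r.
apply/dP_idealP => v; have [t [x [-> F0]]] := adapted_point ad v.
rewrite subr0 pevalM linear_form_sg -d3E big_distrl big1 // => a' _ /=.
rewrite big_distrl big1 // => j _ /=.
by rewrite mulrAC [t 0 a' * _]mulrC -[x 0 j * _ * _]mulrA (d3_pi c F0) mulr0 mul0r.
Qed.

Lemma al_elt_mem s y : al_elt s y \in A.
Proof.
apply: (mem_lagrangian hFC hM) => [S S3|j|c a].
- rewrite /al_elt extD supp_sum ?addr0 => [|a]; last first.
    by rewrite supp_sum // => i; rewrite extZ mu_pair_supp // mulr0.
  rewrite /beta_wedge extD extN w3_supp // supp_sum ?subr0 // => i.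
  by rewrite extZ mu_pair_supp // mulr0.
- have [k' [L' [q0' [q1' [ad' hPj]]]]] := hP j.
  rewrite -topE /al_elt topD (kappa_beta_net hf QY ad qr ad' hPj) add0r.
  rewrite top_sum big1 // => a _; rewrite top_sum big1 // => i _.
  by rewrite topZ top_mu_phi_net mulr0.
(* The linear form a is expanded in the products t_i x_j, each of which is settled by one Jacobian
   minor. *)
pose g i j := peval (lcomb (fun i => 'X_i) a) (sg L (delta_mx 0 i) (delta_mx 0 j)).
exists (\sum_i \sum_j g i j *: form4 w (rows4 i j) (cols4 c s y)).
  apply: minor_span_sum => i; apply: minor_span_sum => j; apply: minor_spanZ; exact: form4_span.
apply/dP_idealP => v; have [t [x [-> F0]]] := adapted_point ad v.
rewrite pevalB pevalM linear_form_sg -d3E peval_sum big_distrl -sumrB big1 // => i _ /=.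
rewrite peval_sum big_distrl -sumrB big1 // => j _ /=.
rewrite pevalZ -(d3_al c F0) /g; move: (d3 _ _ _ _) (peval _ _) => *; ring.
Qed.

End Elements.

(** * The equation of V_A *)

Section Blocks.
Variable K : numFieldType.
Implicit Types (a b c d e f : 'rV[K]_6) (al be ga : 'rV[K]_3).

Lemma w3_cyc a b c : w3 a b c = w3 b c a.
Proof. by apply/ffunP => S; rewrite !w3E; case: ifP => // _; ring. Qed.

Lemma w3Dr a b c c' : w3 a b (c + c') = w3 a b c + w3 a b c'.
Proof.
by apply/ffunP => S; rewrite extD !w3E; case: ifP => _; [rewrite !mxE; ring|rewrite addr0].
Qed.
Lemma w3Dm a b b' c : w3 a (b + b') c = w3 a b c + w3 a b' c.
Proof.
by apply/ffunP => S; rewrite extD !w3E; case: ifP => _; [rewrite !mxE; ring|rewrite addr0].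
Qed.

Lemma det6_shuffle a b c d e f : det6 a b c d e f = det6 a d e b c f.
Proof.
pose i1 : 'I_6 := @Ordinal 6 1 isT; pose i2 : 'I_6 := @Ordinal 6 2 isT.
pose i3 : 'I_6 := @Ordinal 6 3 isT; pose i4 : 'I_6 := @Ordinal 6 4 isT.
transitivity (- det6 a d c b e f).
  apply: (@det_row_swap _ _ _ _ i1 i3) => // l; rewrite !rowK.
  case: tpermP => [->|->|] //; case: l => [[|[|[|[|[|[|l]]]]]] Hl] // H1 H2.
    by case: H1; apply: val_inj.
  by case: H2; apply: val_inj.
transitivity (- - det6 a d e b c f); last by rewrite opprK.
congr (- _); apply: (@det_row_swap _ _ _ _ i2 i4) => // l; rewrite !rowK.
case: tpermP => [->|->|] //; case: l => [[|[|[|[|[|[|l]]]]]] Hl] // H1 H2.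
  by case: H1; apply: val_inj.
by case: H2; apply: val_inj.
Qed.

Lemma det6_eq03 a b c e f : det6 a b c a e f = 0.
Proof.
apply: (@determinant_alternate _ _ _ (@Ordinal 6 0 isT) (@Ordinal 6 3 isT)) => // l.
by rewrite !mxE.
Qed.

Variables (mu th : 'M[K]_(3, 6)).
Let B : 'M[K]_6 := col_mx mu th.

(** In the basis (mu, theta), with the three pure mu vectors moved to the front, the coordinate
    matrix is block triangular. *)
Lemma det6_block al1 al2 al3 be be' ga ga' nu nu' :
  det6 (al1 *m mu) (be *m mu + be' *m th) (ga *m mu + ga' *m th)
       (al2 *m mu) (al3 *m mu) (nu *m mu + nu' *m th) =
  trip al1 al2 al3 * trip be' ga' nu' * \det B.
Proof.
rewrite det6_shuffle.
pose A1 := \matrix_(i < 3) l3 al1 al2 al3 i.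
pose A3 := \matrix_(i < 3) l3 be ga nu i.
pose A4 := \matrix_(i < 3) l3 be' ga' nu' i.
have dA (a b c : 'rV[K]_3) : \det (\matrix_(i < 3) l3 a b c i) = trip a b c.
  by rewrite det3E tripE !mxE /=; ring.
rewrite -!dA -/A1 -/A4 -(det_lblock A1 A3 A4) -(det_mulmx (n := 6)); congr (\det _).
have -> : (block_mx A1 0 A3 A4 : 'M_6) *m B = col_mx (A1 *m mu) (A3 *m mu + A4 *m th).
  rewrite /B (mul_block_col (m1 := 3) (n1 := 3)) mul0mx addr0 //.
apply/row_matrixP => l; rewrite rowK.
case: l => [[|[|[|[|[|[|l]]]]]] Hl] //=.
- rewrite (_ : Ordinal Hl = lshift 3 o0); last exact: val_inj.
  by have E := rowKu o0 (A1 *m mu) (A3 *m mu + A4 *m th); rewrite row_mul rowK in E; exact: esym E.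
- rewrite (_ : Ordinal Hl = lshift 3 o1); last exact: val_inj.
  by have E := rowKu o1 (A1 *m mu) (A3 *m mu + A4 *m th); rewrite row_mul rowK in E; exact: esym E.
- rewrite (_ : Ordinal Hl = lshift 3 o2); last exact: val_inj.
  by have E := rowKu o2 (A1 *m mu) (A3 *m mu + A4 *m th); rewrite row_mul rowK in E; exact: esym E.
- rewrite (_ : Ordinal Hl = rshift 3 o0); last exact: val_inj.
  have E := rowKd o0 (A1 *m mu) (A3 *m mu + A4 *m th).
  by rewrite raddfD /= !row_mul !rowK in E; exact: esym E.
- rewrite (_ : Ordinal Hl = rshift 3 o1); last exact: val_inj.
  have E := rowKd o1 (A1 *m mu) (A3 *m mu + A4 *m th).
  by rewrite raddfD /= !row_mul !rowK in E; exact: esym E.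
rewrite (_ : Ordinal Hl = rshift 3 o2); last exact: val_inj.
have E := rowKd o2 (A1 *m mu) (A3 *m mu + A4 *m th).
by rewrite raddfD /= !row_mul !rowK in E; exact: esym E.
Qed.

End Blocks.

Section PlaneCalculus.
Variable K : numFieldType.
Implicit Types (U V : 'M[K]_(3, 6)) (r v : 'rV[K]_6).

(** The subspace W^2_u of trivectors with two factors in U, split along the complement V; the
    coefficient d is the part in /\^3 U. *)
Definition in_W2 U V (z : ext K) := exists (c : 'M[K]_3) (d : K),
  z = \sum_i \sum_j c i j *: w3 (row (ordS i) U) (row (ordS (ordS i)) U) (row j V)
      + d *: plucker U.

Variables U V : 'M[K]_(3, 6).

Lemma in_W2D z z' : in_W2 U V z -> in_W2 U V z' -> in_W2 U V (z + z').
Proof.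
move=> [c [d ->]] [c' [d' ->]]; exists (c + c'), (d + d').
rewrite addrACA -scalerDl -big_split; congr (_ + _); apply: eq_bigr => i _ /=.
by rewrite -big_split; apply: eq_bigr => j _; rewrite mxE scalerDl.
Qed.

Lemma in_W2Z l z : in_W2 U V z -> in_W2 U V (l *: z).
Proof.
move=> [c [d ->]]; exists (l *: c), (l * d).
rewrite scalerDr scalerA scaler_sumr; congr (_ + _); apply: eq_bigr => i _.
by rewrite scaler_sumr; apply: eq_bigr => j _; rewrite mxE scalerA.
Qed.

Lemma in_W2N z : in_W2 U V z -> in_W2 U V (- z).
Proof. by rewrite -scaleN1r; exact: in_W2Z. Qed.

Lemma in_W20 : in_W2 U V 0.
Proof.
exists 0, 0; rewrite scale0r addr0 big1 // => i _; rewrite big1 // => j _.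
by rewrite mxE scale0r.
Qed.

Lemma in_W2_sum I (r : seq I) (F : I -> ext K) :
  (forall i, in_W2 U V (F i)) -> in_W2 U V (\sum_(i <- r) F i).
Proof. by move=> FW; apply: (big_ind (in_W2 U V)) => //; [exact: in_W20|exact: in_W2D]. Qed.

Lemma w3_cross (al be : 'rV[K]_3) v : w3 (al *m U) (be *m U) v =
  \sum_i cross al be 0 i *: w3 (row (ordS i) U) (row (ordS (ordS i)) U) v.
Proof.
apply/ffunP => S; rewrite sum_ffunE.
under eq_bigr => i _ do rewrite extZ w3E.
rewrite w3E; case: ifP => _; last by rewrite big1 // => i _; rewrite mulr0.
rewrite sum3E !crossE !ordSE !mxE !sum3E; ring.
Qed.

Lemma w3_pair_row (i : 'I_3) (be ga : 'rV[K]_3) :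
  w3 (row (ordS i) U) (row (ordS (ordS i)) U) (be *m U + ga *m V) =
  \sum_j ga 0 j *: w3 (row (ordS i) U) (row (ordS (ordS i)) U) (row j V) + be 0 i *: plucker U.
Proof.
apply/ffunP => S; rewrite extD extZ sum_ffunE pluckerE.
under eq_bigr => j _ do rewrite extZ w3E.
rewrite !w3E; case: ifP => _; last by rewrite mulr0 addr0 big1 // => j _; rewrite mulr0.
by case: (ord3P i) => ->; rewrite sum3E !ordSE !mxE !sum3E; ring.
Qed.

Lemma in_W2_w3 (al be be' ga' : 'rV[K]_3) :
  in_W2 U V (w3 (al *m U) (be *m U) (be' *m U + ga' *m V)).
Proof.
rewrite w3_cross; apply: in_W2_sum => i; apply: in_W2Z; rewrite w3_pair_row.
exists (\matrix_(k, j) ((k == i)%:R * ga' 0 j)), (be' 0 i); congr (_ + _).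
rewrite [RHS](bigD1 i) //= [X in _ = _ + X]big1 ?addr0 => [|k /negPf ki].
  by apply: eq_bigr => j _; rewrite mxE eqxx mul1r.
by rewrite big1 // => j _; rewrite mxE ki mul0r scale0r.
Qed.

End PlaneCalculus.

(** * Coordinates on the net and on its complement *)

Section VA.
Variable K : numFieldType.
Variables (p : 'I_4 -> 'rV[K]_3) (f : 'I_6 -> {mpoly K[3]}) (Q : {mpoly K[6]}).
Variables (w : 'I_6 -> {mpoly K[6]}) (k : option 'I_4) (L : 'M[K]_(2 * 3, 6)) (q0 q1 : 'M[K]_3).
Variables (mu : 'M[K]_(3, 6)) (ph : 'M[K]_(2, 6)) (ka : 'rV[K]_6).
Hypothesis hf : forall a, lcomb f a = 0 -> a = 0.
Hypothesis QY : ~ dP_ideal f Q.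
Hypothesis hw : lin_basis (quadrics_through (curve_ideal f Q)) w.
Hypothesis ad : adapted p f k L q0 q1.
Hypothesis qr : quadric_rows Q w L q0 q1 mu ph ka.
Variables (U V : 'M[K]_(3, 6)).
Hypothesis hU : net_basis w (segre_net p f k) U.
Hypothesis hUV : row_free (col_mx U V).

(** A complement of the net adapted to q: its rows restrict to t_0 F, t_1 F and G on the Segre
    threefold. *)
Definition theta : 'M[K]_(3, 6) := \matrix_(i < 3) l3 (row b0 ph) (row b1 ph) ka i.

Lemma theta_mulE (be : 'rV[K]_3) : be *m theta = lead2 be *m ph + be 0 o2 *: ka.
Proof.
by rewrite !mulmx_sum_row sum3E sum2E !rowK !lead2E.
Qed.

Lemma mu_theta_unit : (col_mx mu theta : 'M_6) \in unitmx.
Proof.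
rewrite -row_free_unit; apply: inj_row_free => r.
rewrite -[r](hsubmxK (r : 'rV_(3 + 3))) (mul_row_col (n1 := 3)) theta_mulE addrA.
case/(rows_independent hf QY ad qr) => E1 E2 E3.
rewrite E1 (_ : rsubmx _ = 0) ?row_mx0 //.
apply/rowP => i; rewrite [RHS]mxE; set be := rsubmx _ in E2 E3 *.
case: (ord3P i) => ->; [rewrite -(lead2E be).1|rewrite -(lead2E be).2|by rewrite E3].
  by rewrite E2 mxE.
by rewrite E2 mxE.
Qed.

Lemma mu_theta_span (r : 'rV[K]_6) : exists be be', r = be *m mu + be' *m theta.
Proof.
rewrite -[r](mulmxKV mu_theta_unit); set r' := r *m _.
by rewrite -[r'](hsubmxK (r' : 'rV_(3 + 3))) (mul_row_col (n1 := 3)); do 2 eexists.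
Qed.

Lemma net_mu : exists2 Ga : 'M[K]_3, Ga \in unitmx & U = Ga *m mu.
Proof.
have [Ga GaE] : exists Ga : 'M[K]_3, forall i, row i U = row i Ga *m mu.
  apply: (row_choice (P := fun i r => row i U = r *m mu)) => i.
  have /(segre_net_minors ad (wq_homog hw _)).1 [al alE] : segre_net p f k (lcomb w (row i U)).
    by apply/hU.1; exists (delta_mx 0 i); rewrite -lcomb_mul -rowE.
  exists al; apply: (lcomb_w_inj hw); apply: peval_inj => v.
  by rewrite -(coordsK (adapted_free ad) v) alE (minor_rowE qr).
have UE : U = Ga *m mu by apply/row_matrixP => i; rewrite GaE row_mul.
exists Ga => //; rewrite -row_free_unit; apply: inj_row_free => r rG.
have /(row_free_inj hUV) : row_mx r (0 : 'rV_3) *m col_mx U V = 0 *m col_mx U V.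
  by rewrite mul_row_col UE mulmxA rG !mul0mx add0r.
by move/(congr1 lsubmx); rewrite row_mxKl linear0.
Qed.

Lemma complement_theta (Ga : 'M[K]_3) : Ga \in unitmx -> U = Ga *m mu ->
  exists (N1 N2 : 'M[K]_3), N2 \in unitmx /\ V = N1 *m mu + N2 *m theta.
Proof.
move=> Gu UE.
have [N1 N1E] : exists N1 : 'M[K]_3, forall i, exists r, row i V = row i N1 *m mu + r *m theta.
  apply: (row_choice (P := fun i be => exists r, row i V = be *m mu + r *m theta)) => i.
  by have [be [be' E]] := mu_theta_span (row i V); exists be, be'.
have [N2 N2E] : exists N2 : 'M[K]_3, forall i, row i V = row i N1 *m mu + row i N2 *m theta.
  exact: (row_choice (P := fun i r => row i V = row i N1 *m mu + r *m theta)).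
have VE : V = N1 *m mu + N2 *m theta.
  by apply/row_matrixP => i; rewrite N2E raddfD /= !row_mul.
exists N1, N2; split=> //; rewrite -row_free_unit; apply: inj_row_free => r rN.
have /(row_free_inj hUV) : row_mx (- (r *m N1 *m invmx Ga)) r *m col_mx U V = 0 *m col_mx U V.
  rewrite mul_row_col mul0mx UE VE mulmxDr !mulmxA rN mul0mx addr0 !mulNmx.
  by rewrite mulmxKV // addNr.
by move/(congr1 rsubmx); rewrite row_mxKr linear0.
Qed.

Variables (Ga N1 N2 : 'M[K]_3).
Hypothesis Gu : Ga \in unitmx.
Hypothesis UE : U = Ga *m mu.
Hypothesis VE : V = N1 *m mu + N2 *m theta.
Hypothesis N2u : N2 \in unitmx.

(** The map induced on bivectors: it expresses V_(i+1) /\ V_(i+2), modulo the net, through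
    theta_(j+1) /\ theta_(j+2). *)
Definition cofactors (N : 'M[K]_3) : 'M[K]_3 :=
  \matrix_(i, j) cross (row (ordS i) N) (row (ordS (ordS i)) N) 0 j.

Lemma cofactors_mul (N : 'M[K]_3) : cofactors N *m N^T = (\det N)%:M.
Proof.
apply/matrixP => i j; rewrite mxE [RHS]mxE sum3E ![_^T _ _]mxE ![cofactors N _ _]mxE !crossE ![row _ _ _ _]mxE det3E.
by case: (ord3P i) => ->; case: (ord3P j) => ->; rewrite !ordSE /= ?mulr1n ?mulr0n; ring.
Qed.

Lemma cofactors_unit (N : 'M[K]_3) : N \in unitmx -> cofactors N \in unitmx.
Proof.
move=> Nu; have : cofactors N *m N^T \in unitmx.
  by rewrite cofactors_mul unitmxE det_scalar unitrX // -unitmxE.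
by rewrite unitmx_mul => /andP[].
Qed.

Lemma in_W2_mu (al be : 'rV[K]_3) (v : 'rV[K]_6) : in_W2 U V (w3 (al *m mu) (be *m mu) v).
Proof.
have muE : mu = invmx Ga *m U by rewrite UE mulKmx.
have [be' [ga' vE]] : exists be' ga', v = be' *m U + ga' *m V.
  have [b [b' ->]] := mu_theta_span v.
  exists (b *m invmx Ga - b' *m invmx N2 *m N1 *m invmx Ga), (b' *m invmx N2).
  rewrite UE VE mulmxDr !mulmxA mulmxBl !mulmxKV //.
  by rewrite mulmxBl addrA subrK.
by rewrite vE muE !mulmxA; exact: in_W2_w3.
Qed.

End VA.

Section TopMore.
Variable K : numFieldType.

Lemma topDr (x y y' : ext K) : top x (y + y') = top x y + top x y'.
Proof. by rewrite !topE wedgeDr ffunE. Qed.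
Lemma top_sumr I (r : seq I) (P : pred I) (F : I -> ext K) x :
  top x (\sum_(i <- r | P i) F i) = \sum_(i <- r | P i) top x (F i).
Proof. by rewrite topE wedge_sumr sum_ffunE; apply: eq_bigr => i _; rewrite topE. Qed.

Definition supp3 (z : ext K) := forall S : {set 'I_6}, #|S| != 3%N -> z S = 0.

Lemma supp3_w3 a b c : supp3 (w3 a b c).
Proof. by move=> S; apply: w3_supp. Qed.
Lemma supp3Z l z : supp3 z -> supp3 (l *: z).
Proof. by move=> h S S3; rewrite extZ h // mulr0. Qed.
Lemma supp3_sum I (r : seq I) (F : I -> ext K) : (forall i, supp3 (F i)) -> supp3 (\sum_(i <- r) F i).
Proof. by move=> h S S3; rewrite sum_ffunE big1 // => i _; rewrite h. Qed.

Lemma wedge_supp3 z z' : supp3 z -> supp3 z' -> wedge z z' = top z z' *: ext_basis K [set: 'I_6].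
Proof.
move=> h h'; apply/ffunP => S; rewrite extZ [ext_basis _ _ _]ffunE.
have [->|ST] := eqVneq S setT; first by rewrite mulr1 topE.
rewrite mulr0 ffunE big1 // => T TS.
have [T3|T3] := eqVneq #|T| 3%N; last by rewrite h // mulr0 mul0r.
rewrite h' ?mulr0 //; apply: contraNneq ST => D3.
rewrite eqEcard subsetT cardsT card_ord -(cardsID T S) (setIidPr TS) T3 D3 //.
Qed.

End TopMore.

(** * The value of a_1 /\ a_2 *)

Section VAValue.
Variable K : numFieldType.
Variables (p : 'I_4 -> 'rV[K]_3) (f : 'I_6 -> {mpoly K[3]}) (Q : {mpoly K[6]}).
Variables (w : 'I_6 -> {mpoly K[6]}) (k : option 'I_4) (L : 'M[K]_(2 * 3, 6)) (q0 q1 : 'M[K]_3).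
Variables (mu : 'M[K]_(3, 6)) (ph : 'M[K]_(2, 6)) (ka : 'rV[K]_6).
Hypothesis Q2 : Q \is 2.-homog.
Hypothesis hf : forall a, lcomb f a = 0 -> a = 0.
Hypothesis QY : ~ dP_ideal f Q.
Hypothesis ad : adapted p f k L q0 q1.
Hypothesis qr : quadric_rows Q w L q0 q1 mu ph ka.
Variables (U V : 'M[K]_(3, 6)) (Ga N1 N2 : 'M[K]_3).
Hypothesis Gu : Ga \in unitmx.
Hypothesis UE : U = Ga *m mu.
Hypothesis VE : V = N1 *m mu + N2 *m theta ph ka.
Hypothesis N2u : N2 \in unitmx.
Variable A : {vspace ext K}.
Hypothesis lagA : lagrangian A.
Hypothesis piA : forall y, pi_elt q0 q1 mu ph y \in A.
Hypothesis alA : forall s y, al_elt Q L q0 q1 mu ph ka s y \in A.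

Local Notation th := (theta ph ka).
Local Notation Delta := (\det (col_mx mu th : 'M_6)).
Local Notation W2 := (in_W2 U V).

Lemma W2_mu (al be : 'rV[K]_3) v : W2 (w3 (al *m mu) (be *m mu) v).
Proof. exact: (in_W2_mu hf QY ad qr Gu UE VE N2u). Qed.

(** Four of the six vectors lie in the three-dimensional span of mu. *)
Lemma top_mu4 (al be ga de : 'rV[K]_3) v v' :
  top (w3 (al *m mu) (be *m mu) v) (w3 (ga *m mu) (de *m mu) v') = 0.
Proof.
rewrite top_w3; have [c [c' ->]] := mu_theta_span hf QY ad qr v.
have [d [d' ->]] := mu_theta_span hf QY ad qr v'.
have -> : be *m mu = be *m mu + 0 *m th by rewrite mul0mx addr0.
by rewrite det6_block [trip 0 _ _]tripE !mxE; ring.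
Qed.

Lemma W2_top z z' : W2 z -> W2 z' -> top z z' = 0.
Proof.
have gen z1 z2 : (exists (a b : 'rV[K]_3) v, z1 = w3 (a *m mu) (b *m mu) v) ->
    (exists (a b : 'rV[K]_3) v, z2 = w3 (a *m mu) (b *m mu) v) -> top z1 z2 = 0.
  by move=> [a [b [v ->]]] [a' [b' [v' ->]]]; exact: top_mu4.
have gU i v : exists (a b : 'rV[K]_3) v', w3 (row (ordS i) U) (row (ordS (ordS i)) U) v =
    w3 (a *m mu) (b *m mu) v'.
  by exists (row (ordS i) Ga), (row (ordS (ordS i)) Ga), v; rewrite -!row_mul UE.
have gP : exists (a b : 'rV[K]_3) v', plucker U = w3 (a *m mu) (b *m mu) v'.
  by exists (row o0 Ga), (row o1 Ga), (row o2 U); rewrite -!row_mul UE -UE pluckerE.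
move=> [c [d ->]] [c' [d' ->]].
have right z1 : (exists (a b : 'rV[K]_3) v, z1 = w3 (a *m mu) (b *m mu) v) ->
    top z1 (\sum_i \sum_j c' i j *: w3 (row (ordS i) U) (row (ordS (ordS i)) U) (row j V)
      + d' *: plucker U) = 0.
  move=> g1; rewrite topDr top_sumr big1 => [|i _].
    by rewrite topZr (gen _ _ g1 gP) mulr0 addr0.
  rewrite top_sumr big1 // => j _; rewrite topZr (gen _ _ g1 (gU i _)); exact: mulr0.
rewrite topD top_sum big1 => [|i _]; first by rewrite topZ right // mulr0 addr0.
by rewrite top_sum big1 // => j _; rewrite topZ right ?mulr0.
Qed.

(** For X in U, the representative over the point (X, y) whose second factor is a bivector of the
    complement theta. *)
Definition lead_elt (X : 'rV[K]_6) (y : 'rV[K]_3) : ext K :=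
  \sum_j y 0 j *: w3 X (row (ordS j) th) (row (ordS (ordS j)) th).

Definition VA_elt (x y : 'rV[K]_3) : ext K :=
  y 0 o2 *: pi_elt q0 q1 mu ph x - al_elt Q L q0 q1 mu ph ka (lead2 y) x.

Definition rest_elt (x y : 'rV[K]_3) : ext K :=
  y 0 o2 *: \sum_i ((x *m q0) 0 i *: mu_pair mu (row b0 ph) i
                    + (x *m q1) 0 i *: mu_pair mu (row b1 ph) i)
  + \sum_i bcov q0 q1 (lead2 y) x 0 i *: mu_pair mu ka i
  - \sum_a \sum_i hcoef Q L (lead2 y) x a i *: mu_pair mu (row a ph) i.

Lemma row_theta : (row o0 th = row b0 ph) * (row o1 th = row b1 ph) * (row o2 th = ka).
Proof. by rewrite /theta !rowK. Qed.

Lemma lead_eltE X y : lead_elt X y =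
  y 0 o2 *: w3 X (row b0 ph) (row b1 ph) - w3 ka X (twist ph (lead2 y)).
Proof.
apply/ffunP => S; rewrite /lead_elt sum3E !ordSE !row_theta !extD extN !extZ !w3E.
case: ifP => _; last by ring.
rewrite /twist !lead2E; move: (row b0 ph) (row b1 ph) => r0 r1; rewrite !mxE; ring.
Qed.

Lemma VA_elt_split x y : VA_elt x y = lead_elt (x *m mu) y + rest_elt x y.
Proof.
rewrite /VA_elt /pi_elt /al_elt /beta_wedge /rest_elt lead_eltE scalerDr.
move: (w3 _ _ _) (\sum_i _) (w3 _ _ _) (\sum_i _) (\sum_i _) => a b c d e.
rewrite -!addrA; congr (_ + _); rewrite [RHS]addrCA; congr (_ + _).
by rewrite !opprD opprK.
Qed.

Lemma VA_elt_mem x y : VA_elt x y \in A.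
Proof. by rewrite /VA_elt rpredB // rpredZ. Qed.

Lemma W2_mu_pair r i : W2 (mu_pair mu r i).
Proof. by rewrite /mu_pair w3_cyc [row (ordS i) mu]rowE [row (ordS (ordS i)) mu]rowE; exact: W2_mu. Qed.

Lemma W2_rest x y : W2 (rest_elt x y).
Proof.
rewrite /rest_elt; apply: in_W2D; [apply: in_W2D|].
- apply/in_W2Z/in_W2_sum => i; apply: in_W2D; apply: in_W2Z; exact: W2_mu_pair.
- apply: in_W2_sum => i; apply: in_W2Z; exact: W2_mu_pair.
apply/in_W2N/in_W2_sum => a; apply: in_W2_sum => i; apply: in_W2Z; exact: W2_mu_pair.
Qed.

Lemma top_lead_mu_pair x y j i :
  top (lead_elt (x *m mu) y) (mu_pair mu (row j th) i) = Delta * (y 0 j * x 0 i).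
Proof.
rewrite /lead_elt top_sum.
have E l : top (w3 (x *m mu) (row (ordS l) th) (row (ordS (ordS l)) th)) (mu_pair mu (row j th) i)
    = Delta * (x 0 i * (l == j)%:R).
  rewrite /mu_pair [w3 (row j th) _ _]w3_cyc top_w3.
  have thE m : row m th = 0 *m mu + (delta_mx 0 m : 'rV[K]_3) *m th by rewrite mul0mx add0r rowE.
  rewrite !thE [row (ordS i) mu]rowE [row (ordS (ordS i)) mu]rowE det6_block mulrC; congr (_ * _).
  rewrite !tripE !mxE.
  by case: (ord3P i) => ->; case: (ord3P l) => ->; case: (ord3P j) => ->; rewrite !ordSE /=; ring.
under eq_bigr => l _ do rewrite topZ E.
by rewrite sum3E; case: (ord3P j) => -> /=; ring.
Qed.

(** The corrections in pi and in [beta_wedge] each contribute y_2 F, and the [hcoef] part is a polar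
    form on the diagonal, 2 G; hence the factor 2. *)
Lemma top_lead_rest x y : top (lead_elt (x *m mu) y) (rest_elt x y) =
  2%:R * Delta * (y 0 o2 * Fval q0 q1 (lead2 y) x - peval Q (sg L (lead2 y) x)).
Proof.
set T := lead_elt _ _.
have T0 i : top T (mu_pair mu (row b0 ph) i) = Delta * (y 0 o0 * x 0 i).
  by rewrite -row_theta.1.1 top_lead_mu_pair.
have T1 i : top T (mu_pair mu (row b1 ph) i) = Delta * (y 0 o1 * x 0 i).
  by rewrite -row_theta.1.2 top_lead_mu_pair.
have T2 i : top T (mu_pair mu ka i) = Delta * (y 0 o2 * x 0 i).
  by rewrite -[X in mu_pair _ X]row_theta.2 top_lead_mu_pair.
have TN z : top T (- z) = - top T z by rewrite -scaleN1r topZr mulN1r.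
rewrite /rest_elt topDr TN topDr topZr top_sumr.
have -> : \sum_i top T ((x *m q0) 0 i *: mu_pair mu (row b0 ph) i
    + (x *m q1) 0 i *: mu_pair mu (row b1 ph) i) = Delta * Fval q0 q1 (lead2 y) x.
  transitivity (\sum_i ((x *m q0) 0 i * (Delta * (y 0 o0 * x 0 i)) + (x *m q1) 0 i * (Delta * (y 0 o1 * x 0 i)))).
    by apply: eq_bigr => i _; rewrite topDr !topZr T0 T1.
  rewrite /Fval /qform !lead2E !dotE sum3E; move: (x *m q0) (x *m q1) Delta => a b D; ring.
have -> : top T (\sum_i bcov q0 q1 (lead2 y) x 0 i *: mu_pair mu ka i) =
    Delta * (y 0 o2 * Fval q0 q1 (lead2 y) x).
  rewrite top_sumr; transitivity (\sum_i bcov q0 q1 (lead2 y) x 0 i * (Delta * (y 0 o2 * x 0 i))).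
    by apply: eq_bigr => i _; rewrite topZr T2.
  have <- : dot (bcov q0 q1 (lead2 y) x) x = Fval q0 q1 (lead2 y) x by rewrite dot_bcov.
  rewrite dotE sum3E; move: (bcov _ _ _ _) Delta => b D; ring.
have -> : top T (\sum_a \sum_i hcoef Q L (lead2 y) x a i *: mu_pair mu (row a ph) i) =
    Delta * (2%:R * peval Q (sg L (lead2 y) x)).
  rewrite -polar_diag // -hcoef_sum // top_sumr big_distrr; apply: eq_bigr => a _ /=.
  rewrite top_sumr big_distrr; apply: eq_bigr => i _ /=; rewrite topZr.
  by case: (ord2P a) => ->; [rewrite T0 (lead2E y).1|rewrite T1 (lead2E y).2]; move: (\det _) (hcoef _ _ _ _ _ _) => *; ring.
move: (Fval _ _ _ _) (peval _ _) Delta => F G D; ring.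
Qed.

Lemma w3_theta X (be ga : 'rV[K]_3) : w3 X (be *m th) (ga *m th) =
  \sum_j cross be ga 0 j *: w3 X (row (ordS j) th) (row (ordS (ordS j)) th).
Proof.
apply/ffunP => S; rewrite sum_ffunE.
under eq_bigr => i _ do rewrite extZ w3E.
rewrite w3E; case: ifP => _; last by rewrite big1 // => i _; rewrite mulr0.
move: th => t; rewrite sum3E !crossE !ordSE !mxE !sum3E; ring.
Qed.

Lemma segre_vectorE xi eta : segre_vector U V xi eta =
  \sum_i eta 0 i *: w3 (xi *m U) (row (ordS i) V) (row (ordS (ordS i)) V).
Proof.
rewrite /segre_vector wedge_sumr; apply: eq_bigr => i _.
by rewrite wedgeZr /bivector wedge_vec3r.
Qed.

(** Passing from the complement V to theta: the mu components of V only produce terms with two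
    factors in U. These terms still contain the vector xi *m U, as does [lead_elt], so the two wedge
    to zero. *)
Lemma segre_vector_split xi eta : exists D,
  [/\ segre_vector U V xi eta = lead_elt (xi *m Ga *m mu) (eta *m cofactors N2) + D, W2 D &
      forall y, top D (lead_elt (xi *m Ga *m mu) y) = 0].
Proof.
rewrite segre_vectorE; have -> : xi *m U = xi *m Ga *m mu by rewrite UE mulmxA.
set X := xi *m Ga *m mu.
pose n1 i := row i N1 *m mu; pose n2 i := row i N2 *m th.
pose D i := w3 X (n1 (ordS i)) (row (ordS (ordS i)) V) + w3 X (n2 (ordS i)) (n1 (ordS (ordS i))).
have VnE i : row i V = n1 i + n2 i by rewrite VE raddfD /= !row_mul.
exists (\sum_i eta 0 i *: D i); split.
- rewrite /lead_elt; have -> : \sum_j (eta *m cofactors N2) 0 j *: w3 X (row (ordS j) th) (row (ordS (ordS j)) th)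
     = \sum_i eta 0 i *: w3 X (n2 (ordS i)) (n2 (ordS (ordS i))).
    under eq_bigr => j _ do rewrite mxE scaler_suml.
    rewrite exchange_big; apply: eq_bigr => i _ /=; rewrite w3_theta scaler_sumr.
    by apply: eq_bigr => j _; rewrite scalerA mxE.
  rewrite -big_split; apply: eq_bigr => i _ /=; rewrite -scalerDr; congr (_ *: _).
  rewrite /D (VnE (ordS i)) w3Dm [RHS]addrCA; congr (_ + _).
  by rewrite VnE w3Dr addrC.
- apply: in_W2_sum => i; apply/in_W2Z/in_W2D; first exact: W2_mu.
  by rewrite -w3_cyc; exact: W2_mu.
move=> y; rewrite top_sum big1 // => i _; rewrite topZ /lead_elt top_sumr big1 ?mulr0 // => j _.
by rewrite topZr topD !top_w3 !det6_eq03 addr0 mulr0.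
Qed.

Lemma top_self xi eta : top (segre_vector U V xi eta) (segre_vector U V xi eta) = 0.
Proof.
rewrite segre_vectorE top_sum big1 // => i _; rewrite topZ top_sumr big1 ?mulr0 // => j _.
by rewrite topZr top_w3 det6_eq03 mulr0.
Qed.

Lemma top_lead_self X y y' : top (lead_elt X y) (lead_elt X y') = 0.
Proof.
rewrite top_sum big1 // => i _; rewrite topZ top_sumr big1 ?mulr0 // => j _.
by rewrite topZr top_w3 det6_eq03 mulr0.
Qed.

Lemma top_lead_plucker al y : top (lead_elt (al *m mu) y) (plucker U) = 0.
Proof.
rewrite top_sum big1 // => i _; rewrite topZ pluckerE UE !row_mul top_w3.
have thE m : row m th = 0 *m mu + (delta_mx 0 m : 'rV[K]_3) *m th by rewrite mul0mx add0r rowE.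
have zE : row o2 Ga *m mu = row o2 Ga *m mu + 0 *m th by rewrite mul0mx addr0.
by rewrite !thE zE det6_block [X in _ * X * _]tripE !mxE; ring.
Qed.

Definition VA_value (xi eta : 'rV[K]_3) : K :=
  2%:R * Delta * ((eta *m cofactors N2) 0 o2 *
      Fval q0 q1 (lead2 (eta *m cofactors N2)) (xi *m Ga)
    - peval Q (sg L (lead2 (eta *m cofactors N2)) (xi *m Ga))).

Lemma W2_second z : W2 z -> exists a2 d, z = a2 + d *: plucker U /\
  exists c : 'M[K]_3, a2 =
     \sum_(i < 3) \sum_(j < 3) c i j *: wedge (bivector U i) (ext_vec (row j V)).
Proof.
move=> [c [d ->]]; do 2 eexists; split; first by [].
exists c; apply: eq_bigr => i _; apply: eq_bigr => j _; by rewrite /bivector wedge_vec3.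
Qed.

Lemma second_component_exists xi eta :
  exists a2, second_component A U V (segre_vector U V xi eta) a2.
Proof.
have [D [segE WD topD0]] := segre_vector_split xi eta.
set x := xi *m Ga in segE topD0; set y := eta *m _ in segE.
have : W2 (rest_elt x y - D) by apply: in_W2D; [exact: W2_rest|exact: in_W2N].
case/W2_second => a2 [d [E a2E]]; exists a2; split=> //; exists d.
rewrite -addrA -E segE addrACA subrr addr0.
by rewrite -VA_elt_split VA_elt_mem.
Qed.

(** The given lift of a_1 and the explicit [VA_elt] differ by an element of A lying in W^2_u. Since
    a_1 is [VA_elt] minus an element of W^2_u, and both A and W^2_u are isotropic, this difference
    pairs to zero with a_1, so [rest_elt] computes the value. *)
Lemma top_second_component xi eta a2 :
  second_component A U V (segre_vector U V xi eta) a2 ->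
  top (segre_vector U V xi eta) a2 = VA_value xi eta.
Proof.
case=> -[c a2E] [d aA]; set a1 := segre_vector U V xi eta in aA *.
have [D [segE WD topD0]] := segre_vector_split xi eta; rewrite -/a1 in segE.
set x := xi *m Ga in segE topD0; set y := eta *m _ in segE.
have [_ isoA _] := lagA.
pose R := rest_elt x y - D.
have aE : VA_elt x y = a1 + R.
  by rewrite VA_elt_split segE /R addrACA subrr addr0.
have WR : W2 R by apply: in_W2D; [exact: W2_rest|exact: in_W2N].
have Wa2 : W2 a2.
  exists c, 0; rewrite scale0r addr0 a2E; apply: eq_bigr => i _; apply: eq_bigr => j _.
  by rewrite /bivector wedge_vec3.
have WP : W2 (plucker U).
  by exists 0, 1; rewrite scale1r big1 ?add0r // => i _; rewrite big1 // => j _; rewrite mxE scale0r.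
have top_neg z z' : top z (- z') = - top z z' by rewrite -scaleN1r topZr mulN1r.
have topA z z' : z \in A -> z' \in A -> top z z' = 0.
  by move=> zA z'A; rewrite topE isoA // ext0.
have a1P : top a1 (plucker U) = 0.
  by rewrite segE topD top_lead_plucker add0r W2_top.
have a1R : top a1 R = VA_value xi eta.
  have -> : top a1 R = top a1 (VA_elt x y) by rewrite aE topDr top_self add0r.
  rewrite segE topD VA_elt_split.
  rewrite (topDr (lead_elt _ _) (lead_elt _ _) (rest_elt _ _)) (topDr D (lead_elt _ _) (rest_elt _ _)).
  rewrite top_lead_self top_lead_rest topD0 (W2_top WD (W2_rest x y)).
  by rewrite add0r addr0 addr0.
have key : top a1 (a2 + d *: plucker U - R) = 0.
  have -> : a1 = VA_elt x y - R by rewrite aE addrK.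
  rewrite topB (W2_top WR) ?subr0; last first.
    by apply: in_W2D; [apply: in_W2D => //; exact: in_W2Z|exact: in_W2N].
  apply: topA; first exact: VA_elt_mem.
  have -> : a2 + d *: plucker U - R = (a1 + a2 + d *: plucker U) - VA_elt x y.
    have gen (z1 z2 z3 z4 : ext K) : z2 + z3 - z4 = (z1 + z2 + z3) - (z1 + z4).
      by rewrite opprD addrA -(addrA z1 z2) [z1 + _]addrC addrK.
    by rewrite aE; exact: gen.
  by rewrite rpredB ?VA_elt_mem.
by move: key; rewrite !topDr topZr a1P mulr0 addr0 top_neg a1R => /eqP; rewrite subr_eq0 => /eqP.
Qed.

Lemma wedge_second_component xi eta a2 :
  second_component A U V (segre_vector U V xi eta) a2 ->
  wedge (segre_vector U V xi eta) a2 = VA_value xi eta *: ext_basis K [set: 'I_6].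
Proof.
move=> h; rewrite -(top_second_component h); apply: wedge_supp3.
  by rewrite segre_vectorE; apply: supp3_sum => i; apply/supp3Z/supp3_w3.
case: h => -[c ->] _; apply: supp3_sum => i; apply: supp3_sum => j; apply: supp3Z.
by rewrite /bivector wedge_vec3; exact: supp3_w3.
Qed.

End VAValue.

(** * The image of q x p *)

Lemma bihomog_psubst (K : numFieldType) l m n (F : 'I_l -> {mpoly K[m + n]})
    (D E : 'I_l -> nat) (g : {mpoly K[l]}) d e :
  (forall i, bihomog (D i) (E i) (F i)) ->
  (forall mu, mu \in msupp g -> (\sum_i mu i * D i = d)%N /\ (\sum_i mu i * E i = e)%N) ->
  bihomog d e (psubst F g).
Proof.
move=> FDE gde; rewrite /psubst comp_mpolyE big_seq.
apply: (big_ind (bihomog d e)) => [||mu ms]; [exact: bihomog0|exact: bihomogD|].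
have [<- <-] := gde mu ms; apply: bihomogZ.
have pw i j : bihomog (j * D i) (j * E i) (F i ^+ j).
  elim: j => [|j IHj]; last by rewrite exprS !mulSn; apply: bihomogM.
  move=> nu; rewrite expr0 msupp1 inE => /eqP ->.
  by split; rewrite big1 // => ? _; rewrite mnm0E.
have : bihomog (\sum_(i < l) mu i * D i) (\sum_(i < l) mu i * E i) (\prod_(i < l) F i ^+ mu i).
  elim/big_rec3: _ => [|i x y z _ yz]; last exact: bihomogM.
  by move=> nu; rewrite msupp1 inE => /eqP ->; split; rewrite big1 // => ? _; rewrite mnm0E.
congr bihomog; apply: eq_bigr => i _; by rewrite tnth_mktuple.
Qed.

Section SegrePolynomials.
Variable K : numFieldType.
Variable L : 'M[K]_(2 * 3, 6).

Lemma peval_segre_map t x g :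
  peval (psubst (segre_map L) g) (row_mx t x) = peval g (sg L t x).
Proof.
rewrite peval_psubst; congr peval; apply/rowP => k; rewrite mxE /sg mxvec_mulE /segre_map.
rewrite peval_sum; apply: eq_bigr => i _; rewrite peval_sum; apply: eq_bigr => j _.
by rewrite !pevalE row_mxEl row_mxEr rank1E mulrC.
Qed.

Lemma row_mx_surj m n (v : 'rV[K]_(m + n)) : exists y x, v = row_mx y x.
Proof. by exists (lsubmx v), (rsubmx v); rewrite hsubmxK. Qed.

Lemma bihomog_segre_map k : bihomog 1 1 (segre_map L k).
Proof.
apply: bihomog_sum => i; apply: bihomog_sum => j; apply: bihomogZ.
exact: (bihomogM (@bihomogXl K 2 3 i) (@bihomogXr K 2 3 j)).
Qed.

Lemma bihomog_segre g d : g \is d.-homog -> bihomog d d (psubst (segre_map L) g).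
Proof.
move=> /dhomogP gd; apply: (@bihomog_psubst _ _ _ _ _ (fun=> 1%N) (fun=> 1%N)) => [k|mu ms].
  exact: bihomog_segre_map.
by have /= <- := gd mu ms; rewrite mdegE; split; apply: eq_bigr => i _; rewrite muln1.
Qed.

(** The parametrization of Y by cubics only provides multiples by cubes, f(l v) = l ^ 3 f(v); the
    component of degree d is therefore read off in degree 3 d. *)
Lemma peval_pihomog_cube n d (g : {mpoly K[n]}) (z : 'rV[K]_n) :
  (forall l, l != 0 -> peval g (l ^+ 3 *: z) = 0) -> peval (pihomog mdeg d g) z = 0.
Proof.
move=> gz; pose N := maxn (msize g) d.+1.
have gE : g = \sum_(j < N) pihomog mdeg j g by apply: pihomog_partitionE; exact: leq_maxl.
pose P := \sum_(j < N) peval (pihomog mdeg j g) z *: 'X^(3 * j) : {poly K}.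
have P0 : P = 0.
  apply: poly_eq0_eval => l l0; rewrite horner_sum -[RHS](gz l) // {2}gE peval_sum.
  apply: eq_bigr => j _; rewrite hornerZ hornerXn mulrC exprM.
  by rewrite (dhomog_pevalZ (d := j)) // pihomogP.
have dN : (d < N)%N by rewrite leq_max leqnn orbT.
have : P`_(3 * d) = peval (pihomog mdeg d g) z.
  rewrite coef_sum (bigD1 (Ordinal dN)) //= coefZ coefXn eqxx mulr1 big1 ?addr0 // => j jd.
  rewrite coefZ coefXn eqn_mul2l /= (_ : (d == j :> nat) = false) ?mulr0 //.
  by apply: contraNF jd => /eqP E; apply/eqP/val_inj; rewrite /= E.
by rewrite P0 coef0.
Qed.

End SegrePolynomials.

(** * The net of forms of bidegree (2, 2) and the equation of the image *)

Section NetJ.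
Variable K : numFieldType.
Variables (p : 'I_4 -> 'rV[K]_3) (f : 'I_6 -> {mpoly K[3]}) (Q : {mpoly K[6]}).
Variables (w : 'I_6 -> {mpoly K[6]}) (k : option 'I_4) (L : 'M[K]_(2 * 3, 6)) (q0 q1 : 'M[K]_3).
Variables (mu : 'M[K]_(3, 6)) (ph : 'M[K]_(2, 6)) (ka : 'rV[K]_6).
Hypothesis Q2 : Q \is 2.-homog.
Hypothesis hf : forall a, lcomb f a = 0 -> a = 0.
Hypothesis f3 : forall i, f i \is 3.-homog.
Hypothesis QY : ~ dP_ideal f Q.
Hypothesis hw : lin_basis (quadrics_through (curve_ideal f Q)) w.
Hypothesis ad : adapted p f k L q0 q1.
Hypothesis qr : quadric_rows Q w L q0 q1 mu ph ka.
Local Notation th := (theta ph ka).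

Lemma dP_ideal_pihomog d g : dP_ideal f g -> dP_ideal f (pihomog mdeg d g).
Proof.
move/dP_idealP => gf; apply/dP_idealP => v; apply: peval_pihomog_cube => l _.
rewrite -[RHS](gf (l *: v)); congr peval; apply/rowP => i; rewrite !mxE.
by rewrite (dhomog_pevalZ _ _ (f3 i)).
Qed.

Lemma pihomog2_mul (h : {mpoly K[6]}) : exists c, pihomog mdeg 2 (h * Q) = c%:MP * Q.
Proof.
have [c cE] := dhomog0_const (pihomogP mdeg 0 h); exists c.
have hE : h = \sum_(j < (msize h).+1) pihomog mdeg j h by apply: pihomog_partitionE.
rewrite {1}hE mulr_suml raddf_sum (bigD1 ord0) //= big1 ?addr0 => [|j j0].
  rewrite cE pihomog_dE // mul_mpolyC.
  exact: dhomogZ.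
apply: (pihomog_ne0 (d := (j + 2)%N)); last by apply: dhomogM => //; exact: pihomogP.
apply: contraNneq j0 => /eqP; rewrite -[X in _ == X]add0n eqn_add2r => /eqP j0.
by apply/eqP/val_inj.
Qed.

(** The ideal of Y is homogeneous, and the quadratic part of h Q is a constant times Q. *)
Lemma curve_ideal_pihomog g : curve_ideal f Q g -> curve_ideal f Q (pihomog mdeg 2 g).
Proof.
case=> h /(dP_ideal_pihomog 2); rewrite pihomogB.
by have [c ->] := pihomog2_mul h; exists c%:MP.
Qed.

Definition netJ (i : 'I_3) : {mpoly K[2 + 3]} := psubst (segre_map L) (lcomb w (row i th)).

Lemma lcomb_netJ c : lcomb netJ c = psubst (segre_map L) (lcomb w (c *m th)).
Proof.
rewrite lcomb_mul /psubst /lcomb raddf_sum; apply: eq_bigr => i _.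
by rewrite /netJ /= comp_mpolyZ.
Qed.

Lemma peval_netJ (t : 'rV[K]_2) x : \row_i peval (netJ i) (row_mx t x) =
  row3 (t 0 b0 * Fval q0 q1 t x) (t 0 b1 * Fval q0 q1 t x) (peval Q (sg L t x)).
Proof.
apply/rowP => i; rewrite mxE /netJ peval_segre_map /theta rowK.
by case: (ord3P i) => ->; rewrite row3E /= ?(phi_row_rank1 qr) ?(quadric_section qr).
Qed.

(** A form in the net may come from an inhomogeneous g, but its bidegree leaves only the quadratic
    part of g. The minors restrict to zero, so theta generates; independence holds because a quadric
    vanishing on the Segre threefold is a combination of minors. *)
Lemma netJ_basis : lin_basis (J22 (curve_ideal f Q) L) netJ.
Proof.
split=> [G|c].
  split=> [[G22 [g [gI GE]]]|[c ->]].
    have [a g2a] : exists a, pihomog mdeg 2 g = lcomb w a.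
      by apply/hw.1; split; [exact: pihomogP|exact: curve_ideal_pihomog].
    have [al [c aE]] := mu_theta_span hf QY ad qr a.
    exists c; apply: peval_inj => v; have [t [x ->]] := row_mx_surj v.
    rewrite lcomb_netJ peval_segre_map.
    have -> : peval (lcomb w (c *m th)) (sg L t x) = peval (lcomb w a) (sg L t x).
      by rewrite aE lcombD pevalD (minor_row_rank1 qr) add0r.
    rewrite -g2a; apply/esym/peval_pihomog => l _.
    rewrite -sgZl -peval_segre_map -GE -[x in LHS]scale1r (bihomog_eval _ _ _ _ G22).
    by rewrite expr1n mulr1.
  rewrite lcomb_netJ; split; first exact/bihomog_segre/(wq_homog hw).
  by exists (lcomb w (c *m th)); split=> //; have [] := wq_through hw (c *m th).
rewrite lcomb_netJ => c0.
have [|al alE] := quadric_on_rank1 (L := L) (wq_homog hw (c *m th)).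
  by move=> t x; rewrite -peval_segre_map c0 peval0.
have E : c *m th = al *m mu.
  apply: (lcomb_w_inj hw); apply: peval_inj => v.
  by rewrite -(coordsK (adapted_free ad) v) alE (minor_rowE qr).
have := mu_theta_unit hf QY ad qr; rewrite -row_free_unit => rf.
have /(row_free_inj rf) : row_mx (- al) c *m (col_mx mu th : 'M_6) = 0 *m (col_mx mu th : 'M_6).
  by rewrite (mul_row_col (n1 := 3)) mulNmx E addNr mul0mx.
by move/(congr1 (fun r : 'rV_(3 + 3) => rsubmx r)); rewrite row_mxKr linear0.
Qed.

Definition Gpoly : {mpoly K[3 + 3]} :=
  psubst (fun l => \sum_(i < 2) \sum_(j < 3) L (mxvec_index i j) l *:
    ('X_(lshift 3 (if i == b0 then o0 else o1)) * 'X_(rshift 3 j))) Q.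

Lemma peval_Gpoly y x : peval Gpoly (row_mx y x) = peval Q (sg L (lead2 y) x).
Proof.
rewrite peval_psubst; congr peval; apply/rowP => l; rewrite mxE /sg mxvec_mulE.
rewrite peval_sum; apply: eq_bigr => i _; rewrite peval_sum; apply: eq_bigr => j _.
rewrite !pevalE row_mxEl row_mxEr rank1E mulrC; congr (_ * _ * _).
by rewrite mxE; case: ifP.
Qed.

Definition image_poly : {mpoly K[3 + 3]} := 'X_(lshift 3 o2) * Fpoly q0 q1 - Gpoly.

Lemma peval_image_poly y x : peval image_poly (row_mx y x) =
  y 0 o2 * Fval q0 q1 (lead2 y) x - peval Q (sg L (lead2 y) x).
Proof. by rewrite /image_poly !pevalE peval_Fpoly peval_Gpoly row_mxEl. Qed.

Lemma bihomog_Fpoly : bihomog 1 2 (Fpoly q0 q1).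
Proof.
apply: bihomog_sum => i; apply: bihomog_sum => j; apply: bihomogD; apply: bihomogZ.
  exact: (bihomogM (@bihomogXl K 3 3 o0)
    (bihomogM (@bihomogXr K 3 3 i) (@bihomogXr K 3 3 j))).
exact: (bihomogM (@bihomogXl K 3 3 o1)
    (bihomogM (@bihomogXr K 3 3 i) (@bihomogXr K 3 3 j))).
Qed.

Lemma bihomog_image_poly : bihomog 2 2 image_poly.
Proof.
apply: bihomogD.
  exact: (bihomogM (@bihomogXl K 3 3 o2) bihomog_Fpoly).
rewrite -scaleN1r; apply: bihomogZ.
apply: (@bihomog_psubst _ _ _ _ _ (fun=> 1%N) (fun=> 1%N)) => [l|nu ms].
  apply: bihomog_sum => i; apply: bihomog_sum => j; apply: bihomogZ.
  exact: (bihomogM (@bihomogXl K 3 3 _) (@bihomogXr K 3 3 j)).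
have /dhomogP/(_ nu ms)/= md := Q2.
by split; apply: etrans md; rewrite mdegE; apply: eq_bigr => i _; rewrite muln1.
Qed.

Lemma Fpoly_neq0 : Fpoly q0 q1 != 0.
Proof.
apply/eqP => F0; apply: (Fval_not0 hf ad) => t x.
have := peval_Fpoly q0 q1 (row3 (t 0 b0) (t 0 b1) 0) x; rewrite F0 peval0 => ->.
by rewrite /Fval !lead2E !row3E.
Qed.

Lemma lead2_cone a y2 x :
  lead2 (row3 (a * qform q1 x x) (- (a * qform q0 x x)) y2) = a *: zpt q0 q1 x.
Proof.
apply/rowP => i; rewrite [LHS]mxE [RHS]mxE; case: (ord2P i) => -> /=.
  by rewrite row3E zptE.
by rewrite row3E zptE mulrN.
Qed.

(** A parametrization of the hypersurface F = 0 in (y, x) by (s, x): (y_0, y_1) is s_0 times the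
    root [zpt x] of F, and y_2 = s_1 is free. *)
Definition cone_param (i : 'I_(3 + 3)) : {mpoly K[2 + 3]} :=
  match split i with
  | inl j => row3 ('X_(lshift 3 b0) * \sum_i \sum_j q1 i j *: ('X_(rshift 2 i) * 'X_(rshift 2 j)))
     (- ('X_(lshift 3 b0) * \sum_i \sum_j q0 i j *: ('X_(rshift 2 i) * 'X_(rshift 2 j))))
     'X_(lshift 3 b1) 0 j
  | inr j => 'X_(rshift 2 j)
  end.

Lemma split_rowE m n l (G : 'I_m -> {mpoly K[l]}) (H : 'I_n -> {mpoly K[l]}) v :
  \row_(i < m + n) peval (match split i with inl j => G j | inr j => H j end) v =
  row_mx (\row_j peval (G j) v) (\row_j peval (H j) v).
Proof.
apply/rowP => i; rewrite mxE -(splitK i); case: (split i) => j; rewrite unsplitK /=.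
  by rewrite row_mxEl mxE.
by rewrite row_mxEr mxE.
Qed.

Lemma peval_cone_param g (s : 'rV[K]_2) x : peval (psubst cone_param g) (row_mx s x) =
  peval g (row_mx (row3 (s 0 b0 * qform q1 x x) (- (s 0 b0 * qform q0 x x)) (s 0 b1)) x).
Proof.
rewrite peval_psubst split_rowE; congr (peval g (row_mx _ _)); apply/rowP => i; last first.
  by rewrite mxE pevalX row_mxEr.
have qE (q : 'M[K]_3) : \sum_i \sum_j q i j * (x 0 i * x 0 j) = qform q x x.
  by rewrite /qform dotE !mxE !sum3E; ring.
rewrite mxE; case: (ord3P i) => ->; rewrite !row3E !pevalE !row_mxEl //.
  rewrite peval_sum -qE; congr (_ * _); apply: eq_bigr => i' _.
  by rewrite peval_sum; apply: eq_bigr => j _; rewrite !pevalE !row_mxEr.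
rewrite peval_sum -qE; congr (- (_ * _)); apply: eq_bigr => i' _.
by rewrite peval_sum; apply: eq_bigr => j _; rewrite !pevalE !row_mxEr.
Qed.

(* On the hypersurface [F = 0] the relation [F h = l (y2 F - G)] forces [l G = 0], and [G] is
   not identically zero there since [Q] does not contain [Y]; hence [F] divides [l]. *)
Lemma image_poly_cancel h : divides image_poly (Fpoly q0 q1 * h) -> divides image_poly h.
Proof.
case=> l lE.
have param0 : psubst cone_param l = 0.
  apply: (mpoly_mul_eq0_eval (p := psubst cone_param Gpoly)).
    move=> v; have [s [x ->]] := row_mx_surj v; rewrite !peval_cone_param; set y := row3 _ _ _.
    move=> G0; apply: (mulIf G0); rewrite mul0r.
    have := congr1 (fun g => peval g (row_mx y x)) lE.
    rewrite !pevalM /image_poly !pevalB !pevalM peval_Fpoly.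
    have -> : Fval q0 q1 (lead2 y) x = 0 by rewrite /Fval !lead2E !row3E; ring.
    by rewrite mul0r mulr0 sub0r mulrN => /esym/eqP; rewrite oppr_eq0 => /eqP.
  apply/eqP => G0; apply: QY; apply: (adapted_dP_inv ad) => a x.
  have := peval_cone_param Gpoly (const_mx a) x; rewrite G0 peval0 peval_Gpoly lead2_cone.
  by rewrite mxE => <-.
have [m mE] : divides (Fpoly q0 q1) l.
  apply: (adapted_divides ad) => a y2 x.
  have := peval_cone_param l (\row_i (if i == b0 then a else y2)) x.
  by rewrite param0 peval0 !mxE /=.
exists m; apply: (mulfI Fpoly_neq0); rewrite lE mE; ring.
Qed.

Lemma image_poly_divides (h : {mpoly K[3 + 3]}) d :
  (forall c (y x : 'rV[K]_3), peval h (row_mx (c *: y) x) = c ^+ d * peval h (row_mx y x)) ->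
  (forall (t : 'rV[K]_2) x, peval h (row_mx (row3 (t 0 b0 * Fval q0 q1 t x) (t 0 b1 * Fval q0 q1 t x)
                (peval Q (sg L t x))) x) = 0) -> divides image_poly h.
Proof.
move=> hd h0; set F := Fpoly q0 q1.
have : divides image_poly (F ^+ d * h).
  (* The two substitutions differ only in the value of y_2, namely F y_2 against G, and this
     difference is [image_poly]. *)
  pose rho1 (i : 'I_(3 + 3)) : {mpoly K[3 + 3]} :=
    match split i with inl j => F * 'X_(lshift 3 j) | inr j => 'X_(rshift 3 j) end.
  pose rho2 (i : 'I_(3 + 3)) : {mpoly K[3 + 3]} :=
    match split i with
    | inl j => row3 (F * 'X_(lshift 3 o0)) (F * 'X_(lshift 3 o1)) Gpoly 0 j
    | inr j => 'X_(rshift 3 j) end.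
  have -> : F ^+ d * h = psubst rho1 h - psubst rho2 h.
    apply: peval_inj => v; have [y [x ->]] := row_mx_surj v.
    have E2 : peval (psubst rho2 h) (row_mx y x) = 0.
      rewrite peval_psubst split_rowE -[RHS](h0 (lead2 y) x).
      congr (peval h (row_mx _ _)); apply/rowP => i; rewrite mxE.
        by case: (ord3P i) => ->; rewrite !row3E ?pevalE ?peval_Gpoly ?peval_Fpoly ?row_mxEl ?lead2E 1?mulrC.
      by rewrite pevalX row_mxEr.
    rewrite pevalB E2 subr0 pevalM pevalXn peval_psubst split_rowE -hd.
    congr (peval h (row_mx _ _)); apply/rowP => i; rewrite !mxE ?pevalE ?row_mxEl ?row_mxEr //.
  apply: divides_psubst => i; rewrite /rho1 /rho2; case: (split i) => j; last by exists 0; rewrite subrr mul0r.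
  case: (ord3P j) => ->; rewrite row3E; try by exists 0; rewrite subrr mul0r.
  by exists 1; rewrite mul1r mulrC.
elim: d {hd} => [|d IHd]; first by rewrite expr0 mul1r.
by rewrite exprS -mulrA => /image_poly_cancel.
Qed.

End NetJ.

Section Identification.
Variable K : numFieldType.

Lemma row_identification (a b : 'M[K]_3) (y x : 'rV[K]_3) :
  \row_i peval (identification true a b i) (row_mx y x) = row_mx (x *m a) (y *m b).
Proof.
rewrite split_rowE; congr row_mx; apply/rowP => j; rewrite !mxE peval_sum;
  by apply: eq_bigr => i _; rewrite !pevalE ?row_mxEl ?row_mxEr mulrC.
Qed.

Lemma bihomog_identification (a b : 'M[K]_3) d e (g : {mpoly K[3 + 3]}) :
  bihomog d e g -> bihomog e d (psubst (identification true a b) g).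
Proof.
move=> gd; pose D (i : 'I_(3 + 3)) := if split i is inl _ then 0%N else 1%N.
pose E (i : 'I_(3 + 3)) := if split i is inl _ then 1%N else 0%N.
have DE j : (D (lshift 3 j) = 0%N) * (E (lshift 3 j) = 1%N).
  by rewrite /D /E -[lshift 3 j]/(unsplit (inl j)) unsplitK.
have DE' j : (D (rshift 3 j) = 1%N) * (E (rshift 3 j) = 0%N).
  by rewrite /D /E -[rshift 3 j]/(unsplit (inr j)) unsplitK.
apply: (@bihomog_psubst _ _ _ _ _ D E) => [i|mu ms].
  rewrite /D /E /identification; case: (split i) => j; apply: bihomog_sum => l; apply: bihomogZ.
    exact: (@bihomogXr K 3 3 l).
  exact: (@bihomogXl K 3 3 l).
have [<- <-] := gd mu ms; split; rewrite big_split_ord /=.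
  rewrite big1 ?add0n => [|j _]; last by rewrite DE muln0.
  by apply: eq_bigr => j _; rewrite DE' muln1.
rewrite [X in (_ + X)%N]big1 ?addn0 => [|j _]; last by rewrite DE' muln0.
by apply: eq_bigr => j _; rewrite DE muln1.
Qed.

Lemma row_q_times_p (b : 'I_3 -> {mpoly K[2 + 3]}) t x :
  \row_i peval (q_times_p b i) (row_mx t x) = row_mx (\row_j peval (b j) (row_mx t x)) x.
Proof.
rewrite split_rowE; congr row_mx; apply/rowP => j.
by rewrite mxE pevalX row_mxEr.
Qed.

Lemma mpolyX_neq0 n (i : 'I_n) : ('X_i : {mpoly K[n]}) != 0.
Proof.
apply/eqP => X0; have := pevalX i (const_mx 1 : 'rV[K]_n); rewrite X0 peval0 mxE => /eqP.
by rewrite eq_sym oner_eq0.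
Qed.

End Identification.

(** * Birationality and image for an arbitrary basis of the net *)

Section Adapted.
Variable K : numFieldType.
Variables (p : 'I_4 -> 'rV[K]_3) (f : 'I_6 -> {mpoly K[3]}) (Q : {mpoly K[6]}).
Variables (w : 'I_6 -> {mpoly K[6]}).
Hypothesis hf : lin_basis (cubics_through p) f.
Hypothesis Q2 : Q \is 2.-homog.
Hypothesis QY : ~ dP_ideal f Q.
Hypothesis hw : lin_basis (quadrics_through (curve_ideal f Q)) w.
Variable P : option 'I_4 -> 'M[K]_(3, 6).
Hypothesis hP : forall k, net_basis w (segre_net p f k) (P k).
Variable A : {vspace ext K}.
Hypothesis hFC : FC_eq_section P (curve_ideal f Q) w A.
Hypothesis hA : morin_configuration A.
Variables (u : option 'I_4) (V : 'M[K]_(3, 6)).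
Hypothesis hV : row_free (col_mx (P u) V).
Hypothesis adE : forall k, exists L q0 q1, adapted p f k L q0 q1.
Variables (L : 'M[K]_(2 * 3, 6)) (q0 q1 : 'M[K]_3).
Hypothesis ad : adapted p f u L q0 q1.

Lemma basis_inj a : lcomb f a = 0 -> a = 0.
Proof. exact: hf.2. Qed.

Lemma basis_cubic i : f i \is 3.-homog.
Proof.
have [] : cubics_through p (f i); last by [].
apply/hf.1; exists (delta_mx 0 i); rewrite /lcomb (bigD1 i) //= mxE !eqxx scale1r big1 ?addr0 //.
by move=> j ji; rewrite mxE (negPf ji) andbF scale0r.
Qed.

Lemma segre_ideal_sub g : psubst (segre_map L) g = 0 -> curve_ideal f Q g.
Proof.
move=> g0; apply/dP_ideal_curve/dP_idealP => v.
by have [t [x [-> _]]] := adapted_point ad v; rewrite -peval_segre_map g0 peval0.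
Qed.

Variables (mu : 'M[K]_(3, 6)) (ph : 'M[K]_(2, 6)) (ka : 'rV[K]_6).
Hypothesis qr : quadric_rows Q w L q0 q1 mu ph ka.
Local Notation B := (netJ w L ph ka).
Local Notation S0 := (image_poly Q L q0 q1).

Lemma VA_equation_exists : exists s (C Ga : 'M[K]_3) (D : K),
  [/\ VA_equation A (P u) V s, D != 0, C \in unitmx, Ga \in unitmx &
      s = D *: psubst (identification true C Ga) S0].
Proof.
have [Ga Gu UE] := net_mu hw ad qr (hP u) hV.
have [N1 [N2 [N2u VE]]] := complement_theta basis_inj QY ad qr hV Gu UE.
pose Delta := \det (col_mx mu (theta ph ka) : 'M_6).
have Dn0 : 2%:R * Delta != 0.
  rewrite mulf_eq0 negb_or pnatr_eq0 /= /Delta -unitfE -unitmxE.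
  exact: (mu_theta_unit basis_inj QY ad qr).
have hP' j : exists k' L' q0' q1', adapted p f k' L' q0' q1' /\ net_basis w (segre_net p f k') (P j).
  by have [L' [q0' [q1' a']]] := adE j; exists j, L', q0', q1'.
have piA := pi_elt_mem basis_inj QY hw ad qr hFC hA hP'.
have alA := al_elt_mem Q2 basis_inj QY hw ad qr hFC hA hP'.
have [lagA _] := hA.
exists ((2%:R * Delta) *: psubst (identification true (cofactors N2) Ga) S0), (cofactors N2), Ga, (2%:R * Delta).
split=> //; last exact: cofactors_unit.
split.
  by apply: bihomogZ; apply: bihomog_identification; exact: bihomog_image_poly.
move=> xi eta; split; first exact: (second_component_exists basis_inj QY ad qr Gu UE VE N2u piA alA).
move=> a2 /(wedge_second_component Q2 basis_inj QY ad qr Gu UE VE N2u lagA piA alA) ->.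
by rewrite pevalZ peval_psubst row_identification peval_image_poly.
Qed.

Variable b : 'I_3 -> {mpoly K[2 + 3]}.
Hypothesis hb : lin_basis (J22 (curve_ideal f Q) L) b.

Lemma netJ_change : exists2 T : 'M[K]_3, T \in unitmx &
  forall v, \row_i peval (B i) v = (\row_j peval (b j) v) *m T^T.
Proof.
have hB := netJ_basis Q2 basis_inj basis_cubic QY hw ad qr.
have [T TE] : exists T : 'M[K]_3, forall i, B i = lcomb b (row i T).
  apply: (row_choice (P := fun i r => B i = lcomb b r)) => i.
  apply/hb.1/hB.1; exists (delta_mx 0 i); rewrite /lcomb (bigD1 i) //= mxE !eqxx scale1r big1 ?addr0 //.
  by move=> j ji; rewrite mxE (negPf ji) andbF scale0r.
exists T.
  rewrite -row_free_unit; apply: inj_row_free => c cT; apply: hB.2.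
  have -> : lcomb B c = lcomb b (c *m T).
    by rewrite lcomb_mul; apply: eq_bigr => i _; rewrite TE.
  by rewrite cT lcomb0.
move=> v; apply/rowP => i; rewrite mxE TE peval_lcomb [RHS]mxE.
by apply: eq_bigr => j _; rewrite !mxE mulrC.
Qed.

Lemma birational_q_times_p : birational_onto_image (q_times_p b).
Proof.
have [T Tu BE] := netJ_change.
(* T turns the given basis into [netJ], whose first two members are t_0 F and t_1 F. *)
pose psi (i : 'I_2) : {mpoly K[3 + 3]} :=
  \sum_j T (if i == b0 then o0 else o1) j *: 'X_(lshift 3 j).
pose chi (i : 'I_3) : {mpoly K[3 + 3]} := 'X_(rshift 3 i).
have psiE i t x : peval (psubst (q_times_p b) (psi i)) (row_mx t x) = t 0 i * Fval q0 q1 t x.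
  rewrite peval_psubst row_q_times_p /psi peval_sum.
  transitivity ((\row_i peval (B i) (row_mx t x)) 0 (if i == b0 then o0 else o1)).
    by rewrite BE [RHS]mxE; apply: eq_bigr => j _; rewrite !pevalE row_mxEl !mxE mulrC.
  by rewrite (peval_netJ qr); case: (ord2P i) => ->; rewrite row3E.
have chiE i : psubst (q_times_p b) (chi i) = 'X_(rshift 2 i).
  apply: peval_inj => v; have [t [x ->]] := row_mx_surj v.
  by rewrite peval_psubst row_q_times_p !pevalX !row_mxEr.
exists psi, chi; split.
- exists 1%N, 0%N => i; apply: bihomog_sum => j; apply: bihomogZ; exact: (@bihomogXl K 3 3 j).
- exists 0%N, 1%N => i; exact: (@bihomogXr K 3 3 i).
- split; last 1 first.
  + move=> i j; apply: peval_inj => v; have [t [x ->]] := row_mx_surj v.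
    by rewrite !pevalM !psiE !pevalX !row_mxEl; ring.
  + case: (eqVneq (psubst (q_times_p b) (psi b0)) 0) => [E0|]; last by exists b0.
    exists b1; apply/eqP => E1; apply: (Fval_not0 basis_inj ad) => t x.
    have F0 (s : 'rV[K]_2) : s 0 b0 * Fval q0 q1 s x = 0 by rewrite -psiE E0 peval0.
    have F1 (s : 'rV[K]_2) : s 0 b1 * Fval q0 q1 s x = 0 by rewrite -psiE E1 peval0.
    have [t0|t0] := eqVneq (t 0 b0) 0; last first.
      by have /eqP := F0 t; rewrite mulf_eq0 (negPf t0) => /eqP.
    have [t1|t1] := eqVneq (t 0 b1) 0; last first.
      by have /eqP := F1 t; rewrite mulf_eq0 (negPf t1) => /eqP.
    by rewrite /Fval t0 t1 !mul0r addr0.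
  by exists b0; exact: mpolyX_neq0.
split; last 1 first.
- by move=> i j; rewrite !chiE mulrC.
- by exists o0; rewrite chiE; exact: mpolyX_neq0.
by exists o0; exact: mpolyX_neq0.
Qed.

Lemma image_q_times_p (C Ga : 'M[K]_3) (D : K) (s : {mpoly K[3 + 3]}) :
  D != 0 -> C \in unitmx -> Ga \in unitmx -> s = D *: psubst (identification true C Ga) S0 ->
  exists al be : 'M[K]_3, [/\ al \in unitmx, be \in unitmx &
    image_is_hypersurface (q_times_p b) (psubst (identification true al be) s)].
Proof.
move=> D0 Cu Gu sE; have [T Tu BE] := netJ_change.
have Tu' : T^T \in unitmx by rewrite unitmx_tr.
(* Chosen so that the composite of the two identifications is the identity on x and the change of
   basis to [netJ] on y. *)
exists (invmx Ga), (T^T *m invmx C); split; rewrite ?unitmx_inv ?unitmx_mul ?Tu' ?unitmx_inv //.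
set s' := psubst _ s.
have s'E y x : peval s' (row_mx y x) = D * peval S0 (row_mx (y *m T^T) x).
  rewrite /s' peval_psubst row_identification sE pevalZ peval_psubst row_identification.
  by rewrite !mulmxA !mulmxKV.
have S0B t x : peval S0 (row_mx (\row_i peval (B i) (row_mx t x)) x) = 0.
  rewrite (peval_netJ qr); set y := row3 _ _ _.
  have yE : lead2 y = Fval q0 q1 t x *: t.
    apply/rowP => i; case: (ord2P i) => ->; rewrite ?(lead2E y).1 ?(lead2E y).2 row3E mxE mulrC //.
  rewrite peval_image_poly yE sgZl (dhomog_pevalZ _ _ Q2) row3E /Fval !mxE; ring.
move=> d e h hde; split=> [h0|[k hk]]; last first.
  apply: peval_inj => v; have [t [x ->]] := row_mx_surj v.
  rewrite peval_psubst row_q_times_p hk pevalM s'E -BE S0B peval0; ring.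
pose rho (i : 'I_(3 + 3)) : {mpoly K[3 + 3]} := match split i with
  | inl j => \sum_l invmx T^T l j *: 'X_(lshift 3 l) | inr j => 'X_(rshift 3 j) end.
pose tau (i : 'I_(3 + 3)) : {mpoly K[3 + 3]} := match split i with
  | inl j => \sum_l T^T l j *: 'X_(lshift 3 l) | inr j => 'X_(rshift 3 j) end.
have subE (M : 'M[K]_3) g y x : peval (psubst (fun i : 'I_(3 + 3) => match split i with
  | inl j => \sum_l M l j *: 'X_(lshift 3 l) | inr j => 'X_(rshift 3 j) end) g) (row_mx y x) =
  peval g (row_mx (y *m M) x).
  rewrite peval_psubst split_rowE; congr (peval g (row_mx _ _)); apply/rowP => j.
    by rewrite !mxE peval_sum; apply: eq_bigr => l _; rewrite !pevalE row_mxEl mulrC.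
  by rewrite mxE pevalX row_mxEr.
have [] := image_poly_divides basis_inj QY ad (h := psubst rho h) (d := d).
- move=> c y x; rewrite !subE -scalemxAl -{1}[x]scale1r (bihomog_eval _ _ _ _ hde).
  by rewrite expr1n mulr1.
- move=> t x; rewrite subE -(peval_netJ qr) BE mulmxK // -row_q_times_p -peval_psubst h0.
  exact: peval0.
move=> k kE; exists (D^-1 *: psubst tau k).
apply: peval_inj => v; have [y [x ->]] := row_mx_surj v.
rewrite pevalM pevalZ subE s'E.
have := congr1 (fun g => peval g (row_mx (y *m T^T) x)) kE.
rewrite subE mulmxK // pevalM => ->.
by rewrite mulrACA mulVf // mul1r.
Qed.

End Adapted.

Lemma theorem_adapted (K : numFieldType) (p : 'I_4 -> 'rV[K]_3) (f : 'I_6 -> {mpoly K[3]})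
    (hf : lin_basis (cubics_through p) f) (Q : {mpoly K[6]}) (Q2 : Q \is 2.-homog)
    (QY : ~ dP_ideal f Q) (w : 'I_6 -> {mpoly K[6]})
    (hw : lin_basis (quadrics_through (curve_ideal f Q)) w)
    (P : option 'I_4 -> 'M[K]_(3, 6)) (hP : forall k, net_basis w (segre_net p f k) (P k))
    (A : {vspace ext K}) (hFC : FC_eq_section P (curve_ideal f Q) w A)
    (hA : morin_configuration A) (u : option 'I_4) (V : 'M[K]_(3, 6))
    (hV : row_free (col_mx (P u) V))
    (adE : forall k, exists L q0 q1, adapted p f k L q0 q1) (L : 'M[K]_(2 * 3, 6)) :
  (exists q0 q1, adapted p f u L q0 q1) ->
  (forall g, psubst (segre_map L) g = 0 -> curve_ideal f Q g) /\
  (exists b : 'I_3 -> {mpoly K[2 + 3]}, lin_basis (J22 (curve_ideal f Q) L) b) /\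
  forall b : 'I_3 -> {mpoly K[2 + 3]}, lin_basis (J22 (curve_ideal f Q) L) b ->
    birational_onto_image (q_times_p b) /\
    exists s, VA_equation A (P u) V s /\
      exists (swap : bool) (al be : 'M[K]_3),
        [/\ al \in unitmx, be \in unitmx &
            image_is_hypersurface (q_times_p b) (psubst (identification swap al be) s)].
Proof.
case=> q0 [q1 ad]; split; first exact: segre_ideal_sub ad.
have [mu [ph [ka qr]]] := quadric_rows_exist Q2 hw ad.
split.
  exists (netJ w L ph ka).
  exact: (netJ_basis Q2 (basis_inj hf) (basis_cubic hf) QY hw ad qr).
move=> b hb; split; first exact: (birational_q_times_p hf Q2 QY hw ad qr hb).
have [s [C [Ga [D [VAs D0 Cu Gu sE]]]]] := VA_equation_exists hf Q2 QY hw hP hFC hA hV adE ad qr.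
(* The first factor of the target of q x p carries the coordinates y of P_u^perp and the second
   those of P_u, so the factors are exchanged. *)
exists s; split=> //; exists true.
exact: (image_q_times_p hf Q2 QY hw ad qr hb D0 Cu Gu sE).
Qed.

(** * Standard coordinates *)

Section StandardCubic.
Variable K : numFieldType.
Local Notation X i := ('X_(i) : {mpoly K[3 + 3]}).
Local Notation yv j := ('X_(lshift 3 j) : {mpoly K[3 + 3]}).
Local Notation xv j := ('X_(rshift 3 j) : {mpoly K[3 + 3]}).

(** The pair for which F is 2 (t_0 x_0 (x_1 - x_2) - t_1 x_1 (x_0 - x_2)): the graph of the pencil
    of conics through the coordinate points and (1 : 1 : 1). The factor 2 comes from integral
    symmetric matrices. *)
Definition q0std : 'M[K]_3 :=
  \matrix_(i, j) l3 (l3 0 1 (-1) j) (l3 1 0 0 j) (l3 (-1) 0 0 j) i.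
Definition q1std : 'M[K]_3 :=
  \matrix_(i, j) l3 (l3 0 (-1) 0 j) (l3 (-1) 0 1 j) (l3 0 1 0 j) i.

Lemma q0std_sym : q0std^T = q0std.
Proof. by apply/matrixP => i j; rewrite !mxE; case: (ord3P i) => ->; case: (ord3P j) => ->. Qed.
Lemma q1std_sym : q1std^T = q1std.
Proof. by apply/matrixP => i j; rewrite !mxE; case: (ord3P i) => ->; case: (ord3P j) => ->. Qed.

Lemma qform_q0std x : qform q0std x x = 2%:R * (x 0 o0 * (x 0 o1 - x 0 o2)).
Proof. rewrite /qform dotE !mxE !sum3E !mxE /l3 /=; ring. Qed.
Lemma qform_q1std x : qform q1std x x = - (2%:R * (x 0 o1 * (x 0 o0 - x 0 o2))).
Proof. rewrite /qform dotE !mxE !sum3E !mxE /l3 /=; ring. Qed.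

Lemma zpt_std x : zpt q0std q1std x =
  (- 2%:R) *: \row_i (if i == b0 then x 0 o1 * (x 0 o0 - x 0 o2) else x 0 o0 * (x 0 o1 - x 0 o2)).
Proof.
by apply/rowP => i; rewrite !mxE; case: (ord2P i) => -> /=;
  rewrite ?qform_q0std ?qform_q1std; ring.
Qed.

(** pi is a retraction onto the hypersurface l = 0: its kernel is the ideal of l, and its target is
    a domain, so l is prime. Since F is not a multiple of l, the cofactor of F must absorb l. *)
Lemma divides_cancel n (F l H : {mpoly K[n]}) (pi : 'I_n -> {mpoly K[n]}) :
  (forall i, divides l ('X_i - pi i)) -> psubst pi l = 0 -> l != 0 -> psubst pi F != 0 ->
  divides F (l * H) -> divides F H.
Proof.
move=> pil l0 ln0 F0 [k kE].
have /eqP : psubst pi k * psubst pi F = 0 by rewrite -psubstM -kE psubstM l0 mul0r.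
rewrite mulf_eq0 (negPf F0) orbF => /eqP k0.
have [|m mE] := @divides_psubst K n n l (fun i => 'X_i) pi k.
  exact: pil.
have kid : psubst (fun i => 'X_i) k = k.
  apply: peval_inj => v; rewrite peval_psubst; congr peval.
  by apply/rowP => i; rewrite mxE pevalX.
rewrite kid k0 subr0 in mE.
by exists m; apply: (mulfI ln0); rewrite kE mE; ring.
Qed.

Lemma Fval_std (t : 'rV[K]_2) x : Fval q0std q1std t x =
  2%:R * (t 0 b0 * (x 0 o0 * (x 0 o1 - x 0 o2)) - t 0 b1 * (x 0 o1 * (x 0 o0 - x 0 o2))).
Proof. by rewrite /Fval qform_q0std qform_q1std; ring. Qed.

(** Pseudo-division by F, which is linear in y_1 with leading coefficient a multiple of l = x_1 (x_0
    - x_2): some l ^ N H is congruent modulo F to a polynomial free of y_1. That remainder vanishes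
    where l does not, hence is zero, and the two prime factors of l are cancelled one at a time. *)
Lemma std_divides (H : {mpoly K[3 + 3]}) :
  (forall a y2 x, peval H (row_mx (row3 (a * qform q1std x x) (- (a * qform q0std x x)) y2) x) = 0) ->
  divides (Fpoly q0std q1std) H.
Proof.
move=> H0; set F := Fpoly _ _.
pose l1 := xv o1; pose l2 := xv o0 - xv o2; pose l := l1 * l2.
pose sg1 (i : 'I_(3 + 3)) := if i == lshift 3 o1 then 0 else X i.
have sg1E g y x : peval (psubst sg1 g) (row_mx y x) = peval g (row_mx (row3 (y 0 o0) 0 (y 0 o2)) x).
  rewrite peval_psubst; congr peval; apply/rowP => i; rewrite mxE /sg1.
  case: (split_ordP i) => j -> /=.
    rewrite row_mxEl (inj_eq (@lshift_inj _ _)).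
    by case: (ord3P j) => -> /=; rewrite ?pevalX ?peval0 ?row_mxEl row3E.
  by rewrite pevalX !row_mxEr.
have FE y x : peval F (row_mx y x) = Fval q0std q1std (lead2 y) x by rewrite /F peval_Fpoly.
have lE y x : peval l (row_mx y x) = x 0 o1 * (x 0 o0 - x 0 o2).
  by rewrite /l /l1 /l2 !pevalE !row_mxEr.
have sgl n : psubst sg1 (l ^+ n) = l ^+ n.
  apply: peval_inj => v; have [y [x ->]] := row_mx_surj v.
  by rewrite sg1E (pevalXn l) lE (pevalXn l) lE.
have red g : exists N R, divides F (l ^+ N * g - psubst sg1 R).
  elim/mpoly_ring_ind: g => [c|i|g h [N [R gR]] [N' [R' hR]]|g h [N [R gR]] [N' [R' hR]]].
  - by exists 0%N, c%:MP; exists 0; rewrite psubstC expr0 mul1r subrr mul0r.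
  - have [->|i1] := eqVneq i (lshift 3 o1); last first.
      by exists 0%N, (X i); exists 0; rewrite psubstX /sg1 (negPf i1) expr0 mul1r subrr mul0r.
    (* The constant -1/2 comes from F = 2 (y_0 x_0 (x_1 - x_2) - y_1 l). *)
    exists 1%N, (yv o0 * (xv o0 * (xv o1 - xv o2))), ((- 2%:R^-1)%:MP).
    apply: peval_inj => v; have [y [x ->]] := row_mx_surj v.
    rewrite expr1 pevalB (pevalM l) lE pevalM sg1E FE Fval_std !lead2E pevalC !pevalE !row_mxEl !row_mxEr row3E.
    have two : (2%:R : K) != 0 by rewrite pnatr_eq0.
    by field.
  - exists (N + N')%N, (l ^+ N' * R + l ^+ N * R').
    have -> : l ^+ (N + N') * (g + h) - psubst sg1 (l ^+ N' * R + l ^+ N * R') =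
        l ^+ N' * (l ^+ N * g - psubst sg1 R) + l ^+ N * (l ^+ N' * h - psubst sg1 R').
      by rewrite psubstD !psubstM !sgl exprD; ring.
    by apply: dividesD; apply: dividesMl.
  exists (N + N')%N, (R * R').
  have -> : l ^+ (N + N') * (g * h) - psubst sg1 (R * R') =
      (l ^+ N' * h) * (l ^+ N * g - psubst sg1 R) + psubst sg1 R * (l ^+ N' * h - psubst sg1 R').
    by rewrite psubstM exprD; ring.
  by apply: dividesD; apply: dividesMl.
have l1n0 : l1 != 0 by exact: mpolyX_neq0.
have l2n0 : l2 != 0.
  apply/eqP => l20; have := congr1 (fun g => peval g (row_mx 0 (row3 1 0 0))) l20.
  by rewrite /l2 !pevalE !row_mxEr !row3E subr0 => /eqP; rewrite oner_eq0.
have [N [R [k kE]]] := red H.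
have R0 : psubst sg1 R = 0.
  apply: (@mpoly_mul_eq0_eval _ _ l); last by rewrite mulf_neq0.
  move=> v; have [y [x ->]] := row_mx_surj v; rewrite lE => lx.
  (* This a gives the point of F = 0 the prescribed first coordinate y_0. *)
  rewrite sg1E; pose a := y 0 o0 / qform q1std x x.
  have q1x : qform q1std x x != 0 by rewrite qform_q1std oppr_eq0 mulf_neq0 ?pnatr_eq0.
  have := congr1 (fun g => peval g (row_mx (row3 (a * qform q1std x x) (- (a * qform q0std x x)) (y 0 o2)) x)) kE.
  rewrite pevalB !pevalM H0 mulr0 sub0r FE lead2_cone Fval_zpt mulr0 sg1E !row3E /a divfK //.
  by move/eqP; rewrite oppr_eq0 => /eqP.
rewrite R0 subr0 in kE.
have cancel1 g : divides F (l1 * g) -> divides F g.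
  pose pi (i : 'I_(3 + 3)) := if i == rshift 3 o1 then 0 else X i.
  have piE h y x : peval (psubst pi h) (row_mx y x) = peval h (row_mx y (row3 (x 0 o0) 0 (x 0 o2))).
    rewrite peval_psubst; congr peval; apply/rowP => i; rewrite mxE /pi.
    case: (split_ordP i) => j ->; first by rewrite eq_lrshift pevalX !row_mxEl.
    rewrite row_mxEr (inj_eq (@rshift_inj _ _)).
    by case: (ord3P j) => -> /=; rewrite ?pevalX ?peval0 ?row_mxEr row3E.
  apply: (@divides_cancel _ _ _ _ pi) => //.
  - move=> i; rewrite /pi; case: eqP => [->|_]; last by exists 0; rewrite subrr mul0r.
    by exists 1; rewrite subr0 mul1r.
  - by rewrite /l1 psubstX /pi eqxx.
  apply/eqP => F0; have := congr1 (fun g => peval g (row_mx (row3 1 0 0) (row3 1 0 1))) F0.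
  rewrite peval0 piE FE Fval_std !lead2E !row3E => /eqP.
  by rewrite !mul0r subr0 sub0r !mul1r mulrN1 oppr_eq0 pnatr_eq0.
have cancel2 g : divides F (l2 * g) -> divides F g.
  pose pi (i : 'I_(3 + 3)) := if i == rshift 3 o0 then X (rshift 3 o2) else X i.
  have piE h y x : peval (psubst pi h) (row_mx y x) = peval h (row_mx y (row3 (x 0 o2) (x 0 o1) (x 0 o2))).
    rewrite peval_psubst; congr peval; apply/rowP => i; rewrite mxE /pi.
    case: (split_ordP i) => j ->; first by rewrite eq_lrshift pevalX !row_mxEl.
    rewrite row_mxEr (inj_eq (@rshift_inj _ _)).
    by case: (ord3P j) => -> /=; rewrite pevalX row_mxEr row3E.
  apply: (@divides_cancel _ _ _ _ pi) => //.
  - move=> i; rewrite /pi; case: eqP => [->|_]; last by exists 0; rewrite subrr mul0r.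
    by exists 1; rewrite mul1r.
  - apply: peval_inj => v; have [y [x ->]] := row_mx_surj v.
    by rewrite piE /l2 !pevalE !row_mxEr !row3E subrr.
  apply/eqP => F0; have := congr1 (fun g => peval g (row_mx (row3 1 0 0) (row3 0 0 1))) F0.
  rewrite peval0 piE FE Fval_std !lead2E !row3E => /eqP.
  by rewrite !mul0r subr0 sub0r !mul1r mulrN1 oppr_eq0 pnatr_eq0.
have {kE} : divides F (l ^+ N * H) by exists k.
elim: N => [|N IHN]; first by rewrite expr0 mul1r.
by rewrite exprS /l -!mulrA => /cancel1/cancel2; rewrite -/l => /IHN.
Qed.

End StandardCubic.

Lemma sum_delta_mx (K : pzRingType) (W : lmodType K) m n (a : 'I_m) (b : 'I_n)
    (u : 'I_m -> 'I_n -> W) :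
  \sum_i \sum_j (delta_mx a b i j : K) *: u i j = u a b.
Proof.
rewrite (bigD1 a) //= [X in _ + X]big1 ?addr0 => [|i /negPf ia]; last first.
  by rewrite big1 // => j _; rewrite mxE ia scale0r.
rewrite (bigD1 b) //= [X in _ + X]big1 ?addr0 => [|j /negPf jb]; last first.
  by rewrite mxE jb andbF scale0r.
by rewrite mxE !eqxx scale1r.
Qed.

Section Frame.
Variable K : numFieldType.
Variables (p : 'I_4 -> 'rV[K]_3) (f : 'I_6 -> {mpoly K[3]}) (k : option 'I_4).
Hypothesis hf : lin_basis (cubics_through p) f.
Variables (tau : 'I_2 -> {mpoly K[3]}) (chi : 'I_3 -> {mpoly K[3]}).

Definition pvals m n (g : 'I_m -> {mpoly K[n]}) (v : 'rV[K]_n) : 'rV[K]_m :=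
  \row_i peval (g i) v.

(* The divisors of the pencil are the combinations of tau, and their residuals in
   the cubics through p are cut out by chi; so v |-> (tau v, chi v) is the
   embedding of Y in P^1 x P^2. *)
Record frame : Prop := Frame {
  frame_cubic : forall a b, cubics_through p (tau a * chi b);
  frame_free : forall h : 'M[K]_(2, 3),
    (forall v, \sum_i \sum_j h i j * (peval (tau i) v * peval (chi j) v) = 0) -> h = 0;
  frame_pencil : forall D, pencil_member p k D -> exists s, D = lcomb tau s;
  frame_pencil_inv : forall s, s != 0 -> pencil_member p k (lcomb tau s);
  frame_residual : forall D g, pencil_member p k D -> D * g \is 3.-homog ->
    (forall i, ~~ assigned k i -> peval g (p i) = 0) -> exists c, g = lcomb chi c;
  frame_base : forall b i, ~~ assigned k i -> peval (chi b) (p i) = 0;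
  frame_Fval : forall v, Fval (q0std K) (q1std K) (pvals tau v) (pvals chi v) = 0;
  frame_zpt : exists2 m : {mpoly K[3]}, m != 0 &
    forall v, zpt (q0std K) (q1std K) (pvals chi v) = peval m v *: pvals tau v;
  frame_cone : exists2 n : {mpoly K[3]}, n != 0 &
    forall x, exists v c, peval n x *: ((zpt (q0std K) (q1std K) x)^T *m x) =
      c *: ((pvals tau v)^T *m pvals chi v) }.

Hypothesis fr : frame.

Lemma frame_matrix : exists T : 'M[K]_(2 * 3, 6), forall e : 'M_(2, 3),
  lcomb f (mxvec e *m T) = \sum_i \sum_j e i j *: (tau i * chi j).
Proof.
have [i|T TP] := @row_choice K (2 * 3) 6 (fun i r => lcomb f r =
    \sum_a \sum_b vec_mx (delta_mx 0 i) a b *: (tau a * chi b)).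
  have [r ->] : exists r, \sum_a \sum_b vec_mx (delta_mx 0 i) a b *: (tau a * chi b) = lcomb f r.
    apply/hf.1; split.
      by apply: rpred_sum => a _; apply: rpred_sum => b _; apply: rpredZ; case: (frame_cubic fr a b).
    move=> j; rewrite peval_sum big1 // => a _; rewrite peval_sum big1 // => b _.
    by rewrite pevalZ (frame_cubic fr a b).2 mulr0.
  by exists r.
exists T => e; apply: peval_inj => v.
rewrite peval_lcomb; under eq_bigr do rewrite mxvec_mulE.
rewrite peval_sum.
have E (a : 'I_2) (b : 'I_3) : \sum_i T (mxvec_index a b) i * peval (f i) v = peval (tau a * chi b) v.
  have := congr1 (fun g => peval g v) (TP (mxvec_index a b)).
  rewrite peval_lcomb; under eq_bigr do rewrite mxE.
  by move=> ->; rewrite vec_mx_delta sum_delta_mx.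
under eq_bigr do rewrite big_distrl /=.
rewrite exchange_big; apply: eq_bigr => a _ /=.
rewrite peval_sum; under eq_bigr do rewrite big_distrl /=.
rewrite exchange_big; apply: eq_bigr => b _ /=.
by rewrite pevalZ -E big_distrr; apply: eq_bigr => i _ /=; rewrite mulrA.
Qed.

Lemma row_rank1 (e : 'M[K]_(2, 3)) (s : 'rV[K]_2) : s != 0 -> s *m e = 0 ->
  exists (t : 'rV[K]_2) (x : 'rV[K]_3), e = t^T *m x.
Proof.
move=> s0 /matrixP se.
have {}se j : s 0 b0 * e b0 j + s 0 b1 * e b1 j = 0.
  by have := se 0 j; rewrite !mxE sum2E.
have [sb0|sb0] := eqVneq (s 0 b0) 0.
  have sb1 : s 0 b1 != 0.
    apply: contraNneq s0 => sb1; apply/eqP/rowP => i; rewrite mxE.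
    by case: (ord2P i) => ->.
  exists (delta_mx 0 b0), (row b0 e); apply/matrixP => i j; rewrite rank1E !mxE.
  case: (ord2P i) => -> /=; rewrite ?mul1r ?mul0r //.
  by have /eqP := se j; rewrite sb0 mul0r add0r mulf_eq0 (negPf sb1) => /eqP.
exists (\row_i (if i == b0 then - s 0 b1 / s 0 b0 else 1)), (row b1 e).
apply/matrixP => i j; rewrite rank1E !mxE; case: (ord2P i) => -> /=; last by rewrite mul1r.
have -> : e b0 j = - (s 0 b1 * e b1 j) / s 0 b0.
  by apply: (mulIf sb0); rewrite divfK // mulrC; apply/eqP; rewrite -addr_eq0 se.
by rewrite mulrAC !mulNr.
Qed.

(** The products tau_i chi_j form another basis of the cubics, and L is the dual change of
    coordinates, so that f(v) becomes tau(v) (x) chi(v). The hyperplanes through the conic of s .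
    tau are the s (x) c, so its plane consists of the matrices z with s z = 0, which have rank at
    most one. *)
Lemma frame_adapted : exists L, adapted p f k L (q0std K) (q1std K).
Proof.
have [T TE] := frame_matrix.
have peT e v : \sum_i (mxvec e *m T) 0 i * peval (f i) v =
    \sum_i \sum_j e i j * (peval (tau i) v * peval (chi j) v).
  rewrite -peval_lcomb TE peval_sum; apply: eq_bigr => i _; rewrite peval_sum.
  by apply: eq_bigr => j _; rewrite pevalZ pevalM.
have Tfree : row_free T.
  apply: inj_row_free => h hT; have h0 : vec_mx h = 0 :> 'M[K]_(2, 3).
    apply: (frame_free fr) => v; rewrite -peT vec_mxK hT big1 // => i _.
    by rewrite mxE mul0r.
  by rewrite -(vec_mxK h) h0 linear0.
have TV : T *m pinvmx T = 1%:M by exact: mulmxVp.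
have VT : pinvmx T *m T = 1%:M.
  by apply: mulVpmx; move: Tfree; rewrite /row_free /row_full.
pose L : 'M[K]_(2 * 3, 6) := (pinvmx T)^T.
have LT : L *m T^T = 1%:M by rewrite -trmx_mul TV trmx1.
have TL : T^T *m L = 1%:M by rewrite -trmx_mul VT trmx1.
have pair e z : \sum_i (mxvec e *m T) 0 i * (mxvec z *m L) 0 i = \sum_i \sum_j e i j * z i j.
  have -> : \sum_i (mxvec e *m T) 0 i * (mxvec z *m L) 0 i =
      (mxvec e *m (mxvec z)^T) 0 0.
    rewrite -[mxvec e in RHS]mulmx1 -TV -[pinvmx T]trmxK -/L -!mulmxA -trmx_mul mulmxA [RHS]mxE.
    by apply: eq_bigr => i _; rewrite [_^T _ _]mxE.
  by rewrite mxvec_mulE; apply: eq_bigr => i _; apply: eq_bigr => j _; rewrite mxE mxvecE.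
have fE v : \row_i peval (f i) v = sg L (pvals tau v) (pvals chi v).
  suff E : (\row_i peval (f i) v) *m T^T = mxvec ((pvals tau v)^T *m pvals chi v).
    by rewrite /sg -E -mulmxA TL mulmx1.
  apply/rowP => i; case/mxvec_indexP: i => a b; rewrite mxvecE rank1E !mxE.
  have := peT (delta_mx a b) v; rewrite mxvec_delta -rowE.
  under eq_bigr do rewrite mxE.
  have := @sum_delta_mx K K^o _ _ a b (fun i j => peval (tau i) v * peval (chi j) v).
  rewrite /GRing.scale /= => -> <-.
  by apply: eq_bigr => i _; rewrite !mxE mulrC.
exists L; split.
- exact: q0std_sym.
- exact: q1std_sym.
- by apply/row_freeP; exists T^T.
- by move=> v; exists (pvals tau v), (pvals chi v); split=> //; exact: (frame_Fval fr).
- exact: std_divides.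
- move=> g g2 /dP_idealP g0 x.
  have [n n0 nP] := frame_cone fr.
  (* The assertion is put into polynomial form, so that it needs proof only where n does not vanish;
     there the point lies in the image of f up to scalars. *)
  pose G := psubst (cone_param (q0std K) (q1std K)) (Gpoly g L).
  have GE (s : 'rV[K]_2) y : peval G (row_mx s y) = peval g (sg L (s 0 b0 *: zpt (q0std K) (q1std K) y) y).
    by rewrite peval_cone_param peval_Gpoly lead2_cone.
  suff G0 : G = 0.
    have := GE (delta_mx 0 b0) x; rewrite G0 peval0 mxE !eqxx scale1r => <- //.
  apply: (@mpoly_mul_eq0_eval _ _ (psubst (fun j => 'X_(rshift 2 j)) n)).
    move=> v; have [s [y ->]] := row_mx_surj v; rewrite peval_psubst GE.
    have -> : (\row_i peval 'X_(rshift 2 i) (row_mx s y)) = y.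
      by apply/rowP => i; rewrite mxE pevalX row_mxEr.
    move=> ny; have [v' [c E]] := nP y.
    have /eqP : peval n y ^+ 2 * peval g (sg L (zpt (q0std K) (q1std K) y) y) = 0.
      rewrite -(dhomog_pevalZ _ _ g2) /sg scalemxAl -linearZ /= E linearZ /= -scalemxAl.
      by rewrite -/(sg L _ _) -fE (dhomog_pevalZ _ _ g2) g0 mulr0.
    rewrite mulf_eq0 expf_eq0 (negPf ny) /= => /eqP gz.
    by rewrite sgZl (dhomog_pevalZ _ _ g2) gz mulr0.
  apply: contraNneq n0 => n0; apply/eqP/mpoly_eq0_eval => y.
  have := congr1 (fun g => peval g (row_mx (0 : 'rV_2) y)) n0; rewrite peval0 peval_psubst => E.
  by rewrite -[RHS]E; congr peval; apply/rowP => i; rewrite mxE pevalX row_mxEr.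
- move=> g g0; have [m m0 mP] := frame_zpt fr.
  apply: (@mpoly_mul_eq0_eval _ _ m) => // v mv.
  rewrite peval_psubst fE.
  have -> : pvals tau v = (peval m v)^-1 *: zpt (q0std K) (q1std K) (pvals chi v).
    by rewrite mP scalerA mulVf ?scale1r.
  exact: g0.
- move=> v; split=> [[D [Dp Dv]]|[t [x ->]]].
    have [s DE] := frame_pencil fr Dp.
    have s0 : s != 0.
      by case: Dp => D0 _ _; apply: contraNneq D0 => s0; rewrite DE s0 lcomb0.
    pose z : 'M[K]_(2, 3) := vec_mx (v *m T^T).
    have vE : v = mxvec z *m L by rewrite vec_mxK -mulmxA TL mulmx1.
    suff [t [x zE]] : exists (t : 'rV[K]_2) (x : 'rV[K]_3), z = t^T *m x by exists t, x; rewrite vE zE.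
    apply: (row_rank1 s0); apply/rowP => j; rewrite [RHS]mxE mxE.
    have := Dv (mxvec (s^T *m delta_mx 0 j) *m T).
    rewrite {1}vE pair.
    have E (u : 'I_2 -> 'I_3 -> K) : \sum_i \sum_j0 (s^T *m delta_mx 0 j) i j0 * u i j0 =
        \sum_i s 0 i * u i j.
      apply: eq_bigr => i _; rewrite (bigD1 j) //= rank1E mxE !eqxx mulr1 big1 ?addr0 // => b /negPf bj.
      by rewrite rank1E mxE bj andbF mulr0 mul0r.
    rewrite E; apply; exists (chi j); split; last by move=> i; apply: (frame_base fr).
    apply: peval_inj => y; rewrite peval_lcomb peT E DE pevalM peval_lcomb big_distrl.
    by apply: eq_bigr => i _; rewrite mulrA.
  have [s s0 st] : exists2 s : 'rV[K]_2, s != 0 & s 0 b0 * t 0 b0 + s 0 b1 * t 0 b1 = 0.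
    have [->|t0] := eqVneq t 0.
      exists (delta_mx 0 b0); last by rewrite !mxE !mulr0 addr0.
      by apply/eqP => /rowP /(_ b0) /eqP; rewrite !mxE !eqxx oner_eq0.
    exists (\row_i (if i == b0 then t 0 b1 else - t 0 b0)); last by rewrite !mxE /=; ring.
    apply: contraNneq t0 => /rowP s0; apply/eqP/rowP => i; rewrite mxE.
    have := s0 b0; have := s0 b1; rewrite !mxE /= => /eqP; rewrite oppr_eq0 => /eqP t0 t1.
    by case: (ord2P i) => ->.
  have Dp := frame_pencil_inv fr s0; exists (lcomb tau s); split=> // l [g [lE gp]].
  have l3 : lcomb tau s * g \is 3.-homog.
    by rewrite -lE; have [] := (hf.1 (lcomb f l)).2 (ex_intro _ l erefl).
  have [c gE] := frame_residual fr Dp l3 gp.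
  have -> : l = mxvec (s^T *m c) *m T.
    apply/eqP; rewrite -subr_eq0; apply/eqP/hf.2.
    rewrite -scaleN1r lcombD lcombZ scaleN1r lE TE gE; apply/eqP; rewrite subr_eq0; apply/eqP.
    apply: peval_inj => y; rewrite pevalM !peval_lcomb peval_sum big_distrl.
    apply: eq_bigr => i _; rewrite peval_sum big_distrr; apply: eq_bigr => j _ /=.
    by rewrite rank1E pevalZ pevalM; ring.
  rewrite pair; under eq_bigr do under eq_bigr do rewrite !rank1E mulrACA.
  rewrite sum2E -!big_distrr -mulrDl /= st mul0r //.
Qed.

End Frame.

(** * Projective frames and explicit pencils *)

Section ProjectiveFrame.
Variable K : numFieldType.

(** Where D does not vanish, dividing the two scaling laws shows that g scales with weight e, so
    that g agrees there with its component of degree e. *)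
Lemma dhomog_quotient n d e (D g : {mpoly K[n]}) : D != 0 -> D \is d.-homog ->
  D * g \is (d + e).-homog -> g \is e.-homog.
Proof.
move=> D0 Dd Dg.
suff E : pihomog mdeg e g - g = 0 by move/eqP: E; rewrite subr_eq0 => /eqP <-; apply: pihomogP.
apply: (mpoly_mul_eq0_eval _ D0) => z Dz; rewrite pevalB.
rewrite (@peval_pihomog _ _ e g z (peval g z)) ?subrr // => l l0.
apply: (mulfI (x := peval D (l *: z))); first by rewrite (dhomog_pevalZ _ _ Dd) mulf_neq0 ?expf_neq0.
by rewrite -pevalM (dhomog_pevalZ _ _ Dg) (dhomog_pevalZ _ _ Dd) pevalM exprD; ring.
Qed.

(** The rows are the three other points rescaled by the coordinates of p_(i3) with respect to
    them. *)
Lemma projective_frame (p : 'I_4 -> 'rV[K]_3) (i3 : 'I_4) : general_position p ->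
  exists M : 'M[K]_3, [/\ M \in unitmx, p i3 = row3 1 1 1 *m M &
    forall j, exists2 c, c != 0 & row j M = c *: p (lift i3 j)].
Proof.
move=> hp; pose N : 'M[K]_3 := \matrix_(j < 3) p (lift i3 j).
have Nu : N \in unitmx by rewrite -row_free_unit; apply: hp; exact: lift_inj.
pose c := p i3 *m invmx N.
have cE : p i3 = c *m N by rewrite mulmxKV.
have c0 j : c 0 j != 0.
  apply/eqP => cj.
  (* With a zero coordinate at j, the triple in which p_(i3) replaces the j-th point would be
     dependent, against general position. *)
  pose s j' := if j' == j then i3 else lift i3 j'.
  have s_inj : injective s.
    move=> j1 j2; rewrite /s; case: eqP => [->|_]; case: eqP => [->|_] //.
    - by move/eqP; rewrite (negPf (neq_lift _ _)).
    - by move/esym/eqP; rewrite (negPf (neq_lift _ _)).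
    exact: lift_inj.
  have /row_free_inj/(_ (c - delta_mx 0 j) 0) := hp _ s_inj.
  rewrite mul0mx => E.
  have /rowP/(_ j) : c - delta_mx 0 j = 0.
    apply: E; rewrite mulmxBl -rowE rowK /s eqxx cE !mulmx_sum_row -sumrB big1 // => l _.
    rewrite !rowK; case: eqP => [->|_]; last by rewrite subrr.
    by rewrite cj !scale0r subrr.
  by rewrite mxE cj !mxE !eqxx sub0r => /eqP; rewrite oppr_eq0 oner_eq0.
exists (diag_mx c *m N); split.
- rewrite unitmx_mul Nu andbT unitmxE det_diag unitfE.
  by apply/prodf_neq0 => j _; exact: c0.
- rewrite mulmxA cE; congr (_ *m N); apply/rowP => j; rewrite mul_mx_diag mxE.
  by rewrite [in RHS]mxE; case: (ord3P j) => ->; rewrite /l3 /= mul1r.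
by move=> j; exists (c 0 j) => //; rewrite row_mul row_diag_mx -scalemxAl -rowE rowK.
Qed.

End ProjectiveFrame.

Section Coordinates.
Variable K : numFieldType.
Variables (p : 'I_4 -> 'rV[K]_3) (i3 : 'I_4) (M : 'M[K]_3).
Hypothesis Mu : M \in unitmx.
Hypothesis p3E : p i3 = row3 1 1 1 *m M.
Hypothesis pjE : forall j, exists2 c, c != 0 & row j M = c *: p (lift i3 j).

Definition coordX j : {mpoly K[3]} := \sum_k invmx M k j *: 'X_k.

Lemma peval_coordX j x : peval (coordX j) (x *m M) = x 0 j.
Proof.
transitivity ((x *m M *m invmx M) 0 j); last by rewrite mulmxK.
by rewrite peval_sum [RHS]mxE; apply: eq_bigr => k _; rewrite pevalZ pevalX mulrC.
Qed.

Lemma coordX_homog j : coordX j \is 1.-homog.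
Proof. by apply: rpred_sum => i _; apply: rpredZ; rewrite dhomogX /= mdeg1. Qed.

Lemma coord_surj (v : 'rV[K]_3) : exists x : 'rV[K]_3, v = x *m M.
Proof. by exists (v *m invmx M); rewrite mulmxKV. Qed.

Lemma peval_coord_inj (g h : {mpoly K[3]}) :
  (forall x, peval g (x *m M) = peval h (x *m M)) -> g = h.
Proof. by move=> gh; apply: peval_inj => v; have [x ->] := coord_surj v. Qed.

Lemma lift_pointE j : exists c : K, p (lift i3 j) = (c *: delta_mx 0 j) *m M.
Proof.
have [c c0 E] := pjE j; exists c^-1.
by rewrite -scalemxAl -rowE E scalerA mulVf ?scale1r.
Qed.

Lemma peval_row0 d (D : {mpoly K[3]}) j : D \is d.-homog -> peval D (p (lift i3 j)) = 0 ->
  peval D (row j M) = 0.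
Proof. by move=> Dd D0; have [c _ ->] := pjE j; rewrite (dhomog_pevalZ _ _ Dd) D0 mulr0. Qed.

Lemma mulmx_rows (x : 'rV[K]_3) :
  x *m M = x 0 o0 *: row o0 M + x 0 o1 *: row o1 M + x 0 o2 *: row o2 M.
Proof. by rewrite mulmx_sum_row sum3E. Qed.

Lemma conic_expand (D : {mpoly K[3]}) x : D \is 2.-homog -> (forall j, peval D (row j M) = 0) ->
  peval D (x *m M) = x 0 o0 * x 0 o1 * polar D (row o0 M) (row o1 M)
    + x 0 o0 * x 0 o2 * polar D (row o0 M) (row o2 M)
    + x 0 o1 * x 0 o2 * polar D (row o1 M) (row o2 M).
Proof.
move=> D2 D0.
have pevalDD u v : peval D (u + v) = peval D u + peval D v + polar D u v by rewrite /polar; ring.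
rewrite mulmx_rows !pevalDD polarDl // !polarZl // !polarZr // !(dhomog_pevalZ _ _ D2) !D0; ring.
Qed.

Lemma line_expand (D : {mpoly K[3]}) x : D \is 1.-homog ->
  peval D (x *m M) = x 0 o0 * peval D (row o0 M) + x 0 o1 * peval D (row o1 M)
    + x 0 o2 * peval D (row o2 M).
Proof.
case/dhomog1_lcomb => a ->; rewrite mulmx_rows !peval_lcomb !mulr_sumr -!big_split.
by apply: eq_bigr => i _ /=; rewrite !pevalX !mxE; ring.
Qed.

Lemma sumsub_eq0 (a b : K) : a + b = 0 -> a - b = 0 -> a = 0 /\ b = 0.
Proof.
move=> ab /eqP; rewrite subr_eq0 => /eqP E; rewrite E in ab *.
by move/eqP: ab; rewrite -mulr2n mulrn_eq0 /= => /eqP ->.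
Qed.

Definition tau_conic (i : 'I_2) : {mpoly K[3]} :=
  if i == b0 then coordX o1 * (coordX o0 - coordX o2) else coordX o0 * (coordX o1 - coordX o2).

Definition tau_line (i : 'I_2) : {mpoly K[3]} :=
  if i == b0 then coordX o0 - coordX o2 else coordX o1 - coordX o2.

(** The standard Cremona transformation at the three other points. It carries the lines through (1 :
    1 : 1) to the conics through the four points, which is why both kinds of pencil lead to the same
    F. *)
Definition chi_line : 'I_3 -> {mpoly K[3]} :=
  l3 (coordX o1 * coordX o2) (coordX o0 * coordX o2) (coordX o0 * coordX o1).

Lemma peval_tau_conic x : (peval (tau_conic b0) (x *m M) = x 0 o1 * (x 0 o0 - x 0 o2)) *
  (peval (tau_conic b1) (x *m M) = x 0 o0 * (x 0 o1 - x 0 o2)).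
Proof. by rewrite /tau_conic /= !pevalE !peval_coordX. Qed.

Lemma peval_tau_line x : (peval (tau_line b0) (x *m M) = x 0 o0 - x 0 o2) *
  (peval (tau_line b1) (x *m M) = x 0 o1 - x 0 o2).
Proof. by rewrite /tau_line /= !pevalE !peval_coordX. Qed.

Lemma peval_chi_line x : (peval (chi_line o0) (x *m M) = x 0 o1 * x 0 o2) *
  (peval (chi_line o1) (x *m M) = x 0 o0 * x 0 o2) *
  (peval (chi_line o2) (x *m M) = x 0 o0 * x 0 o1).
Proof. by rewrite /chi_line /l3 /= !pevalM !peval_coordX. Qed.

Lemma peval_lcomb2 (t : 'I_2 -> {mpoly K[3]}) (s : 'rV[K]_2) v :
  peval (lcomb t s) v = s 0 b0 * peval (t b0) v + s 0 b1 * peval (t b1) v.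
Proof. by rewrite peval_lcomb sum2E. Qed.

Lemma peval_lcomb3 (t : 'I_3 -> {mpoly K[3]}) (s : 'rV[K]_3) v :
  peval (lcomb t s) v = s 0 o0 * peval (t o0) v + s 0 o1 * peval (t o1) v + s 0 o2 * peval (t o2) v.
Proof. by rewrite peval_lcomb sum3E. Qed.

Lemma point_ind (P : 'rV[K]_3 -> Prop) : P (row3 1 1 1 *m M) ->
  (forall c j, P ((c *: delta_mx 0 j) *m M)) -> forall i, P (p i).
Proof.
move=> P3 Pj i; case: (unliftP i3 i) => [j ->|->]; last by rewrite p3E.
by have [c ->] := lift_pointE j.
Qed.

Lemma tau_conic_point a i : peval (tau_conic a) (p i) = 0.
Proof.
apply: (point_ind (P := fun v => peval (tau_conic a) v = 0)) i => [|c j].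
  by case: (ord2P a) => ->; rewrite peval_tau_conic !row3E; ring.
by case: (ord2P a) => ->; rewrite peval_tau_conic !mxE; case: (ord3P j) => -> /=; ring.
Qed.

Lemma chi_line_point b j : peval (chi_line b) (p (lift i3 j)) = 0.
Proof.
have [c ->] := lift_pointE j.
by case: (ord3P b) => ->; rewrite peval_chi_line !mxE; case: (ord3P j) => -> /=; ring.
Qed.

Lemma tau_line_point a : peval (tau_line a) (p i3) = 0.
Proof. by rewrite p3E; case: (ord2P a) => ->; rewrite peval_tau_line !row3E subrr. Qed.

Lemma tau_conic_homog a : tau_conic a \is 2.-homog.
Proof.
by rewrite /tau_conic; case: ifP => _; apply: (dhomogM (d := 1) (e := 1)); rewrite ?rpredB ?coordX_homog.
Qed.

Lemma tau_line_homog a : tau_line a \is 1.-homog.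
Proof. by rewrite /tau_line; case: ifP => _; rewrite rpredB ?coordX_homog. Qed.

Lemma chi_line_homog b : chi_line b \is 2.-homog.
Proof.
by rewrite /chi_line; case: (ord3P b) => ->; rewrite /l3 /=; apply: (dhomogM (d := 1) (e := 1)); rewrite ?coordX_homog.
Qed.

Lemma frame_conic : frame p None tau_conic coordX.
Proof.
split.
- move=> a b; split; first by apply: (dhomogM (d := 2) (e := 1)); rewrite ?tau_conic_homog ?coordX_homog.
  by move=> i; rewrite pevalM tau_conic_point mul0r.
- move=> h h0; have {}h0 x0 x1 x2 : x1 * (x0 - x2) * (h b0 o0 * x0 + h b0 o1 * x1 + h b0 o2 * x2)
      + x0 * (x1 - x2) * (h b1 o0 * x0 + h b1 o1 * x1 + h b1 o2 * x2) = 0.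
    rewrite -[RHS](h0 (row3 x0 x1 x2 *m M)) sum2E !sum3E !peval_tau_conic !peval_coordX !row3E; ring.
  have [h10 h12] : h b1 o0 = 0 /\ h b1 o2 = 0.
    by apply: sumsub_eq0; [rewrite -[RHS]oppr0 -[in RHS](h0 1 0 1)|rewrite -[RHS](h0 1 0 (-1))]; ring.
  have [h01 h02] : h b0 o1 = 0 /\ h b0 o2 = 0.
    by apply: sumsub_eq0; [rewrite -[RHS]oppr0 -[in RHS](h0 0 1 1)|rewrite -[RHS](h0 0 1 (-1))]; ring.
  have [h00 h11] : h b0 o0 = 0 /\ h b1 o1 = 0.
    apply: sumsub_eq0; [rewrite -[RHS](h0 1 1 0)|rewrite -[RHS]oppr0 -[in RHS](h0 1 (-1) 0)];
    by rewrite h10 h01; ring.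
  by apply/matrixP => i j; rewrite mxE; case: (ord2P i) => ->; case: (ord3P j) => ->.
- move=> D [_ D2 Dp].
  have D0 j : peval D (row j M) = 0 by apply: (peval_row0 D2); apply: Dp.
  have := Dp i3 isT; rewrite p3E (conic_expand _ D2 D0) !row3E !mul1r => S0.
  exists (\row_i (if i == b0 then - polar D (row o1 M) (row o2 M) else - polar D (row o0 M) (row o2 M))).
  apply: peval_coord_inj => x; rewrite peval_lcomb2 !peval_tau_conic (conic_expand _ D2 D0) !mxE /=.
  have -> : polar D (row o0 M) (row o1 M) = - polar D (row o0 M) (row o2 M) - polar D (row o1 M) (row o2 M).
    by apply/eqP; rewrite -subr_eq0 -S0; apply/eqP; ring.
  ring.
- move=> s s0; split.
  + apply: contraNneq s0 => E; apply/eqP/rowP => i; rewrite mxE.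
    have := congr1 (fun g => peval g (row3 1 0 (-1) *m M)) E.
    have := congr1 (fun g => peval g (row3 0 1 (-1) *m M)) E.
    rewrite !peval0 !peval_lcomb2 !peval_tau_conic !row3E.
    case: (ord2P i) => -> E0 E1; [rewrite -E0|rewrite -E1]; ring.
  + by apply: rpred_sum => i _; rewrite rpredZ ?tau_conic_homog.
  + by move=> i _; rewrite peval_lcomb2 !tau_conic_point !mulr0 addr0.
- move=> D g [D0 D2 _] Dg _.
  have /dhomog1_lcomb [a ->] := @dhomog_quotient K 3 2 1 D g D0 D2 Dg.
  exists (a *m M^T); apply: peval_coord_inj => x; rewrite !peval_lcomb.
  transitivity ((a *m (x *m M)^T) 0 0).
    by rewrite mxE; apply: eq_bigr => i _; rewrite pevalX [_^T _ _]mxE.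
  by rewrite trmx_mul mulmxA mxE; apply: eq_bigr => i _; rewrite peval_coordX [_^T _ _]mxE.
- by [].
- move=> v; have [x ->] := coord_surj v.
  by rewrite Fval_std !mxE !peval_tau_conic !peval_coordX; ring.
- exists ((- 2%:R)%:MP); first by rewrite mpolyC_eq0 oppr_eq0 pnatr_eq0.
  move=> v; have [x ->] := coord_surj v; rewrite pevalC zpt_std; congr (_ *: _).
  by apply/rowP => i; rewrite !mxE; case: (ord2P i) => ->; rewrite peval_tau_conic !peval_coordX.
exists 1; first exact: oner_neq0.
move=> x; exists (x *m M), (- 2%:R); rewrite peval1 scale1r zpt_std rank1Zl.
congr (_ *: (_^T *m _)); apply/rowP => i; rewrite !mxE ?peval_coordX //.
by case: (ord2P i) => ->; rewrite peval_tau_conic.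
Qed.

Lemma frame_line : frame p (Some i3) tau_line chi_line.
Proof.
split.
- move=> a b; split; first by apply: (dhomogM (d := 1) (e := 2)); rewrite ?tau_line_homog ?chi_line_homog.
  move=> i; rewrite pevalM; case: (unliftP i3 i) => [j ->|->].
    by rewrite chi_line_point mulr0.
  by rewrite tau_line_point mul0r.
- move=> h h0; have {}h0 x0 x1 x2 :
      (x0 - x2) * (h b0 o0 * (x1 * x2) + h b0 o1 * (x0 * x2) + h b0 o2 * (x0 * x1))
      + (x1 - x2) * (h b1 o0 * (x1 * x2) + h b1 o1 * (x0 * x2) + h b1 o2 * (x0 * x1)) = 0.
    rewrite -[RHS](h0 (row3 x0 x1 x2 *m M)) sum2E !sum3E !peval_tau_line !peval_chi_line !row3E; ring.
  have [h02 h12] : h b0 o2 = 0 /\ h b1 o2 = 0.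
    apply: sumsub_eq0; first by rewrite -[RHS](h0 1 1 0); ring.
    by rewrite -[RHS]oppr0 -[in RHS](h0 1 (-1) 0); ring.
  have h11 : h b1 o1 = 0 by rewrite -[RHS]oppr0 -[in RHS](h0 1 0 1); ring.
  have h00 : h b0 o0 = 0 by rewrite -[RHS]oppr0 -[in RHS](h0 0 1 1); ring.
  have two : (2%:R : K) != 0 by rewrite pnatr_eq0.
  have h01 : h b0 o1 = 0.
    by apply: (mulfI two); rewrite mulr0 -[RHS]oppr0 -[in RHS](h0 1 0 (-1)) h11; ring.
  have h10 : h b1 o0 = 0.
    by apply: (mulfI two); rewrite mulr0 -[RHS]oppr0 -[in RHS](h0 0 1 (-1)) h00; ring.
  by apply/matrixP => i j; rewrite mxE; case: (ord2P i) => ->; case: (ord3P j) => ->.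
- move=> D [_ D1 Dp].
  have := Dp i3 (eqxx _); rewrite p3E (line_expand _ D1) !row3E !mul1r => S0.
  exists (\row_i (if i == b0 then peval D (row o0 M) else peval D (row o1 M))).
  apply: peval_coord_inj => x; rewrite peval_lcomb2 !peval_tau_line (line_expand _ D1) !mxE /=.
  have -> : peval D (row o2 M) = - peval D (row o0 M) - peval D (row o1 M).
    by apply/eqP; rewrite -subr_eq0 -S0; apply/eqP; ring.
  ring.
- move=> s s0; split.
  + apply: contraNneq s0 => E; apply/eqP/rowP => i; rewrite mxE.
    have := congr1 (fun g => peval g (row3 1 0 0 *m M)) E.
    have := congr1 (fun g => peval g (row3 0 1 0 *m M)) E.
    rewrite !peval0 !peval_lcomb2 !peval_tau_line !row3E.
    case: (ord2P i) => -> E0 E1; [rewrite -E1|rewrite -E0]; ring.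
  + by apply: rpred_sum => i _; rewrite rpredZ ?tau_line_homog.
  + by move=> i /eqP ->; rewrite peval_lcomb2 !tau_line_point !mulr0 addr0.
- move=> D g [D0 D1 _] Dg gp.
  have g2 := @dhomog_quotient K 3 1 2 D g D0 D1 Dg.
  have g0 j : peval g (row j M) = 0.
    by apply: (peval_row0 g2); apply: gp; rewrite /= eq_sym neq_lift.
  exists (row3 (polar g (row o1 M) (row o2 M)) (polar g (row o0 M) (row o2 M)) (polar g (row o0 M) (row o1 M))).
  apply: peval_coord_inj => x; rewrite peval_lcomb3 !peval_chi_line (conic_expand _ g2 g0) !row3E; ring.
- move=> b i /=; case: (unliftP i3 i) => [j ->|->]; last by rewrite eqxx.
  by rewrite chi_line_point.
- move=> v; have [x ->] := coord_surj v.
  by rewrite Fval_std !mxE !peval_tau_line !peval_chi_line; ring.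
- exists (2%:R *: (coordX o0 * coordX o1 * coordX o2)).
    apply/eqP => E; have := congr1 (fun g => peval g (row3 1 1 1 *m M)) E.
    rewrite peval0 !pevalE !peval_coordX !row3E !mulr1 => /eqP.
    by rewrite pnatr_eq0.
  move=> v; have [x ->] := coord_surj v; rewrite zpt_std !pevalE !peval_coordX.
  apply/rowP => i; rewrite !mxE !peval_chi_line.
  by case: (ord2P i) => -> /=; rewrite peval_tau_line; ring.
exists ('X_o0 * 'X_o1 * 'X_o2).
  by rewrite !mulf_neq0 ?mpolyX_neq0.
move=> x; exists (row3 (x 0 o1 * x 0 o2) (x 0 o0 * x 0 o2) (x 0 o0 * x 0 o1) *m M), 2%:R.
apply/matrixP => i j; rewrite mxE [RHS]mxE !rank1E !pevalE zpt_std !mxE.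
by case: (ord2P i) => ->; case: (ord3P j) => -> /=;
  rewrite ?peval_tau_line ?peval_chi_line !row3E; ring.
Qed.

End Coordinates.

Lemma adapted_exists (K : numFieldType) (p : 'I_4 -> 'rV[K]_3) (f : 'I_6 -> {mpoly K[3]}) k :
  general_position p -> lin_basis (cubics_through p) f ->
  exists L, adapted p f k L (q0std K) (q1std K).
Proof.
move=> hp hf; case: k => [i3|].
  have [M [Mu p3E pjE]] := projective_frame i3 hp.
  exact: (frame_adapted hf (frame_line Mu p3E pjE)).
have [M [Mu p3E pjE]] := projective_frame ord_max hp.
exact: (frame_adapted hf (frame_conic Mu p3E pjE)).
Qed.

(** * Changing the parametrization of the Segre threefold *)

Section Rank1Preserver.
Variable K : numFieldType.
Implicit Types (B : 'M[K]_3).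

(** Where x B0 is nonzero, x B1 is c(x) times it. For independent images, comparison with x + y
    gives c(x) = c(y), and rank at least two lets any two vectors be linked through a third one. *)
Lemma parallel_matrices B0 B1 :
  (forall x : 'rV_3, exists s0 s1 (w : 'rV_3), x *m B0 = s0 *: w /\ x *m B1 = s1 *: w) ->
  (1 < \rank B0)%N -> exists c, B1 = c *: B0.
Proof.
move=> par rk.
have npar (u : 'rV[K]_3) : exists y : 'rV[K]_3, ~~ (y *m B0 <= u)%MS.
  have /row_subPn [i iu] : ~~ (B0 <= u)%MS.
    by apply: contraL rk => /mxrankS rk; rewrite -leqNgt (leq_trans rk) // rank_leq_row.
  by exists (delta_mx 0 i); rewrite -rowE.
have eig (y : 'rV[K]_3) : y *m B0 != 0 -> exists c, y *m B1 = c *: (y *m B0).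
  move=> y0; have [s0 [s1 [w [E0 E1]]]] := par y.
  have s00 : s0 != 0 by apply: contraNneq y0 => s0E; rewrite E0 s0E scale0r.
  by exists (s1 / s0); rewrite E0 E1 scalerA divfK.
have [x0 x0n] := npar 0.
have x0B : x0 *m B0 != 0 by apply: contraNneq x0n => ->; exact: sub0mx.
have [c xE] := eig _ x0B.
have indep (x y : 'rV[K]_3) : x *m B1 = c *: (x *m B0) -> x *m B0 != 0 ->
    ~~ (y *m B0 <= x *m B0)%MS -> y *m B1 = c *: (y *m B0).
  move=> xc x0' yx.
  have y0 : y *m B0 != 0 by apply: contraNneq yx => ->; rewrite sub0mx.
  have xy0 : (x + y) *m B0 != 0.
    apply: contraNneq yx => /eqP; rewrite mulmxDl addrC addr_eq0 => /eqP ->.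
    by rewrite -scaleN1r scalemx_sub.
  have [d yE] := eig _ y0; have [e xyE] := eig _ xy0.
  have E : (d - e) *: (y *m B0) = (e - c) *: (x *m B0).
    move: xyE; rewrite !mulmxDl xc yE; move: (x *m B0) (y *m B0) => u v /rowP E.
    apply/rowP => j; have := E j; rewrite !mxE => /eqP; rewrite -subr_eq0 => /eqP {}E.
    by apply/eqP; rewrite -subr_eq0 -E; apply/eqP; ring.
  have [de|de] := eqVneq d e.
    move/eqP: E; rewrite de subrr scale0r eq_sym scaler_eq0 (negPf x0') orbF subr_eq0 => /eqP <-.
    by rewrite yE de.
  case/negP: yx; have -> : y *m B0 = ((e - c) / (d - e)) *: (x *m B0).
    by rewrite mulrC -scalerA -E scalerA mulVf ?scale1r // subr_eq0.
  by rewrite scalemx_sub.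
exists c; apply/row_matrixP => i; rewrite linearZ /= !rowE; set y := delta_mx 0 i.
have [yx|] := boolP (y *m B0 <= x0 *m B0)%MS; last exact: indep.
have [z zx] := npar (x0 *m B0); have zE := indep _ _ xE x0B zx.
have: (y + z) *m B1 = c *: ((y + z) *m B0).
  apply: (indep x0) => //; apply: contra zx => H.
  by rewrite -(addKr (y *m B0) (z *m B0)) addmx_sub ?eqmx_opp // -mulmxDl.
by rewrite !mulmxDl scalerDr zE => /addIr.
Qed.

(** A three-dimensional space of 2 x 3 matrices of rank at most one has a fixed left factor s. If
    both B0 and B1 had rank at most one, their kernels, of dimension at least two in a 3-space,
    would meet against injectivity. *)
Lemma factor_parallel B0 B1 :
  (forall x : 'rV_3, exists s0 s1 (w : 'rV_3), x *m B0 = s0 *: w /\ x *m B1 = s1 *: w) ->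
  (forall x : 'rV_3, x *m B0 = 0 -> x *m B1 = 0 -> x = 0) ->
  exists (s : 'rV[K]_2) C, [/\ C \in unitmx, B0 = s 0 b0 *: C & B1 = s 0 b1 *: C].
Proof.
move=> par inj.
have unitC C c0 c1 : B0 = c0 *: C -> B1 = c1 *: C -> C \in unitmx.
  move=> E0 E1; rewrite -row_free_unit; apply: inj_row_free => x xC.
  by apply: inj; rewrite ?E0 ?E1 -scalemxAr xC scaler0.
have [rk0|rk0] := ltnP 1 (\rank B0).
  have [c E1] := parallel_matrices par rk0.
  exists (\row_i (if i == b0 then 1 else c)), B0; rewrite !mxE /= scale1r; split=> //.
  by apply: (unitC _ 1 c); rewrite ?scale1r.
have [rk1|rk1] := ltnP 1 (\rank B1).
  have [|c E0] := @parallel_matrices B1 B0 _ rk1.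
    by move=> x; have [s0 [s1 [w [? ?]]]] := par x; exists s1, s0, w.
  exists (\row_i (if i == b0 then c else 1)), B1; rewrite !mxE /= scale1r; split=> //.
  by apply: (unitC _ c 1); rewrite ?scale1r.
have : (0 < \rank (kermx B0 :&: kermx B1)%MS)%N.
  rewrite -(ltn_add2l (\rank (kermx B0 + kermx B1)%MS)) addn0 mxrank_sum_cap !mxrank_ker.
  apply: leq_ltn_trans (rank_leq_col _) _.
  exact: (leq_add (leq_sub2l 3 rk0) (leq_sub2l 3 rk1)).
rewrite lt0n mxrank_eq0 => /rowV0Pn [x]; rewrite sub_capmx => /andP [/sub_kermxP x0 /sub_kermxP x1].
by rewrite (inj _ x0 x1) eqxx.
Qed.

(** A linear bijection preserving rank one acts separately on the two factors. By [factor_parallel]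
    it sends e_i (x) x to s_i (x) x C_i, and the images of (1, 1) (x) x make x C_0 and x C_1
    parallel, so C_1 is a multiple of C_0, absorbed into s_1. *)
Lemma segre_reparam (L L0 : 'M[K]_(2 * 3, 6)) : row_free L -> row_free L0 ->
  (forall t x, exists t0 x0, sg L t x = sg L0 t0 x0) ->
  exists (a : 'M[K]_2) (b : 'M[K]_3), [/\ a \in unitmx, b \in unitmx &
    forall t x, sg L t x = sg L0 (t *m a) (x *m b)].
Proof.
move=> Lf L0f LL0.
pose Phi (e : 'M[K]_(2, 3)) : 'M[K]_(2, 3) := vec_mx (mxvec e *m L *m pinvmx L0).
have PhiE e : mxvec e *m L = mxvec (Phi e) *m L0.
  by rewrite vec_mxK -mulmxA (L_inv' L0f) mulmx1.
have PhiD e e' : Phi (e + e') = Phi e + Phi e' by rewrite /Phi !linearD /= !mulmxDl linearD.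
have PhiZ c e : Phi (c *: e) = c *: Phi e by rewrite /Phi linearZ /= -!scalemxAl linearZ.
have Phi0 e : Phi e = 0 -> e = 0.
  move=> e0; have := PhiE e; rewrite e0 linear0 mul0mx => eL.
  by rewrite -(mxvecK e) -[mxvec e]mulmx1 -(L_inv Lf) mulmxA eL mul0mx linear0.
have Phi1 (t : 'rV[K]_2) (x : 'rV[K]_3) : exists (t0 : 'rV[K]_2) (x0 : 'rV[K]_3), Phi (t^T *m x) = t0^T *m x0.
  have [t0 [x0 E]] := LL0 t x; exists t0, x0.
  by rewrite /Phi -/(sg L t x) E /sg -mulmxA (L_inv L0f) mulmx1 mxvecK.
pose Bm i l : 'M[K]_3 := \matrix_(j < 3) row l (Phi (delta_mx i j)).
have BmE i l (x : 'rV[K]_3) : x *m Bm i l = row l (Phi ((delta_mx 0 i)^T *m x)).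
  rewrite [in RHS](row_delta_sum x) mulmx_sumr mulmx_sum_row sum3E sum3E !PhiD !rank1Zr !PhiZ.
  rewrite !linearD /= !linearZ /= !rowK.
  by rewrite !trmx_delta !mul_delta_mx.
have fac i : exists (s : 'rV[K]_2) C, [/\ C \in unitmx, Bm i b0 = s 0 b0 *: C & Bm i b1 = s 0 b1 *: C].
  apply: factor_parallel => x.
    have [t0 [x0 E]] := Phi1 (delta_mx 0 i) x; exists (t0 0 b0), (t0 0 b1), x0.
    by rewrite !BmE E; split; apply/rowP => j; rewrite mxE rank1E mxE.
  rewrite !BmE => /rowP r0 /rowP r1.
  have E : (delta_mx 0 i)^T *m x = 0 :> 'M[K]_(2, 3).
    apply: Phi0; apply/matrixP => l j; rewrite [RHS]mxE.
    by case: (ord2P l) => ->; [have := r0 j|have := r1 j]; rewrite !mxE.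
  apply/rowP => j; have /matrixP/(_ i j) := E; rewrite rank1E !mxE !eqxx mul1r //.
have [s0 [C0 [C0u B00 B01]]] := fac b0; have [s1 [C1 [C1u B10 B11]]] := fac b1.
have PhiT (t : 'rV[K]_2) (x y : 'rV[K]_3) : Phi ((t 0 b0 *: delta_mx 0 b0)^T *m x + (t 0 b1 *: delta_mx 0 b1)^T *m y) =
    (t 0 b0 *: s0)^T *m (x *m C0) + (t 0 b1 *: s1)^T *m (y *m C1).
  have H i (s : 'rV[K]_2) C : Bm i b0 = s 0 b0 *: C -> Bm i b1 = s 0 b1 *: C ->
      forall z : 'rV[K]_3, Phi ((delta_mx 0 i)^T *m z) = s^T *m (z *m C).
    move=> E0 E1 z; apply/matrixP => l j; rewrite rank1E.
    have -> : Phi ((delta_mx 0 i)^T *m z) l j = (z *m Bm i l) 0 j by rewrite BmE [RHS]mxE.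
    by case: (ord2P l) => ->; rewrite ?E0 ?E1 -scalemxAr mxE.
  by rewrite PhiD !rank1Zl !PhiZ (H _ _ _ B00 B01) (H _ _ _ B10 B11).
have tsplit (t : 'rV[K]_2) : t 0 b0 *: delta_mx 0 b0 + t 0 b1 *: delta_mx 0 b1 = t.
  by rewrite [RHS]row_delta_sum sum2E.
pose a0 : 'M[K]_2 := \matrix_i (if i == b0 then s0 else s1).
have a0E (r : 'rV[K]_2) : r *m a0 = r 0 b0 *: s0 + r 0 b1 *: s1.
  by rewrite mulmx_sum_row sum2E !rowK.
have a0u : a0 \in unitmx.
  rewrite -row_free_unit; apply: inj_row_free => r ra.
  pose d : 'rV[K]_3 := delta_mx 0 o0.
  have := PhiT r (d *m invmx C0) (d *m invmx C1).
  rewrite !mulmxKV // -rank1Dl -a0E ra trmx0 mul0mx => /Phi0 /matrixP E.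
  have d0 C : C \in unitmx -> d *m invmx C != 0.
    move=> Cu; apply/eqP => dC; have /rowP/(_ o0) : d = 0 by rewrite -(mulmxKV Cu d) dC mul0mx.
    by rewrite !mxE !eqxx => /eqP; rewrite oner_eq0.
  have nz (c : K) (x : 'rV[K]_3) : x != 0 -> (forall j, c * x 0 j = 0) -> c = 0.
    move=> x0 cx; apply/eqP; apply: contraNT x0 => c0; apply/eqP/rowP => j; rewrite mxE.
    by apply: (mulfI c0); rewrite mulr0.
  have rdE (c : K) (l i : 'I_2) : (c *: delta_mx 0 l : 'rV[K]_2) 0 i = c * (i == l)%:R.
    by rewrite !mxE.
  apply/rowP => i; rewrite [RHS]mxE; case: (ord2P i) => ->.
    apply: (nz _ _ (d0 _ C0u)) => j; have := E b0 j.
    by rewrite mxE !rank1E !rdE [RHS]mxE /= mulr1 mulr0 mul0r addr0.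
  apply: (nz _ _ (d0 _ C1u)) => j; have := E b1 j.
  by rewrite mxE !rank1E !rdE [RHS]mxE /= mulr1 mulr0 mul0r add0r.
have par (x : 'rV_3) : exists s0 s1 (w : 'rV_3), x *m C0 = s0 *: w /\ x *m C1 = s1 *: w.
  pose t : 'rV[K]_2 := const_mx 1.
  have [t0 [x0 E]] := Phi1 t x.
  have tE : t^T *m x = (t 0 b0 *: delta_mx 0 b0)^T *m x + (t 0 b1 *: delta_mx 0 b1)^T *m x.
    by rewrite -rank1Dl tsplit.
  rewrite tE PhiT !mxE !scale1r in E.
  exists ((t0 *m invmx a0) 0 b0), ((t0 *m invmx a0) 0 b1), x0.
  have E' : \matrix_i (if i == b0 then x *m C0 else x *m C1) = (t0 *m invmx a0)^T *m x0 :> 'M[K]_(2, 3).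
    have aT : a0^T \in unitmx by rewrite unitmx_tr.
    rewrite trmx_mul -mulmxA -E trmx_inv; apply: (can_inj (mulKmx aT)); rewrite mulKVmx //.
    by apply/matrixP => i j; rewrite [RHS]mxE !rank1E mxE sum2E !mxE.
  by split; apply/rowP => j; [have /matrixP/(_ b0 j) := E'|have /matrixP/(_ b1 j) := E'];
    rewrite rank1E !mxE.
have rk0 : (1 < \rank C0)%N by rewrite mxrank_unit.
have [c C1E] := parallel_matrices par rk0.
have c0 : c != 0.
  apply/eqP => c0; move: C1u; rewrite C1E c0 scale0r unitmxE det0 unitr0 //.
exists (diag_mx (\row_i (if i == b0 then 1 else c)) *m a0), C0; split=> //.
  rewrite unitmx_mul a0u andbT unitmxE det_diag unitfE; apply/prodf_neq0 => i _.
  by rewrite mxE; case: ifP; rewrite ?oner_eq0.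
move=> t x; rewrite /sg PhiE; congr (mxvec _ *m _).
have -> : t^T *m x = (t 0 b0 *: delta_mx 0 b0)^T *m x + (t 0 b1 *: delta_mx 0 b1)^T *m x.
  by rewrite -rank1Dl tsplit.
rewrite PhiT C1E -scalemxAr rank1Zr -rank1Zl -rank1Dl (mulmxA t) a0E.
by congr ((_ + _)^T *m _); rewrite mul_mx_diag !mxE /= ?mulr1 // mulrC scalerA.
Qed.

End Rank1Preserver.

(** * Transport of the coordinates along a change of the two factors *)

Section Reparam.
Variable K : numFieldType.
Variables (a : 'M[K]_2) (b : 'M[K]_3).
Implicit Types (t : 'rV[K]_2) (x y : 'rV[K]_3) (H : {mpoly K[3 + 3]}).

Definition pencil_reparam (q0 q1 : 'M[K]_3) (j : 'I_2) : 'M[K]_3 :=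
  a j b0 *: (b *m q0 *m b^T) + a j b1 *: (b *m q1 *m b^T).

Lemma pencil_reparam_sym q0 q1 j : q0^T = q0 -> q1^T = q1 -> (pencil_reparam q0 q1 j)^T = pencil_reparam q0 q1 j.
Proof.
by move=> s0 s1; rewrite /pencil_reparam raddfD /= !linearZ /= !trmx_mul trmxK s0 s1 !mulmxA.
Qed.

Lemma qform_reparam q0 q1 j x :
  qform (pencil_reparam q0 q1 j) x x = a j b0 * qform q0 (x *m b) (x *m b) + a j b1 * qform q1 (x *m b) (x *m b).
Proof.
have dot_tr (u v : 'rV[K]_3) : dot u v = (u *m v^T) 0 0.
  by rewrite mxE; apply: eq_bigr => i _; rewrite mxE.
rewrite /qform !dot_tr /pencil_reparam mulmxDr -!scalemxAr mulmxDl -!scalemxAl mxE.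
by rewrite !trmx_mul !mulmxA [X in X + _]mxE [X in _ + X]mxE.
Qed.

Lemma Fval_reparam q0 q1 t x :
  Fval (pencil_reparam q0 q1 b0) (pencil_reparam q0 q1 b1) t x = Fval q0 q1 (t *m a) (x *m b).
Proof. by rewrite /Fval !qform_reparam !mxE !sum2E; ring. Qed.

(** [zpt] is the pair of values of q0, q1 at x turned by a quarter, so it changes by the adjugate of
    a; multiplying by a leaves the determinant. *)
Lemma zpt_reparam q0 q1 x :
  zpt (pencil_reparam q0 q1 b0) (pencil_reparam q0 q1 b1) x *m a = \det a *: zpt q0 q1 (x *m b).
Proof.
have e0 : ord0 = b0 by exact: val_inj.
have e1 : ord_max = b1 by exact: val_inj.
apply/rowP => i; rewrite det2E e0 e1 !mxE sum2E !zptE !qform_reparam.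
by case: (ord2P i) => -> /=; ring.
Qed.

Definition reparam (i : 'I_(3 + 3)) : {mpoly K[3 + 3]} :=
  match split i with
  | inl j => l3 (\sum_l a l b0 *: 'X_(lshift 3 (if l == b0 then o0 else o1)))
                (\sum_l a l b1 *: 'X_(lshift 3 (if l == b0 then o0 else o1)))
                'X_(lshift 3 o2) j
  | inr j => \sum_l b l j *: 'X_(rshift 3 l)
  end.

Lemma peval_reparam H y x : peval (psubst reparam H) (row_mx y x) =
  peval H (row_mx (row3 ((lead2 y *m a) 0 b0) ((lead2 y *m a) 0 b1) (y 0 o2)) (x *m b)).
Proof.
rewrite peval_psubst split_rowE; congr (peval H (row_mx _ _)); apply/rowP => i; rewrite mxE.
  rewrite !mxE !sum2E !lead2E; case: (ord3P i) => ->; rewrite /l3 /=;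
  by rewrite ?sum2E !pevalE !row_mxEl; ring.
rewrite peval_sum [RHS]mxE; apply: eq_bigr => l _.
by rewrite pevalZ pevalX row_mxEr mulrC.
Qed.

End Reparam.

Lemma adapted_reparam (K : numFieldType) p (f : 'I_6 -> {mpoly K[3]}) k L0 L q0 q1
    (a : 'M[K]_2) (b : 'M[K]_3) :
  a \in unitmx -> b \in unitmx -> row_free L ->
  (forall t x, sg L t x = sg L0 (t *m a) (x *m b)) ->
  adapted p f k L0 q0 q1 ->
  adapted p f k L (pencil_reparam a b q0 q1 b0) (pencil_reparam a b q0 q1 b1).
Proof.
move=> au bu Lf LE [s0 s1 _ pt dv dP dPi seg].
have da : \det a != 0 by move: au; rewrite unitmxE unitfE.
have LE' t x : sg L0 t x = sg L (t *m invmx a) (x *m invmx b) by rewrite LE !mulmxKV.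
have zE x : zpt q0 q1 x = (\det a)^-1 *: (zpt (pencil_reparam a b q0 q1 b0) (pencil_reparam a b q0 q1 b1) (x *m invmx b) *m a).
  by rewrite zpt_reparam mulmxKV // scalerA mulVf ?scale1r.
split=> //; [exact: pencil_reparam_sym|exact: pencil_reparam_sym| | | | |].
- move=> v; have [t [x [vE F0]]] := pt v; exists (t *m invmx a), (x *m invmx b).
  by rewrite -LE' Fval_reparam !mulmxKV.
- move=> H H0; have [|m mE] := dv (psubst (reparam (invmx a) (invmx b)) H).
    move=> c y2 x; rewrite peval_reparam lead2_cone zE scalerA -scalemxAl mulmxK // row3E.
    rewrite -[RHS](H0 (c / \det a) y2 (x *m invmx b)); congr (peval H (row_mx _ _)).
    by apply/rowP => i; case: (ord3P i) => ->; rewrite !row3E // mxE zptE // mulrN.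
  exists (psubst (reparam a b) m); apply: peval_inj => v; have [y [x ->]] := row_mx_surj v.
  rewrite pevalM peval_Fpoly Fval_reparam.
  set y' := row3 ((lead2 y *m a) 0 b0) ((lead2 y *m a) 0 b1) (y 0 o2).
  have y'E : lead2 y' = lead2 y *m a.
    by apply/rowP => i; case: (ord2P i) => ->; rewrite lead2E row3E.
  have := congr1 (fun g => peval g (row_mx y' (x *m b))) mE.
  rewrite [in X in X = _ -> _]peval_reparam pevalM peval_Fpoly y'E (mulmxK au) (mulmxK bu) [y' 0 o2]row3E.
  have -> : row3 (lead2 y 0 b0) (lead2 y 0 b1) (y 0 o2) = y.
    by apply/rowP => i; case: (ord3P i) => ->; rewrite !row3E ?lead2E.
  by move=> ->; rewrite peval_reparam.
- move=> g g2 g0 x; rewrite LE zpt_reparam sgZl (dhomog_pevalZ _ _ g2).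
  by rewrite dP ?mulr0.
- move=> g g0; apply: dPi => c x; rewrite zE scalerA LE' -scalemxAl mulmxK //.
move=> v; rewrite seg; split=> [[t [x ->]]|[t [x ->]]].
  by exists (t *m invmx a), (x *m invmx b).
by exists (t *m a), (x *m b).
Qed.

(** Both matrices parametrize the same base locus, so they differ by linear changes on the two
    factors, along which all properties are transported. *)
Lemma adapted_of_base_locus (K : numFieldType) p (f : 'I_6 -> {mpoly K[3]}) k L0 L q0 q1 :
  lin_basis (cubics_through p) f ->
  adapted p f k L0 q0 q1 -> base_locus_is_segre (segre_net p f k) L ->
  exists q0' q1', adapted p f k L q0' q1'.
Proof.
move=> hf ad [Lf LN]; have [L0f L0N] := base_locus_adapted ad.
have [t x|a [b [au bu LE]]] := segre_reparam Lf L0f.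
  by apply/L0N/LN; exists t, x.
exists (pencil_reparam a b q0 q1 b0), (pencil_reparam a b q0 q1 b1).
exact: (adapted_reparam au bu Lf LE ad).
Qed.

Theorem theorem1p10 (R : realType)
  (* the surface Y *)
  (p : 'I_4 -> 'rV[R[i]]_3) (hp : general_position p)
  (f : 'I_6 -> {mpoly R[i][3]}) (hf : lin_basis (cubics_through p) f)
  (* the curve C *)
  (Q : {mpoly R[i][6]}) (hQ2 : Q \is 2.-homog) (hQY : ~ dP_ideal f Q)
  (hC : reduced (curve_ideal f Q))
  (* a basis of W, and the planes P_1, .., P_5 *)
  (w : 'I_6 -> {mpoly R[i][6]})
  (hw : lin_basis (quadrics_through (curve_ideal f Q)) w)
  (P : option 'I_4 -> 'M[R[i]]_(3, 6))
  (hP : forall k, net_basis w (segre_net p f k) (P k))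
  (* F_C = P(A) . G is a Morin-Del Pezzo configuration *)
  (A : {vspace ext R[i]})
  (hFC : FC_eq_section P (curve_ideal f Q) w A)
  (hA : morin_del_pezzo P A)
  (* the plane P_u called P_5, and a complement V of U *)
  (u : option 'I_4) (V : 'M[R[i]]_(3, 6)) (hV : row_free (col_mx (P u) V)) :
  (exists L, base_locus_is_segre (segre_net p f u) L) /\
  forall L, base_locus_is_segre (segre_net p f u) L ->
    (forall g, psubst (segre_map L) g = 0 -> curve_ideal f Q g) /\
    (exists b : 'I_3 -> {mpoly R[i][2 + 3]},
       lin_basis (J22 (curve_ideal f Q) L) b) /\
    forall b : 'I_3 -> {mpoly R[i][2 + 3]},
      lin_basis (J22 (curve_ideal f Q) L) b ->
      birational_onto_image (q_times_p b) /\
      exists s, VA_equation A (P u) V s /\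
        exists (swap : bool) (al be : 'M[R[i]]_3),
          [/\ al \in unitmx, be \in unitmx &
              image_is_hypersurface (q_times_p b)
                (psubst (identification swap al be) s)].
Proof.
have adE k := adapted_exists k hp hf.
split.
  by have [L ad] := adE u; exists L; exact: (base_locus_adapted ad).
move=> L hL; have [L0 ad] := adE u.
have [q0 [q1 adL]] := adapted_of_base_locus hf ad hL.
have [hM _ _] := hA.
apply: (theorem_adapted hf hQ2 hQY hw hP hFC hM hV) => [k|]; last by exists q0, q1.
by have [L1 ad1] := adE k; exists L1, (q0std _), (q1std _).
Qed.
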